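(* Let $1\le i\le d-1$ and let $\Sigma\subset \mathrm{GL}(d,\mathbb{R})$ be a compact set. The following four statements are equivalent: (a) The set $\Sigma$ is dominated of index $i$. (b) For every compact Hausdorff space $X$, every homeomorphism $T: X\to X$ and every continuous map $A: X\to \mathrm{GL}(d,\mathbb{R})$ whose image is contained in $\Sigma$, the cocycle $(T,A)$ has a dominated splitting of index $i$. (c) There exists a non-empty subset $C\subset G(i,d)$ that is strictly invariant by $\Sigma$, and there is a $(d-i)$-plane that is transverse to all elements of $C$. (d) There exists a subset $C\subset P\mathbb{R}^d$ that is strictly invariant by $\Sigma$, that contains the projection $PE$ of some $i$-plane $E$ and that does not intersect the projection $PF$ of some $(d-i)$-plane $F$.
   Context: The singular values $\sigma_1(M)\ge\cdots\ge\sigma_d(M)$ of a $d\times d$ matrix $M$ are the eigenvalues of $(M^*M)^{1/2}$. A compact set $\Sigma\subset\mathrm{GL}(d,\mathbb{R})$ is dominated of index $i$ iff there exist $C>0$ and $0<\tau<1$ such that for any finite sequence $A_1,\ldots,A_N$ in $\Sigma$, $$\frac{\sigma_{i+1}(A_1\cdots A_N)}{\sigma_i(A_1\cdots A_N)}<C\tau^N.$$ An $i$-plane is an $i$-dimensional vector subspace of $\mathbb{R}^d$; $G(i,d)$ is the Grassmannian of $i$-planes with its usual topology, on which $\mathrm{GL}(d,\mathbb{R})$ acts naturally; $P\mathbb{R}^d=G(1,d)$. For an $i$-plane or any subspace $E$, $PE\subset P\mathbb{R}^d$ is the set of directions contained in $E$. An $i$-plane and a $(d-i)$-plane are transverse if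 they intersect only at $0$. For $C\subset G(k,d)$ (for any $k$; in particular for $k=i$ and $k=1$), $\Sigma^*C=\{A\cdot E : A\in\Sigma,\ E\in C\}$, and $C$ is strictly invariant by $\Sigma$ if the closure of $\Sigma^*C$ is included in the interior of $C$. For a homeomorphism $T: X\to X$ of a compact Hausdorff space and a continuous map $A: X\to\mathrm{GL}(d,\mathbb{R})$, the cocycle $(T,A)$ is the automorphism $(x,v)\mapsto(T(x),A(x)v)$ of the trivial bundle $X\times\mathbb{R}^d$; write $A^n(x)=A(T^{n-1}x)\cdots A(x)$ for $n\ge 0$. A dominated splitting of index $i$ for $(T,A)$ is a continuous family of splittings $\mathbb{R}^d=E_x\oplus F_x$, $x\in X$, with $\dim E_x=i$ for all $x$, invariant in the sense that $A(x)E_x=E_{T(x)}$ and $A(x)F_x=F_{T(x)}$, such that there are constants $C>0$, $0<\tau<1$ with $$\frac{\|A^n(x)|F_x\|}{\mathfrak{m}(A^n(x)|E_x)}<C\tau^n\quad\text{for all } x\in X,\ n\ge 0,$$ where $\|B\|$ and $\mathfrak{m}(B)$ denote the supremum and infimum of $\|Bv\|$ over unit vectors $v$ in the domain of $B$ (Euclidean norm). *)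

(* Defs.v *)
From HB Require Import structures.
From mathcomp Require Import all_boot all_order all_algebra.
From mathcomp Require Import all_classical all_reals all_analysis.

Set Implicit Arguments.
Unset Strict Implicit.
Unset Printing Implicit Defensive.

Import Order.TTheory GRing.Theory Num.Theory.
Import numFieldNormedType.Exports.
Local Open Scope classical_set_scope.
Local Open Scope ring_scope.

(* Vectors of R^d are columns 'cV[R]_d; a matrix M acts on v by M *m v. *)

Definition GL (R : realType) (d : nat) : set 'M[R]_d :=
  [set M | M \in unitmx].
Arguments GL : clear implicits.

(* Euclidean norm; the library norm on matrices is the sup norm. *)
Definition enorm (R : realType) (d : nat) (v : 'cV[R]_d) : R :=
  Num.sqrt (\sum_(k < d) v k 0 ^+ 2).

Definition psd (R : realType) (d : nat) (S : 'M[R]_d) : Prop :=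
  S^T = S /\ forall v : 'cV[R]_d, 0 <= (v^T *m S *m v) 0 0.

(* The positive semidefinite square root of M; it exists and is unique when
   M is positive semidefinite, the only case used below. *)
Definition psd_sqrt (R : realType) (d : nat) (M : 'M[R]_d) : 'M[R]_d :=
  xget 0 [set S | psd S /\ S *m S = M].

(* The eigenvalues of M, with multiplicity and in nonincreasing order; this
   sequence exists and is unique when M has only real eigenvalues, for
   instance when M is symmetric. *)
Definition eigenvalues (R : realType) (d : nat) (M : 'M[R]_d) : seq R :=
  xget [::] [set s | sorted >=%R s /\
                     char_poly M = \prod_(a <- s) ('X - a%:P)].

(* k is 1-based: singular_value 1 M is the largest one. *)
Definition singular_value (R : realType) (d : nat) (k : nat) (M : 'M[R]_d) : R :=
  nth 0 (eigenvalues (psd_sqrt (M^T *m M))) k.-1.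

Definition dominated (R : realType) (d i : nat) (Sigma : set 'M[R]_d) : Prop :=
  exists C tau : R, [/\ 0 < C, 0 < tau < 1 &
    forall (N : nat) (A : 'I_N -> 'M[R]_d), (1 <= N)%N ->
      (forall k, Sigma (A k)) ->
      singular_value i.+1 (\prod_(k < N) A k) /
        singular_value i (\prod_(k < N) A k) < C * tau ^+ N].

Record grass (R : realType) (d i : nat) := Grass {
  plane :> {vspace 'cV[R]_d};
  _ : \dim plane == i }.

HB.instance Definition _ (R : realType) (d i : nat) :=
  [isSub for @plane R d i].
HB.instance Definition _ (R : realType) (d i : nat) :=
  [Choice of grass R d i by <:].

Definition frame (R : realType) (d : nat) (E : {vspace 'cV[R]_d}) :
    'M[R]_(d, \dim E) :=
  \matrix_(k, j) (tnth (vbasis E) j) k 0.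

(* Orthogonal projection onto E: B (B^T B)^-1 B^T for the matrix B whose
   columns form a basis of E; it does not depend on the basis. *)
Definition oproj (R : realType) (d : nat) (E : {vspace 'cV[R]_d}) : 'M[R]_d :=
  let B := frame E in B *m invmx (B^T *m B) *m B^T.

(* The usual topology of G(i, d), namely the one that makes the injection
   E |-> oproj E into the matrices an embedding. *)
Definition grass_oproj (R : realType) (d i : nat) (E : grass R d i) :
  'M[R]_d := oproj E.

HB.instance Definition _ (R : realType) (d i : nat) :=
  Topological.copy (grass R d i) (initial_topology (@grass_oproj R d i)).
HB.instance Definition _ (R : realType) (d i : nat) :=
  Uniform.copy (grass R d i) (initial_topology (@grass_oproj R d i)).
HB.instance Definition _ (R : realType) (d i : nat) :=
  PseudoMetric.copy (grass R d i) (initial_topology (@grass_oproj R d i)).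

Definition mx_act (R : realType) (d : nat) (M : 'M[R]_d)
    (E : {vspace 'cV[R]_d}) : {vspace 'cV[R]_d} :=
  (linfun (mulmx M : 'cV[R]_d -> 'cV[R]_d) @: E)%VS.

Definition transverse (R : realType) (d : nat) (E F : {vspace 'cV[R]_d}) : Prop :=
  (E :&: F)%VS = 0%VS.

(* P E, as a subset of P R^d = G(1, d). *)
Definition proj_set (R : realType) (d : nat) (E : {vspace 'cV[R]_d}) :
    set (grass R d 1) :=
  [set L | (L <= E)%VS].

(* Sigma^* C. For A in GL(d, R), mx_act A E has the dimension of E. *)
Definition image_family (R : realType) (d k : nat) (Sigma : set 'M[R]_d)
    (C : set (grass R d k)) : set (grass R d k) :=
  [set E' | exists A, Sigma A /\
            exists E, C E /\ plane E' = mx_act A (plane E)].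

Definition strictly_invariant (R : realType) (d k : nat) (Sigma : set 'M[R]_d)
    (C : set (grass R d k)) : Prop :=
  closure (image_family Sigma C) `<=` interior C.

Definition homeomorphism (X : topologicalType) (T : X -> X) : Prop :=
  continuous T /\
  exists S : X -> X, [/\ continuous S, cancel T S & cancel S T].

Fixpoint cocycle (R : realType) (d : nat) (X : Type) (T : X -> X)
    (A : X -> 'M[R]_d) (n : nat) (x : X) : 'M[R]_d :=
  if n is m.+1 then A (iter m T x) *m cocycle T A m x else 1%:M.

Definition unit_image_norms (R : realType) (d : nat) (M : 'M[R]_d)
    (E : {vspace 'cV[R]_d}) : set R :=
  [set enorm (M *m v) | v in [set v | v \in E /\ enorm v = 1]].

Definition norm_on (R : realType) (d : nat) (M : 'M[R]_d)
    (E : {vspace 'cV[R]_d}) : R := sup (unit_image_norms M E).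

Definition conorm_on (R : realType) (d : nat) (M : 'M[R]_d)
    (E : {vspace 'cV[R]_d}) : R := inf (unit_image_norms M E).

(* The dimension of F x is forced by the splitting; it is put in the type so
   that continuity makes sense. *)
Definition has_dominated_splitting (R : realType) (d i : nat)
    (X : topologicalType) (T : X -> X) (A : X -> 'M[R]_d) : Prop :=
  exists (E : X -> grass R d i) (F : X -> grass R d (d - i)),
    [/\ continuous E /\ continuous F,
        (forall x, (E x + F x)%VS = fullv /\ (E x :&: F x)%VS = 0%VS),
        (forall x, mx_act (A x) (E x) = E (T x) /\
                   mx_act (A x) (F x) = F (T x)) &
        exists C tau : R, [/\ 0 < C, 0 < tau < 1 &
          forall x n, norm_on (cocycle T A n x) (F x) /
                      conorm_on (cocycle T A n x) (E x) < C * tau ^+ n]].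

(* Main.v *)
(* Everything goes through cones of vectors: has_cone asks for a set of vectors
   that Sigma maps strictly inside itself, that contains an i-plane E and misses a
   (d - i)-plane F.  By compactness of the Grassmannian, (c) and (d) both give such
   a cone, with a uniform margin delta.

   Take u in the cone and v with w v outside it for a word w.  Along w the set of t
   with u + t v in the cone expands at a definite rate, but it can never exceed a
   multiple of |u| / |v|; hence |w v| |u| <= c rho^n |w u| |v|.  With the min-max
   characterization of singular values this is (a).  It also makes the planes
   A^n(T^-n x) E and A^n(x)^-1 F converge uniformly, to a dominated splitting: this
   is (b).  Conversely (b) for the full shift over Sigma gives (a) by min-max.

   The hard step is (a) => (c).  For a long word A let U(A) be its plane of leading
   left singular vectors and S(A) the orthogonal of its leading right singular
   vectors.  When A is prolonged to A' A, S(A) moves by O(tau^n), and A maps U(B),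
   for any long word B, O(tau^n)-close to U(A).  Comparing the determinant of the
   projection U(B) -> S(A)^perp before and after prolonging A shows that it loses at
   most a factor 1 - O(tau^n), while at a fixed length of A it is bounded below
   uniformly in B.  So U(B) and S(A) are uniformly transverse, and the planes that
   are uniformly transverse to all S(A) form the core of an attractor block. *)

Require Import Defs.
From mathcomp Require Import all_boot all_order all_algebra.
From mathcomp Require Import all_classical all_reals all_analysis.
From mathcomp Require Import perm.
From mathcomp Require Import ring lra.
Import Order.TTheory GRing.Theory Num.Theory.
Import numFieldNormedType.Exports.
Set Implicit Arguments.
Unset Strict Implicit.
Unset Printing Implicit Defensive.
Local Open Scope classical_set_scope.
Local Open Scope ring_scope.

(** * The Euclidean norm *)

Section EuclideanNorm.
Variable R : realType.
Implicit Types d m n : nat.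

(** The determinant is used in the hard step because it is multiplicative. The smallest singular
    value of U(B) -> S(A)^perp, which is the quantity wanted, would lose a fixed factor under every
    composition. The determinant is instead compared through exact matrix identities, in which the
    large and uncontrolled diagonal factors cancel. Only factors 1 - O(tau^n) remain, and their
    product converges. Nothing is lost at the end: for a contraction, |det| is a lower bound for the
    smallest singular value. Cones consist of vectors, although (c) speaks of planes, because the
    expansion of slopes is an argument about two vectors. The price is that a small displacement of
    one vector of a plane has to be extended to a small displacement of the whole plane; a rank-one
    perturbation of the identity does this. The constant in the definition of domination may be
    large, so domination says nothing about short words. Hence the threshold length for uniform
    transversality, and hence an invariant family that cannot simply be the set of uniformly
    transverse planes. *)

Definition dot d (x y : 'cV[R]_d) : R := (x^T *m y) 0 0.

Lemma dotE d (x y : 'cV[R]_d) : dot x y = \sum_k x k 0 * y k 0.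
Proof. by rewrite /dot mxE; apply: eq_bigr => k _; rewrite mxE. Qed.

Lemma dotC d (x y : 'cV[R]_d) : dot x y = dot y x.
Proof. by rewrite !dotE; apply: eq_bigr => k _; rewrite mulrC. Qed.

Lemma dotDl d (x y z : 'cV[R]_d) : dot (x + y) z = dot x z + dot y z.
Proof. by rewrite /dot linearD mulmxDl mxE. Qed.

Lemma dotZl d a (x y : 'cV[R]_d) : dot (a *: x) y = a * dot x y.
Proof. by rewrite /dot linearZ -scalemxAl mxE. Qed.

Lemma dotDr d (x y z : 'cV[R]_d) : dot z (x + y) = dot z x + dot z y.
Proof. by rewrite /dot mulmxDr mxE. Qed.

Lemma dotZr d a (x y : 'cV[R]_d) : dot y (a *: x) = a * dot y x.
Proof. by rewrite /dot -scalemxAr mxE. Qed.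

Lemma dotBl d (x y z : 'cV[R]_d) : dot (x - y) z = dot x z - dot y z.
Proof. by rewrite dotDl -scaleN1r dotZl mulN1r. Qed.

Lemma dotBr d (x y z : 'cV[R]_d) : dot z (x - y) = dot z x - dot z y.
Proof. by rewrite dotDr -scaleN1r dotZr mulN1r. Qed.

Lemma dot_mulmx m n (A : 'M[R]_(m, n)) x y : dot x (A *m y) = dot (A^T *m x) y.
Proof. by rewrite /dot trmx_mul trmxK mulmxA. Qed.

Lemma enorm_ge0 d (x : 'cV[R]_d) : 0 <= enorm x.
Proof. exact: sqrtr_ge0. Qed.
Hint Resolve enorm_ge0 : core.

Lemma enorm_sqr d (x : 'cV[R]_d) : enorm x ^+ 2 = dot x x.
Proof.
rewrite /enorm sqr_sqrtr; last by apply: sumr_ge0 => k _; exact: sqr_ge0.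
by rewrite dotE; apply: eq_bigr => k _; rewrite expr2.
Qed.

Lemma enorm_eq0 d (x : 'cV[R]_d) : (enorm x == 0) = (x == 0).
Proof.
apply/idP/eqP => [|->]; last first.
  by rewrite /enorm big1 ?sqrtr0// => k _; rewrite mxE expr0n.
rewrite -(sqrf_eq0 (enorm x)) enorm_sqr dotE psumr_eq0 => [|k _]; last first.
  by rewrite -expr2 sqr_ge0.
move/allP => h; apply/matrixP => k j; rewrite ord1 mxE.
by have := h k (mem_index_enum _); rewrite -expr2 sqrf_eq0 => /eqP.
Qed.

Lemma enorm0 d : enorm (0 : 'cV[R]_d) = 0.
Proof. by apply/eqP; rewrite enorm_eq0. Qed.

Lemma enorm_gt0 d (x : 'cV[R]_d) : (0 < enorm x) = (x != 0).
Proof. by rewrite lt_def enorm_eq0 enorm_ge0 andbT. Qed.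

Lemma enormZ d a (x : 'cV[R]_d) : enorm (a *: x) = `|a| * enorm x.
Proof.
apply/eqP; rewrite -(eqrXn2 (n := 2))// ?mulr_ge0//.
by rewrite exprMn !enorm_sqr dotZl dotZr mulrA -expr2 real_normK// num_real.
Qed.

Lemma enormN d (x : 'cV[R]_d) : enorm (- x) = enorm x.
Proof. by rewrite -scaleN1r enormZ normrN1 mul1r. Qed.

Lemma enorm_distC d (x y : 'cV[R]_d) : enorm (x - y) = enorm (y - x).
Proof. by rewrite -enormN opprB. Qed.

Lemma dot_le d (x y : 'cV[R]_d) : dot x y <= enorm x * enorm y.
Proof.
have [->|y0] := eqVneq y 0.
  by rewrite enorm0 mulr0 /dot mulmx0 mxE.
have [->|x0] := eqVneq x 0.
  by rewrite enorm0 mul0r /dot trmx0 mul0mx mxE.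
have := sqr_ge0 (enorm (enorm y *: x - enorm x *: y)).
rewrite enorm_sqr -scaleNr dotDl !dotDr !dotZl !dotZr (dotC y x) -!enorm_sqr.
move=> h; have p : 0 < enorm x * enorm y by rewrite mulr_gt0 ?enorm_gt0.
rewrite -(ler_pM2l p); nra.
Qed.

Lemma enorm_triangle d (x y : 'cV[R]_d) : enorm (x + y) <= enorm x + enorm y.
Proof.
rewrite -ler_sqr ?nnegrE ?addr_ge0// enorm_sqr dotDl !dotDr (dotC y x).
rewrite sqrrD -!enorm_sqr; have := dot_le x y; lra.
Qed.

Lemma enorm_triangleB d (x y : 'cV[R]_d) : enorm (x - y) <= enorm x + enorm y.
Proof. by rewrite -(enormN y) enorm_triangle. Qed.

Lemma enorm_dist d (x y : 'cV[R]_d) : enorm x - enorm y <= enorm (x - y).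
Proof. by rewrite lerBlDr -{1}(subrK y x) enorm_triangle. Qed.

Lemma enorm_pythagoras d (x y : 'cV[R]_d) : dot x y = 0 ->
  enorm (x + y) ^+ 2 = enorm x ^+ 2 + enorm y ^+ 2.
Proof. by move=> h; rewrite !enorm_sqr dotDl !dotDr (dotC y x) h addr0 add0r. Qed.

Lemma entry_le_enorm d (x : 'cV[R]_d) k : `|x k 0| <= enorm x.
Proof.
rewrite -ler_sqr ?nnegrE// real_normK ?num_real// enorm_sqr dotE (bigD1 k)//=.
by rewrite -expr2 lerDl sumr_ge0// => j _; rewrite -expr2 sqr_ge0.
Qed.

Lemma enorm_le_sum d (x : 'cV[R]_d) : enorm x <= \sum_k `|x k 0|.
Proof.
rewrite -ler_sqr ?nnegrE ?sumr_ge0// enorm_sqr dotE [leRHS]expr2 mulr_suml.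
apply: ler_sum => k _; rewrite -expr2 -real_normK ?num_real// expr2.
by rewrite ler_wpM2l// (bigD1 k)//= lerDl sumr_ge0.
Qed.

(** The topology of matrices comes from the entrywise sup norm, whereas all estimates use the
    Euclidean operator norm. This bound and [entry_le_op] convert one into the other; the factor
    [m * n] is crude but harmless. *)
Lemma enorm_mulmx_le m n (M : 'M[R]_(m, n)) (e : R) x : 0 <= e ->
  (forall i j, `|M i j| <= e) -> enorm (M *m x) <= (m * n)%:R * e * enorm x.
Proof.
move=> e0 h; apply: (le_trans (enorm_le_sum _)).
have hk k : `|(M *m x) k 0| <= n%:R * (e * enorm x).
  rewrite mxE mulr_natl; apply: (le_trans (ler_norm_sum _ _ _)).
  rewrite -[leRHS](_ : \sum_(j < n) e * enorm x = _); last by rewrite sumr_const card_ord.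
  apply: ler_sum => j _.
  by rewrite normrM ler_pM//; exact: entry_le_enorm.
apply: (le_trans (ler_sum _ (fun k _ => hk k))).
by rewrite sumr_const card_ord natrM -!mulrA [leRHS]mulr_natl.
Qed.

Lemma enorm_delta d (j : 'I_d) : enorm (delta_mx j 0 : 'cV[R]_d) = 1.
Proof.
rewrite /enorm (bigD1 j)//= mxE !eqxx/= expr1n big1 ?addr0 ?sqrtr1// => k kj.
by rewrite mxE (negPf kj) expr0n.
Qed.

Lemma entry_le_op m n (M : 'M[R]_(m, n)) (a : R) :
  (forall x, enorm (M *m x) <= a * enorm x) -> forall i j, `|M i j| <= a.
Proof.
move=> h i j; have -> : M i j = (M *m (delta_mx j 0 : 'cV_n)) i 0 by rewrite -colE mxE.
by apply: (le_trans (entry_le_enorm _ _)); rewrite (le_trans (h _))// enorm_delta mulr1.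
Qed.

Lemma mulmx_ext m n (A B : 'M[R]_(m, n)) :
  (forall x : 'cV_n, A *m x = B *m x) -> A = B.
Proof.
move=> h; apply/matrixP => i j; have := h (delta_mx j 0); rewrite -!colE.
by move=> /matrixP/(_ i 0); rewrite !mxE.
Qed.

Lemma unitmx_inj d (M : 'M[R]_d) :
  (forall x : 'cV_d, M *m x = 0 -> x = 0) -> M \in unitmx.
Proof.
move=> h; rewrite -unitmx_tr -row_free_unit -kermx_eq0.
apply/eqP/row_matrixP => k; rewrite row0; apply: trmx_inj; rewrite trmx0; apply: h.
by apply: trmx_inj; rewrite trmx_mul trmxK -row_mul mulmx_ker row0 trmx0.
Qed.

Lemma enorm_iso m n (W : 'M[R]_(m, n)) x : W^T *m W = 1%:M ->
  enorm (W *m x) = enorm x.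
Proof.
move=> h; apply/eqP; rewrite -(eqrXn2 (n := 2))// !enorm_sqr dot_mulmx mulmxA h.
by rewrite mul1mx.
Qed.

Lemma dot_eq d (x y : 'cV[R]_d) : (forall z, dot z x = dot z y) -> x = y.
Proof.
move=> h; apply/eqP; rewrite -subr_eq0 -enorm_eq0 -sqrf_eq0 enorm_sqr.
by rewrite dotDr h -scaleN1r dotZr mulN1r subrr.
Qed.

Section Projection.
Variables (d : nat) (P : 'M[R]_d).
Hypothesis symP : P^T = P.
Hypothesis idemP : P *m P = P.

Lemma proj_pythagoras x : enorm x ^+ 2 = enorm (P *m x) ^+ 2 + enorm (x - P *m x) ^+ 2.
Proof.
rewrite -enorm_pythagoras; first by rewrite addrC subrK.
by rewrite dotC dot_mulmx symP mulmxBr mulmxA idemP subrr /dot trmx0 mul0mx mxE.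
Qed.

Lemma proj_le x : enorm (P *m x) <= enorm x.
Proof. by rewrite -ler_sqr ?nnegrE// (proj_pythagoras x) lerDl sqr_ge0. Qed.

Lemma coproj_le x : enorm (x - P *m x) <= enorm x.
Proof. by rewrite -ler_sqr ?nnegrE// (proj_pythagoras x) lerDr sqr_ge0. Qed.

Lemma proj_best x y : P *m y = y -> enorm (x - P *m x) <= enorm (x - y).
Proof.
move=> hy; suff -> : x - P *m x = (x - y) - P *m (x - y) by exact: coproj_le.
by rewrite mulmxBr hy opprB addrA addrNK.
Qed.

End Projection.
End EuclideanNorm.
#[global] Hint Extern 0 (is_true (0 <= enorm _)) => (apply: enorm_ge0) : core.

(** * Subspaces and the gap between them *)

Section Planes.
Variables (R : realType) (d : nat).
Implicit Types (E F G : {vspace 'cV[R]_d}) (M : 'M[R]_d) (x y : 'cV[R]_d).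

Lemma frame_mulmx E (z : 'cV[R]_(\dim E)) :
  frame E *m z = \sum_j z j 0 *: (vbasis E)`_j.
Proof.
apply/matrixP => k l; rewrite ord1 mxE summxE; apply: eq_bigr => j _.
by rewrite !mxE (tnth_nth 0) mulrC.
Qed.

Lemma frame_inj E (z : 'cV[R]_(\dim E)) : frame E *m z = 0 -> z = 0.
Proof.
rewrite frame_mulmx => h; have /freeP fr := basis_free (vbasisP E).
by apply/matrixP => j l; rewrite ord1 mxE (fr (fun j => z j 0)).
Qed.

Lemma frame_img E x : x \in E -> exists z, x = frame E *m z.
Proof.
move=> xE; exists (\col_j coord (vbasis E) j x).
rewrite frame_mulmx {1}(coord_vbasis xE); apply: eq_bigr => j _.
by rewrite mxE.
Qed.

Lemma frame_mem E z : frame E *m z \in E.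
Proof.
rewrite frame_mulmx; apply: rpred_sum => j _; apply: rpredZ.
by apply: vbasis_mem; apply: mem_nth; rewrite size_tuple.
Qed.

Lemma gram_unit E : (frame E)^T *m frame E \in unitmx.
Proof.
apply: unitmx_inj => z h; apply: frame_inj; apply/eqP.
by rewrite -enorm_eq0 -sqrf_eq0 enorm_sqr dot_mulmx mulmxA h /dot trmx0 mul0mx mxE.
Qed.

Lemma oproj_mem E x : oproj E *m x \in E.
Proof. by rewrite /oproj -!mulmxA; exact: frame_mem. Qed.

Lemma oproj_id E x : x \in E -> oproj E *m x = x.
Proof.
move=> /frame_img [z ->]; rewrite /oproj -!mulmxA (mulmxA (frame E)^T).
by rewrite mulKmx// gram_unit.
Qed.

Lemma oproj_idP E x : reflect (oproj E *m x = x) (x \in E).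
Proof. by apply: (iffP idP) => [/oproj_id//|<-]; exact: oproj_mem. Qed.

Lemma oproj_sym E : (oproj E)^T = oproj E.
Proof.
by rewrite /oproj !trmx_mul trmxK trmx_inv trmx_mul trmxK mulmxA.
Qed.

Lemma oproj_idem E : oproj E *m oproj E = oproj E.
Proof.
by rewrite /oproj -!mulmxA; congr (_ *m _); rewrite (mulmxA _ (frame E)) mulKmx ?gram_unit.
Qed.

Lemma oproj_tr E : \tr (oproj E) = (\dim E)%:R.
Proof. by rewrite /oproj mxtrace_mulC mulmxA mulmxV ?gram_unit// mxtrace1. Qed.

Definition oprojP := (oproj_sym, oproj_idem).

Lemma oproj_le E x : enorm (oproj E *m x) <= enorm x.
Proof. by apply: proj_le; rewrite oprojP. Qed.

Lemma oproj_best E x y : y \in E -> enorm (x - oproj E *m x) <= enorm (x - y).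
Proof. by move=> /oproj_id; apply: proj_best; rewrite oprojP. Qed.

Definition range_space (P : 'M[R]_d) : {vspace 'cV[R]_d} :=
  limg (linfun (mulmx P : 'cV[R]_d -> 'cV[R]_d)).

Lemma mem_mx_act M E x : x \in E -> M *m x \in mx_act M E.
Proof.
move=> xE; rewrite /mx_act.
by have := memv_img (linfun (mulmx M : 'cV[R]_d -> 'cV[R]_d)) xE; rewrite lfunE.
Qed.

Lemma mx_actP M E y : reflect (exists2 x, x \in E & y = M *m x) (y \in mx_act M E).
Proof.
apply: (iffP idP) => [/memv_imgP[x xE ->]|[x xE ->]]; last exact: mem_mx_act.
by exists x => //; rewrite lfunE.
Qed.

Lemma mx_act_mul M N E : mx_act (M *m N) E = mx_act M (mx_act N E).
Proof.
apply/vspaceP => y; apply/mx_actP/mx_actP => [[x xE ->]|[z /mx_actP[x xE ->] ->]].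
  by exists (N *m x); [exact: mem_mx_act | rewrite mulmxA].
by exists x => //; rewrite mulmxA.
Qed.

Lemma mx_act1 E : mx_act 1%:M E = E.
Proof.
apply/vspaceP => y; apply/mx_actP/idP => [[x xE ->]|yE]; first by rewrite mul1mx.
by exists y => //; rewrite mul1mx.
Qed.

Lemma mulmx_inj M x : M \in unitmx -> M *m x = 0 -> x = 0.
Proof. by move=> Mu h; rewrite -(mulKmx Mu x) h mulmx0. Qed.

Lemma dim_mx_act M E : M \in unitmx -> \dim (mx_act M E) = \dim E.
Proof.
move=> Mu; rewrite /mx_act limg_dim_eq//.
apply/eqP; rewrite -subv0; apply/subvP => x; rewrite memv_cap memv_ker lfunE/= memv0.
by move=> /andP[_ /eqP /(mulmx_inj Mu) ->].
Qed.

Lemma mx_actKV M E : M \in unitmx -> mx_act M (mx_act (invmx M) E) = E.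
Proof. by move=> Mu; rewrite -mx_act_mul mulmxV// mx_act1. Qed.

Lemma mem_mx_act_inv M E y : M \in unitmx -> (y \in mx_act (invmx M) E) = (M *m y \in E).
Proof.
move=> Mu; apply/mx_actP/idP => [[x xE ->]|h]; first by rewrite mulKVmx.
by exists (M *m y) => //; rewrite mulKmx.
Qed.

Lemma transverseP E F : transverse E F <-> (forall x, x \in E -> x \in F -> x = 0).
Proof.
split=> [h x xE xF|h].
  by apply/eqP; rewrite -memv0 -h memv_cap xE.
apply/eqP; rewrite -subv0; apply/subvP => x; rewrite memv_cap memv0.
by move=> /andP[xE xF]; rewrite (h x).
Qed.

Lemma dim_cV : \dim {: 'cV[R]_d} = d.
Proof. by rewrite dimvf /dim /= muln1. Qed.

Lemma transverse_full E F : transverse E F -> (\dim E + \dim F)%N = d ->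
  (E + F)%VS = fullv.
Proof.
move=> h hd; have := dimv_sum_cap E F; rewrite h dimv0 addn0 hd => hs.
by apply/eqP; rewrite eqEdim subvf/= dim_cV hs.
Qed.

Lemma transverse_decomp E F x : transverse E F -> (\dim E + \dim F)%N = d ->
  exists e f, [/\ e \in E, f \in F & x = e + f].
Proof.
move=> h hd; have : x \in (E + F)%VS by rewrite transverse_full// memvf.
by move=> /memv_addP[e eE [f fF ->]]; exists e, f.
Qed.

Lemma meet_nonzero E F : (d < \dim E + \dim F)%N ->
  exists x, [/\ x != 0, x \in E & x \in F].
Proof.
move=> h; have h0 : (E :&: F)%VS != 0%VS.
  apply: contraTneq h => /transverseP/transverseP h; rewrite -leqNgt.
  have := dimv_sum_cap E F; rewrite h dimv0 addn0 => <-.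
  by apply: leq_trans (dimvS (subvf _)) _; rewrite dim_cV.
exists (vpick (E :&: F)%VS); rewrite vpick0 h0.
by have := memv_pick (E :&: F)%VS; rewrite memv_cap => /andP[-> ->].
Qed.

Lemma nonzero_mem E : (0 < \dim E)%N -> exists2 x, x != 0 & x \in E.
Proof.
move=> h; exists (vpick E); last exact: memv_pick.
by rewrite vpick0 -dimv_eq0 -lt0n.
Qed.

(** One half of the aperture metric: the operator norm of (1 - P_F) P_E is at most [a]. Being
    one-sided, it can be checked by exhibiting for each vector of E a nearby vector of F
    ([gapI]). *)
Definition gap (a : R) E F := forall x, x \in E -> enorm (x - oproj F *m x) <= a * enorm x.

Lemma gapI a E F :
  (forall x, x \in E -> exists2 y, y \in F & enorm (x - y) <= a * enorm x) ->
  gap a E F.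
Proof. by move=> h x /h[y yF]; apply: le_trans; exact: oproj_best. Qed.

Lemma gap_trans a b E F G : 0 <= b -> gap a E F -> gap b F G -> gap (a + b) E G.
Proof.
move=> b0 h1 h2; apply: gapI => x xE; exists (oproj G *m (oproj F *m x)).
  exact: oproj_mem.
rewrite -[x - _](subrKA (oproj F *m x)) mulrDl; apply: (le_trans (enorm_triangle _ _)).
apply: lerD; first exact: h1.
by apply: (le_trans (h2 _ (oproj_mem _ _))); rewrite ler_wpM2l// oproj_le.
Qed.

Lemma gap_le a b E F : a <= b -> gap a E F -> gap b E F.
Proof. by move=> ab h x /h /le_trans -> //; rewrite ler_wpM2r. Qed.

Lemma gap_eq E F : \dim E = \dim F -> (forall e : R, 0 < e -> gap e E F) -> E = F.
Proof.
move=> hd h; apply/eqP; rewrite eqEdim hd leqnn andbT; apply/subvP => x xE.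
apply/oproj_idP; apply/eqP; rewrite eq_sym -subr_eq0 -enorm_eq0 eq_le enorm_ge0 andbT.
apply/ler_addgt0Pr => e e0; rewrite add0r.
apply: (le_trans (h (e / (1 + enorm x)) _ x xE)).
  by rewrite divr_gt0// ltr_pwDl.
by rewrite -mulrA ger_pMr// mulrC ler_pdivrMr ?ltr_pwDl// mul1r lerDr.
Qed.

Lemma gap_oproj a E F : 0 <= a -> gap a E F -> gap a F E ->
  forall x, enorm ((oproj E - oproj F) *m x) <= (a + a) * enorm x.
Proof.
move=> a0 h1 h2 x.
have -> : (oproj E - oproj F) *m x =
   oproj E *m (x - oproj F *m x) - (oproj F *m x - oproj E *m (oproj F *m x)).
  by rewrite mulmxBl mulmxBr opprB addrA subrK.
apply: (le_trans (enorm_triangleB _ _)); rewrite mulrDl; apply: lerD; last first.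
  apply: (le_trans (h2 _ (oproj_mem _ _))); rewrite ler_wpM2l//; exact: oproj_le.
(* x -> E (x - F x) is the transpose of y -> E y - F (E y), which h1 bounds. *)
set z := x - _; set w := oproj E *m z.
have : enorm w ^+ 2 <= a * enorm x * enorm w.
  have -> : enorm w ^+ 2 = dot x (w - oproj F *m w).
    rewrite enorm_sqr {1}/w -{1}oproj_sym -dot_mulmx oproj_id ?oproj_mem//.
    by rewrite /z dotBl dotBr (dot_mulmx (oproj F)) oproj_sym.
  apply: (le_trans (dot_le _ _)); rewrite (mulrC a) -mulrA ler_wpM2l//.
  exact: h1 _ (oproj_mem _ _).
have [->|w0] := eqVneq w 0; first by rewrite enorm0 mulr_ge0.
by rewrite expr2 ler_pM2r// enorm_gt0.
Qed.

Lemma gap_of_oproj a E F :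
  (forall x, enorm ((oproj E - oproj F) *m x) <= a * enorm x) -> gap a E F.
Proof. by move=> h x xE; rewrite -{1}(oproj_id xE) -mulmxBl. Qed.

Lemma grass_dim k (E : grass R d k) : \dim E = k.
Proof. by case: E => E h; exact/eqP. Qed.

Definition act k M (hM : M \in unitmx) (E : grass R d k) : grass R d k :=
  Grass (introT eqP (etrans (dim_mx_act E hM) (grass_dim E))).

Lemma entryB m n (A B : 'M[R]_(m, n)) i j : (A - B) i j = A i j - B i j.
Proof. by rewrite mxE [X in _ + X]mxE. Qed.

Lemma grass_ballE k (E F : grass R d k) e :
  ball E e F <-> 0 < e /\ forall a b, `|oproj E a b - oproj F a b| < e.
Proof. by split. Qed.

(** With [gap_ball], the dictionary between the topology of the Grassmannian, given by entries of
    projectors, and two-sided gaps. *)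
Lemma ball_gap k (E F : grass R d k) e : ball E e F ->
  gap ((d * d)%:R * e) E F /\ gap ((d * d)%:R * e) F E.
Proof.
move=> /grass_ballE[/ltW e0 h]; split; apply: gap_of_oproj => x; apply: enorm_mulmx_le => // a b.
  by rewrite entryB ltW.
by rewrite entryB distrC ltW.
Qed.

Lemma gap_ball k (E F : grass R d k) a e : 0 <= a -> a + a < e -> gap a E F -> gap a F E ->
  ball E e F.
Proof.
move=> a0 ae h1 h2; apply/grass_ballE; split=> [|i j].
  by apply: le_lt_trans ae; rewrite addr_ge0.
apply: le_lt_trans ae.
by have := entry_le_op (gap_oproj a0 h1 h2) i j; rewrite entryB.
Qed.

End Planes.

(** * Compactness of the Grassmannian *)

Section MatrixTopology.
Variable R : realType.

Lemma nearbyP (M : pseudoMetricType R) (x : M) (A : set M) :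
  nbhs x A <-> exists2 e : R, 0 < e & forall y, ball x e y -> A y.
Proof. by split=> [/nbhs_ballP|] [e e0 h]; [exists e|apply/nbhs_ballP; exists e]. Qed.

Lemma continuous_mx (T : topologicalType) m n (f : T -> 'M[R]_(m, n)) :
  (forall i j, continuous (fun x => f x i j)) -> continuous f.
Proof.
move=> h x B /nearbyP[e e0 eB]; rewrite nbhs_simpl /=.
have /filter_forall/= : forall i, \forall y \near x, forall j, ball (f x i j) e (f y i j).
  move=> i; apply: filter_forall => j.
  by apply: (h i j x); apply/nbhs_ballP; exists e.
by apply: filterS => y hy; apply: eB.
Qed.

Lemma continuous_sum (T : topologicalType) (I : Type) (r : seq I) (f : I -> T -> R) :
  (forall i, continuous (f i)) -> continuous (fun x => \sum_(i <- r) f i x).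
Proof.
by move=> h; apply: continuous_big => [|i _]; [exact: add_continuous|exact: h].
Qed.

Lemma continuous_mulmx (T : topologicalType) m n p (f : T -> 'M[R]_(m, n))
    (g : T -> 'M[R]_(n, p)) :
  continuous f -> continuous g -> continuous (fun x => f x *m g x).
Proof.
move=> cf cg; apply: continuous_mx => i j.
have -> : (fun x => (f x *m g x) i j) = (fun x => \sum_k f x i k * g x k j).
  by apply/funext => x; rewrite mxE.
apply: continuous_sum => k x; apply: continuousM.
  exact: (continuous_comp (cf x) (@coord_continuous _ _ _ _ _ _)).
exact: (continuous_comp (cg x) (@coord_continuous _ _ _ _ _ _)).
Qed.

Lemma compact_mx_box d : compact [set P : 'M[R]_d | forall i j, `|P i j| <= 1].
Proof.
have -> : [set P : 'M[R]_d | forall i j, `|P i j| <= 1] =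
    vec_mx @` [set v : 'rV[R]_(d * d) | forall i, `[-1, 1]%classic (v ord0 i)].
  apply/seteqP; split=> [P hP|_ [v hv <-] i j]; last first.
    by have := hv (mxvec_index i j); rewrite mxE /= in_itv/= -ler_norml.
  exists (mxvec P); last exact: mxvecK.
  by move=> k /=; case/mxvec_indexP: k => i j; rewrite mxvecE in_itv/= -ler_norml.
apply: continuous_compact; last first.
  by apply: (@rV_compact R _ (fun=> `[-1, 1]%classic)) => _; exact: segment_compact.
apply: continuous_subspaceT; apply: continuous_mx => i j.
rewrite (_ : (fun x => _) = (fun v : 'rV[R]_(d * d) => v 0 (mxvec_index i j))).
  exact: coord_continuous.
by apply/funext => v; rewrite mxE.
Qed.

Lemma clusterP (M : pseudoMetricType R) (F : set_system M) (x : M) :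
  cluster F x <-> forall A e, F A -> 0 < e -> exists2 y, A y & ball x e y.
Proof.
split=> [h A e FA e0|h A B FA /nearbyP[e e0 eB]].
  by have [y []] := h _ _ FA (nbhsx_ballx x e e0); exists y.
by have [y Ay xy] := h A e FA e0; exists y; split=> //; exact: eB.
Qed.

End MatrixTopology.

Section GrassmannianTopology.
Variables (R : realType) (d k : nat).

Lemma oproj_of_projector (P : 'M[R]_d) : P^T = P -> P *m P = P ->
  oproj (range_space P) = P.
Proof.
move=> sP iP; set E := range_space P.
have PE x : x \in E -> P *m x = x.
  by move=> /memv_imgP[y _ ->]; rewrite lfunE/= mulmxA iP.
have mE x : P *m x \in E.
  by apply/memv_imgP; exists x; rewrite ?memvf// lfunE.
have h1 : P *m oproj E = oproj E by apply: mulmx_ext => x; rewrite -mulmxA PE ?oproj_mem.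
have h2 : oproj E *m P = P by apply: mulmx_ext => x; rewrite -mulmxA oproj_id.
by have := congr1 trmx h2; rewrite trmx_mul sP oproj_sym h1.
Qed.

Lemma closed_entry_eq0 m n (f : 'M[R]_d -> 'M[R]_(m, n)) :
  continuous f -> closed [set P | f P = 0].
Proof.
move=> cf; have -> : [set P | f P = 0] = \bigcap_(ij in [set: 'I_m * 'I_n])
    ((fun P => f P ij.1 ij.2) @^-1` [set 0]).
  apply/seteqP; split=> [P /= h ij _|P h]; first by rewrite /= h mxE.
  by apply/matrixP => i j; rewrite mxE; exact: (h (i, j)).
apply: closed_bigI => -[i j] _; apply: preimage_closed; last exact: closed_eq.
move=> P _ /=; exact: (continuous_comp (cf P) (@coord_continuous _ _ _ _ _ _)).
Qed.

(** The trace of an idempotent is its rank, so the rank condition becomes a closed equation like the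
    two others. Entries are bounded by 1 because an orthogonal projector is a contraction. *)
Lemma compact_projectors :
  compact [set P : 'M[R]_d | [/\ P^T = P, P *m P = P & \tr P = k%:R]].
Proof.
apply: (subclosed_compact _ (@compact_mx_box R d)).
  have -> : [set P : 'M[R]_d | [/\ P^T = P, P *m P = P & \tr P = k%:R]] =
     [set P : 'M[R]_d | P^T - P = 0] `&` [set P : 'M[R]_d | P *m P - P = 0] `&`
     [set P : 'M[R]_d | (\tr P - k%:R)%:M = 0 :> 'M[R]_1].
    apply/seteqP; split=> P /=.
      by move=> [-> -> ->]; rewrite !subrr raddf0.
    move=> [[/eqP h1 /eqP h2] /matrixP/(_ 0 0)/eqP]; rewrite !mxE mulr1n => h3.
    by move: h1 h2 h3; rewrite !subr_eq0 => /eqP h1 /eqP h2 /eqP h3.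
  have cid : continuous (@id 'M[R]_d) by move=> x; exact: cvg_id.
  have ct : continuous (fun P : 'M[R]_d => P^T).
    apply: continuous_mx => i j; rewrite (_ : (fun x => _) = (fun P : 'M[R]_d => P j i)).
      exact: coord_continuous.
    by apply/funext => P; rewrite mxE.
  have cB (f g : 'M[R]_d -> 'M[R]_d) : continuous f -> continuous g ->
      continuous (fun P => f P - g P).
    move=> cf cg; apply: continuous_mx => i j P.
    rewrite (_ : (fun x => _) = (fun P => f P i j) \- (fun P => g P i j)).
      apply: continuousB.
        exact: (continuous_comp (cf P) (@coord_continuous _ _ _ _ _ _)).
      exact: (continuous_comp (cg P) (@coord_continuous _ _ _ _ _ _)).
    by apply/funext => Q; rewrite entryB.
  apply: closedI; first apply: closedI.
  - by apply: closed_entry_eq0; exact: cB.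
  - by apply: closed_entry_eq0; apply: cB => //; exact: continuous_mulmx.
  - apply: closed_entry_eq0; apply: continuous_mx => i j P.
    rewrite (_ : (fun x => _) = (fun P : 'M[R]_d => \sum_a P a a) \- (fun=> k%:R)).
      apply: continuousB; last exact: cst_continuous.
      by apply: continuous_sum => a; exact: coord_continuous.
    by apply/funext => Q; rewrite (ord1 i) (ord1 j) mxE eqxx mulr1n.
move=> P [sP iP _] /=; apply: entry_le_op => x.
by rewrite mul1r proj_le.
Qed.

Lemma compact_grass : compact [set: grass R d k].
Proof.
move=> F FF _.
have [|P [[sP iP tP] /clusterP clP]] := @compact_projectors ((@grass_oproj R d k) @ F) _.
  apply: (@filterS _ F _ setT) => [E _|]; last exact: filterT.
  by split; [exact: oproj_sym | exact: oproj_idem | rewrite oproj_tr grass_dim].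
(* The limit projector still has trace [k], and this trace is the dimension of its range. *)
have dE : \dim (range_space P) == k.
  by rewrite -(eqr_nat R) -oproj_tr oproj_of_projector// tP.
exists (Grass dE); split=> //; apply/clusterP => A e FA e0.
have [|_ [E AE <-] hE] := clP ((@grass_oproj R d k) @` A) e _ e0.
  by apply: (@filterS _ F _ A) => // E AE; exists E.
exists E => //; change (ball (oproj (range_space P)) e (oproj E)).
by rewrite oproj_of_projector.
Qed.

End GrassmannianTopology.

(** * Words and strict invariance *)

Section Words.
Variables (R : realType) (d : nat) (Sigma : set 'M[R]_d).

(** Letters are added on the left, as in [cocycle]. The length is an index of the relation since the
    product does not determine it. *)
Inductive word : nat -> 'M[R]_d -> Prop :=
| word0 : word 0 1%:M
| wordS A n M : Sigma A -> word n M -> word n.+1 (A *m M).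

Lemma word1 A : Sigma A -> word 1 A.
Proof. by move=> SA; rewrite -[A]mulmx1; apply: wordS => //; exact: word0. Qed.

Lemma word_cat m n M N : word m M -> word n N -> word (m + n) (M *m N).
Proof.
move=> + hN; elim=> [|A {}m {}M SA _ IH]; first by rewrite mul1mx.
by rewrite -mulmxA; exact: wordS.
Qed.

Lemma word_split m n M : word (m + n) M ->
  exists A B, [/\ word m A, word n B & M = A *m B].
Proof.
elim: m M => [|m IH] M hM.
  by exists 1%:M, M; rewrite mul1mx; split=> //; exact: word0.
rewrite addSn in hM; inversion_clear hM as [|A ? N SA hN].
have [A' [B [hA hB ->]]] := IH _ hN.
by exists (A *m A'), B; rewrite mulmxA; split=> //; exact: wordS.
Qed.

Lemma word_rcons n M : word n.+1 M -> exists A B, [/\ word n A, Sigma B & M = A *m B].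
Proof.
rewrite -addn1 => /word_split[A [B [hA hB ->]]]; exists A, B; split=> //.
inversion_clear hB as [|B' ? N SB hN]; inversion_clear hN.
by rewrite mulmx1.
Qed.

Lemma word_prod n (A : 'I_n -> 'M[R]_d) : (forall k, Sigma (A k)) ->
  word n (\prod_(k < n) A k).
Proof.
elim: n A => [|n IH] A hA; first by rewrite big_ord0; exact: word0.
by rewrite big_ord_recl; apply: wordS => //; exact: IH.
Qed.

Lemma prod_word n M : word n M ->
  exists2 A : 'I_n -> 'M[R]_d, forall k, Sigma (A k) & M = \prod_(k < n) A k.
Proof.
elim=> [|A {}n {}M SA _ [B hB ->]].
  by exists (fun=> 0); [case | rewrite big_ord0].
exists (fun k => if unlift ord0 k is Some j then B j else A).
  by move=> k; case: (unlift ord0 k).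
rewrite big_ord_recl unlift_none; congr (_ *m _).
by apply: eq_bigr => j _; rewrite liftK.
Qed.

Lemma word_unit n M : Sigma `<=` GL R d -> word n M -> M \in unitmx.
Proof.
move=> hGL; elim=> [|A {}n {}M SA _ IH]; first exact: unitmx1.
by rewrite unitmx_mul IH andbT; exact: hGL.
Qed.

(** Bounds [A] and its inverse at once without mentioning the inverse. *)
Definition bounded_by (K : R) := forall A, Sigma A -> forall x : 'cV_d,
  enorm (A *m x) <= K * enorm x /\ enorm x <= K * enorm (A *m x).

Lemma word_bounded K n M : 0 <= K -> bounded_by K -> word n M -> forall x : 'cV_d,
  enorm (M *m x) <= K ^+ n * enorm x /\ enorm x <= K ^+ n * enorm (M *m x).
Proof.
move=> K0 hK; elim=> [|A {}n {}M SA _ IH] x; first by rewrite mul1mx expr0 mul1r.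
rewrite -mulmxA; have [h1 h2] := IH x; have [h3 h4] := hK _ SA (M *m x).
split; first by rewrite exprS -mulrA (le_trans h3)// ler_wpM2l.
by rewrite exprSr -mulrA (le_trans h2)// ler_wpM2l// exprn_ge0.
Qed.

End Words.

Section Bounds.
Variables (R : realType) (d : nat).

Lemma op_bound m n (M : 'M[R]_(m, n)) :
  exists2 c : R, 0 < c & forall x, enorm (M *m x) <= c * enorm x.
Proof.
pose e := \sum_i \sum_j `|M i j|.
have e0 : 0 <= e by apply: sumr_ge0 => i _; exact: sumr_ge0.
exists ((m * n)%:R * e + 1); first by rewrite ltr_wpDl ?mulr_ge0.
move=> x; rewrite mulrDl mul1r; apply: (le_trans (enorm_mulmx_le x e0 _)).
  move=> i j; rewrite /e (bigD1 i)//= (bigD1 j)//= -addrA lerDl addr_ge0//.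
    by apply: sumr_ge0.
  by apply: sumr_ge0 => k _; exact: sumr_ge0.
by rewrite lerDl.
Qed.

Lemma compact_GL_bounded (Sigma : set 'M[R]_d) :
  Sigma `<=` GL R d -> compact Sigma -> exists2 K, 1 <= K & bounded_by Sigma K.
Proof.
move=> hGL /compact_near_coveringP hK.
(* The bound is sought among integers [n] near infinity, so that compactness reduces the claim to
   one neighbourhood of each [A0]. *)
pose P (n : nat) (A : 'M[R]_d) := forall x : 'cV_d,
  enorm (A *m x) <= n%:R * enorm x /\ enorm x <= n%:R * enorm (A *m x).
have [A0 SA0|N _ hN] := hK nat \oo P _; last first.
  exists (N.+1)%:R; first by rewrite ler1n.
  by move=> A SA; exact: hN N.+1 (leqnSn N) _ SA.
have A0u : A0 \in unitmx := hGL _ SA0.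
have [b b0 hb] := op_bound A0; have [c c0 hc] := op_bound (invmx A0).
pose D : R := (d * d)%:R; have D0 : 0 <= D by [].
(* On this ball |A - A0| is at most 1 and at most 1 / (2 c), where [c] bounds the inverse of [A0].
   Hence |x| <= c |A0 x| <= c |A x| + |x| / 2. *)
pose e := (D + 1)^-1 * Num.min 1 (c + c)^-1.
have e0 : 0 < e by rewrite mulr_gt0 ?invr_gt0 ?ltr_wpDl// lt_min ltr01 invr_gt0 addr_gt0.
have De : D * e <= 1 /\ D * e <= (c + c)^-1.
  have h : D * e <= Num.min 1 (c + c)^-1.
    rewrite /e mulrA ger_pMl ?lt_min ?ltr01 ?invr_gt0 ?addr_gt0//.
    by rewrite ler_pdivrMr ?ltr_wpDl// mul1r lerDl.
  by move: h; rewrite le_min => /andP.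
have [N hN] : exists N : nat, b + 1 + (c + c) <= N%:R.
  by exists (Num.truncn (b + 1 + (c + c))).+1; rewrite ltW// truncnS_gt.
exists (ball A0 e, [set n | (N <= n)%N]) => /=.
  split; first exact: nbhsx_ballx.
  by exists N.
case=> A n [/= hA Nn] x.
have nR : b + 1 + (c + c) <= n%:R by rewrite (le_trans hN)// ler_nat.
have hB : enorm ((A - A0) *m x) <= D * e * enorm x.
  apply: enorm_mulmx_le => [|i j]; first exact: ltW.
  by rewrite entryB distrC ltW//; case: hA => _ /(_ i j).
have hx : enorm x <= c * enorm (A0 *m x) by rewrite -{1}(mulKmx A0u x) hc.
rewrite mulmxBl in hB; have x0 := enorm_ge0 x; split.
  have := enorm_triangle (A *m x - A0 *m x) (A0 *m x); rewrite subrK.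
  have := hb x; nra.
have := enorm_dist (A0 *m x) (A *m x); rewrite enorm_distC.
have y0 := enorm_ge0 (A *m x); set y := enorm (A *m x) in y0 *.
have : D * e * (c + c) <= 1 by rewrite -ler_pdivlMr ?addr_gt0// div1r; case: De.
set a := enorm (A0 *m x) in hx *; set z := enorm x in x0 hx hB *.
move=> h1 h2.
have h3 : D * e * (c + c) * z <= z by rewrite ler_piMl.
have h4 : c * (a - y) <= c * (D * e * z).
  by rewrite ler_pM2l//; apply: le_trans h2 hB.
apply: (@le_trans _ _ ((c + c) * y)); last by rewrite ler_wpM2r//; lra.
lra.
Qed.

End Bounds.

Section StrictInvariance.
Variables (R : realType) (d k : nat) (Sigma : set 'M[R]_d).

Definition uniformly_invariant (C : set (grass R d k)) (delta : R) :=
  forall A E (E' E'' : grass R d k), Sigma A -> C E -> plane E' = mx_act A E ->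
    ball E' delta E'' -> C E''.

(** The closure of the image is compact, as the Grassmannian is, so its inclusion in an open set has
    a uniform radius, as with a Lebesgue number. Conversely, a point of the closure is within half
    the radius of an actual image. *)
Lemma strictly_invariantP (C : set (grass R d k)) :
  strictly_invariant Sigma C <-> exists2 delta, 0 < delta & uniformly_invariant C delta.
Proof.
split=> [hC|[e e0 hC] E clE]; last first.
  have e2 : 0 < e / 2 by rewrite divr_gt0.
  have [E' [[A [SA [E0 [CE0 hE']]]] EE']] := clE _ (nbhsx_ballx E _ e2).
  apply/nearbyP; exists (e / 2) => // E'' EE''.
  apply: (hC A E0 E') => //; rewrite (splitr e); apply: ball_triangle EE''.
  exact: ball_sym.
have cK : compact (closure (image_family Sigma C)).
  by apply: subclosed_compact (@compact_grass R d k) _ => //; exact: closed_closure.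
have /compact_near_coveringP hK := cK.
pose P (e : R) (E : grass R d k) := forall E', ball E e E' -> C E'.
have [E hE|e e0 he] := hK R (0^'+) P _.
- have /nearbyP[e e0 eC] := hC _ hE.
  have e2 : 0 < e / 2 by rewrite divr_gt0.
  exists (ball E (e / 2), [set t | t <= e / 2]) => /=.
    by split; [exact: nbhsx_ballx | exact: nbhs_right_le].
  case=> E1 t [/= EE1 te] E2 E12; apply: eC; rewrite (splitr e).
  by apply: ball_triangle EE1 _; apply: le_ball E12.
- exists (e / 2); first by rewrite divr_gt0.
  move=> A E E' E'' SA CE hE' hball; apply: (he (e / 2)) hball => //=.
  + by rewrite sub0r normrN gtr0_norm ?divr_gt0// gtr_pMr ?invf_lt1// ltr1n.
  + by rewrite divr_gt0.
  + by apply: subset_closure; exists A; split=> //; exists E.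
Qed.

End StrictInvariance.

(** * Strictly invariant cones *)

Section Cones.
Variables (R : realType) (d : nat) (Sigma : set 'M[R]_d).

(** The margin in [coneS] is relative to |A u|, hence compatible with scaling. Negative scalars are
    allowed, so [Cv] is a set of directions and is not assumed convex. *)
Record strict_cone (Cv : set 'cV[R]_d) (delta : R) : Prop := StrictCone {
  cone_gt0 : 0 < delta;
  coneZ : forall c u, c != 0 -> Cv u -> Cv (c *: u);
  coneS : forall A u y, Sigma A -> Cv u ->
    enorm (y - A *m u) <= delta * enorm (A *m u) -> Cv y }.

Variables (Cv : set 'cV[R]_d) (delta : R).
Hypothesis HC : strict_cone Cv delta.

Let delta_gt0 : 0 < delta := cone_gt0 HC.

Lemma cone_act A u : Sigma A -> Cv u -> Cv (A *m u).
Proof.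
by move=> SA Cu; apply: (coneS HC SA Cu); rewrite subrr enorm0 mulr_ge0// ltW.
Qed.

Lemma cone_word n w u : word Sigma n w -> Cv u -> Cv (w *m u).
Proof.
elim=> [|A {}n {}w SA _ IH] Cu; first by rewrite mul1mx.
by rewrite -mulmxA; apply: cone_act => //; exact: IH.
Qed.

(** An image rather than an interior: a point of it carries the letter and the preimage that [coneS]
    asks for. *)
Definition inner x := exists A u, [/\ Sigma A, Cv u & x = A *m u].

Lemma innerW x : inner x -> Cv x.
Proof. by move=> [A [u [SA Cu ->]]]; exact: cone_act. Qed.

Lemma inner_far x y : inner x -> ~ Cv y -> delta * enorm x < enorm (y - x).
Proof.
move=> [A [u [SA Cu ->]]] nCy; rewrite ltNge; apply/negP => h.
exact/nCy/(coneS HC SA Cu).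
Qed.

Lemma coneZ_iff c u : c != 0 -> ~ Cv u -> ~ Cv (c *: u).
Proof.
move=> c0 nC hC; apply: nC; rewrite -[u]scale1r -(mulVf c0) -scalerA.
by apply: (coneZ HC) => //; rewrite invr_eq0.
Qed.

(** If slopes up to r stay in the cone, then delta |t| |V| <= (1 + delta) |U + t V| for |t| <= r.
    The margin delta |U + t V| around U + t V is thus at least kappa |t| |V|, which is room for
    kappa |t| more slope. *)
Definition kappa := delta ^+ 2 / (1 + delta).

Lemma kappa_gt0 : 0 < kappa.
Proof. by rewrite divr_gt0 ?exprn_gt0// addr_gt0. Qed.

(* The segment of slopes t with u + t v in the cone expands at a definite rate:
   Sigma maps it into the inner part, whose delta-neighbourhood is again in the
   cone, and since v stays outside the cone the slopes t that are in the cone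
   remain bounded by a multiple of |u| / |v|. *)
Lemma cone_step A u v r : Sigma A -> 0 <= r ->
  (forall t, `|t| <= r -> Cv (u + t *: v)) -> ~ Cv (A *m v) ->
  (forall t, `|t| <= (1 + kappa) * r -> Cv (A *m u + t *: (A *m v))) /\
  kappa * r * enorm (A *m v) <= enorm (A *m u).
Proof.
move=> SA r0 hC; set U := A *m u; set V := A *m v => nV.
have inU t : `|t| <= r -> inner (U + t *: V).
  by move=> /hC Ct; exists A, (u + t *: v); rewrite mulmxDr -scalemxAr.
have inU0 : inner U by have := inU 0; rewrite normr0 scale0r addr0; exact.
have d1 : 0 < 1 + delta by rewrite addr_gt0.
(* The point - t V lies outside the cone, so its distance |U + t V| to U exceeds delta |U|. The
   triangle inequality trades |U| for |t| |V|. *)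
have bound t : `|t| <= r -> delta * (`|t| * enorm V) <= (1 + delta) * enorm (U + t *: V).
  move=> tr; have [->|t0] := eqVneq t 0.
    by rewrite normr0 mul0r mulr0 mulr_ge0// ltW.
  have Nt0 : - t != 0 by rewrite oppr_eq0.
  have := inner_far inU0 (coneZ_iff Nt0 nV).
  rewrite scaleNr -opprD enormN (addrC (t *: V)).
  have := enorm_dist (t *: V) (- U); rewrite opprK (addrC (t *: V)) enormN enormZ.
  move=> h1 h2; have : delta * (`|t| * enorm V - enorm U) <= delta * enorm (U + t *: V).
    by rewrite ler_pM2l.
  lra.
have bk t : `|t| <= r -> kappa * `|t| * enorm V <= delta * enorm (U + t *: V).
  move=> /bound h; rewrite /kappa expr2 -!mulrA ler_pM2l// mulrCA.
  by rewrite ler_pdivrMl.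
split=> [t ht|].
  have [tr|tr] := leP `|t| r; first exact: innerW (inU _ tr).
  have t0 : 0 < `|t| by exact: le_lt_trans tr.
  (* The end of the segment on the side of [t]: U + t V differs from the inner vector U + s V by
     (|t| - r) |V| <= kappa r |V|, which is within its margin. *)
  pose s := r * (t / `|t|).
  have sr : `|s| = r.
    by rewrite normrM normf_div normr_id divff ?gt_eqF// mulr1 ger0_norm.
  have [B [w [SB Cw e]]] : inner (U + s *: V) by apply: inU; rewrite sr.
  apply: (coneS HC SB Cw); rewrite -e opprD addrACA subrr add0r -scalerBl enormZ.
  have -> : t - s = (`|t| - r) * (t / `|t|).
    by rewrite mulrBl mulrCA divff ?gt_eqF// mulr1.
  rewrite normrM normf_div normr_id divff ?gt_eqF// mulr1.
  rewrite ger0_norm; last by rewrite subr_ge0 ltW.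
  have /bk h : `|s| <= r by rewrite sr.
  apply: le_trans h; rewrite sr ler_wpM2r//; lra.
(* For the second bound, r V is outside the cone and differs from the inner vector U + r V by
   exactly U. *)
have [->|r_neq0] := eqVneq r 0; first by rewrite mulr0 mul0r.
have := inner_far (inU r _) (coneZ_iff r_neq0 nV).
rewrite ger0_norm// => /(_ (lexx _)); rewrite opprD addrCA subrr addr0 enormN => h.
by have := bk r; rewrite ger0_norm// => /(_ (lexx _)) h'; apply: le_trans (ltW h).
Qed.

(** Assuming only the last image of [v] outside the cone is enough: letters preserve the cone, so
    every earlier image is outside too. *)
Lemma cone_iter n w : word Sigma n w -> forall u v r, 0 <= r ->
  (forall t, `|t| <= r -> Cv (u + t *: v)) -> ~ Cv (w *m v) ->
  (forall t, `|t| <= (1 + kappa) ^+ n * r -> Cv (w *m u + t *: (w *m v))).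
Proof.
elim=> [|A {}n {}w SA _ IH] u v r r0 hC nC t.
  by rewrite expr0 mul1r !mul1mx; exact: hC.
rewrite -!mulmxA exprS -mulrA; move: t; rewrite -!mulmxA in nC.
have k0 := kappa_gt0.
apply: (proj1 (cone_step SA _ _ _)) => //.
  by rewrite mulr_ge0// exprn_ge0// addr_ge0// ltW.
by apply: IH => // Cwv; apply: nC; exact: cone_act.
Qed.

Variable K : R.
Hypothesis K1 : 1 <= K.
Hypothesis HK : bounded_by Sigma K.

(** The first and the last letter of a word are spent on opening and on bounding the segment of
    slopes, whence (1 + kappa)^2. The factor K^2 compares u and v with their images under the first
    letter; the second summand K^2 serves words of length 1. *)
Definition cone_const := (K ^+ 2 / (delta * kappa) + K ^+ 2) * (1 + kappa) ^+ 2.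
Definition cone_rate := (1 + kappa)^-1.

Lemma cone_rate_itv : 0 < cone_rate < 1.
Proof.
have k0 := kappa_gt0; rewrite invr_gt0 addr_gt0//= invf_lt1 ?ltrDl//.
by rewrite addr_gt0.
Qed.

Lemma cone_const_ge1 : 1 <= cone_const.
Proof.
have k0 := kappa_gt0.
rewrite -[1]mulr1; apply: ler_pM => //; last by rewrite exprn_ege1// lerDl ltW.
apply: ler_wpDl; last by rewrite exprn_ege1.
by apply: divr_ge0; [rewrite exprn_ge0// (le_trans ler01)|rewrite mulr_ge0// ltW].
Qed.

(** The margin after the first letter [A] allows all slopes up to r = delta |A u| / |A v|. The
    middle letters widen this segment by [cone_iter], and the second half of [cone_step], at the
    last letter, bounds the widened segment by a multiple of |w u| / |w v|. *)
Lemma cone_contract n w u v : word Sigma n w -> Cv u -> ~ Cv (w *m v) ->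
  enorm (w *m v) * enorm u <= cone_const * cone_rate ^+ n * (enorm (w *m u) * enorm v).
Proof.
have k0 := kappa_gt0; have q0 : 0 < 1 + kappa by rewrite addr_gt0.
have K0 : 0 < K by exact: lt_le_trans K1.
case: n => [|n].
  move=> hw; inversion_clear hw => _ _; rewrite !mul1mx expr0 mulr1 mulrC.
  by rewrite ler_peMl ?mulr_ge0// cone_const_ge1.
move=> /word_rcons[w' [A [hw' SA ->]]] Cu; rewrite -!mulmxA => nC.
have [v0|v0] := eqVneq v 0; first by rewrite v0 !mulmx0 enorm0 !(mul0r, mulr0).
have [hu1 hu2] := HK SA u; have [hv1 hv2] := HK SA v.
set u1 := A *m u in hu1 hu2 *; set v1 := A *m v in hv1 hv2 nC *.
have nv : 0 < enorm v by rewrite enorm_gt0.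
have nv1 : 0 < enorm v1 by rewrite -(pmulr_rgt0 _ K0) (lt_le_trans nv).
have Kc : 0 < K ^+ 2 / (delta * kappa) by rewrite divr_gt0 ?exprn_gt0// mulr_gt0.
case: n hw' => [|n] hw'.
  inversion_clear hw'; rewrite !mul1mx expr1 /cone_const /cone_rate expr2.
  rewrite -[X in _ <= X * _]mulrA mulfK ?gt_eqF//.
  have h : enorm v1 * enorm u <= K ^+ 2 * (enorm u1 * enorm v).
    rewrite mulrC expr2 [leRHS](_ : _ = (K * enorm u1) * (K * enorm v)); last by ring.
    exact: ler_pM.
  apply: (le_trans h); rewrite ler_wpM2r ?mulr_ge0//.
  have hK : 0 < K ^+ 2 by rewrite exprn_gt0.
  nra.
pose r := delta * enorm u1 / enorm v1.
have r0 : 0 <= r by rewrite divr_ge0 ?mulr_ge0// ltW.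
have hC1 t : `|t| <= r -> Cv (u1 + t *: v1).
  rewrite /r ler_pdivlMr// => ht; apply: (coneS HC SA Cu).
  by rewrite addrAC subrr add0r enormZ.
inversion hw' as [|B m w2 SB hw2 E1 E2]; subst m w'.
rewrite -!mulmxA in nC *.
have nC2 : ~ Cv (w2 *m v1) by move=> h; apply: nC; exact: cone_act.
have [_] := cone_step SB (mulr_ge0 (exprn_ge0 n (ltW q0)) r0) (cone_iter hw2 r0 hC1 nC2) nC.
set X := enorm (B *m (w2 *m v1)); set Y := enorm (B *m (w2 *m u1)) => h.
have hr : delta * enorm u <= r * (K ^+ 2 * enorm v).
  rewrite /r mulrAC ler_pdivlMr// -!mulrA ler_pM2l//.
  rewrite [leRHS](_ : _ = (K * enorm u1) * (K * enorm v)); last by ring.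
  exact: ler_pM.
have X0 : 0 <= X := enorm_ge0 _.
have Y0 : 0 <= Y := enorm_ge0 _.
have qn : 0 < (1 + kappa) ^+ n by rewrite exprn_gt0.
have h2 : kappa * (1 + kappa) ^+ n * (delta * enorm u) * X <= K ^+ 2 * enorm v * Y.
  apply: (@le_trans _ _ ((kappa * ((1 + kappa) ^+ n * r) * X) * (K ^+ 2 * enorm v))).
    rewrite [leRHS](_ : _ = kappa * (1 + kappa) ^+ n * (r * (K ^+ 2 * enorm v)) * X);
      last by ring.
    rewrite ler_wpM2r//. apply: ler_wpM2l => //; exact: ltW (mulr_gt0 k0 qn).
  rewrite mulrC; apply: ler_wpM2l h; exact: mulr_ge0 (exprn_ge0 _ (ltW K0)) (ltW nv).
have -> : cone_const * cone_rate ^+ n.+2 =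
    (K ^+ 2 / (delta * kappa) + K ^+ 2) / (1 + kappa) ^+ n.
  rewrite /cone_const /cone_rate exprVn (_ : n.+2 = (n + 2)%N); last by rewrite addn2.
  rewrite (exprD _ n 2).
  by rewrite [((1 + kappa) ^+ n * _)^-1]invfM (mulrC ((1 + kappa) ^+ n)^-1) mulrA mulfK// gt_eqF// exprn_gt0.
rewrite mulrAC ler_pdivlMr// mulrDl; apply: ler_wpDr.
  exact: mulr_ge0 (exprn_ge0 _ (ltW K0)) (mulr_ge0 Y0 (ltW nv)).
rewrite [leRHS]mulrAC ler_pdivlMr; last exact: mulr_gt0.
by move: h2; congr (_ <= _); ring.
Qed.

End Cones.

Section ConesAndPlanes.
Variables (R : realType) (d : nat) (Sigma : set 'M[R]_d).
Hypothesis hGL : Sigma `<=` GL R d.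

(* The common form of the families of planes and of lines: a strictly invariant
   set of vectors that contains an i-plane and misses a (d - i)-plane. *)
Definition has_cone (i : nat) := exists Cv delta,
  [/\ strict_cone Sigma Cv delta,
      exists E : grass R d i, forall u, u \in plane E -> u != 0 -> Cv u &
      exists F : grass R d (d - i), forall v, v \in plane F -> ~ Cv v].

(* g = 1 + (y - p) p^T / |p|^2 sends p to y and moves no vector by more than
   the factor |y - p| / |p|. *)
Lemma tilt (p y : 'cV[R]_d) (delta : R) : 0 <= delta -> p != 0 ->
  enorm (y - p) <= delta * enorm p ->
  exists2 g : 'M[R]_d, g *m p = y & forall x, enorm (g *m x - x) <= delta * enorm x.
Proof.
move=> d0 p0 hy; have np : 0 < enorm p by rewrite enorm_gt0.
exists (1%:M + (enorm p ^- 2) *: ((y - p) *m p^T)).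
  rewrite mulmxDl mul1mx -scalemxAl -mulmxA.
  have -> : p^T *m p = (enorm p ^+ 2)%:M.
    by apply/matrixP => a b; rewrite !ord1 [RHS]mxE eqxx mulr1n enorm_sqr.
  rewrite mul_mx_scalar scalerA mulVf ?scale1r; first by rewrite addrC subrK.
  by rewrite expf_neq0// gt_eqF.
move=> x; rewrite mulmxDl mul1mx addrAC subrr add0r -scalemxAl -mulmxA.
have -> : p^T *m x = (dot p x)%:M.
  by apply/matrixP => a b; rewrite !ord1 [RHS]mxE eqxx mulr1n.
rewrite mul_mx_scalar scalerA enormZ normrM normfV.
rewrite (ger0_norm (exprn_ge0 _ _))// mulrC mulrCA mulrC.
have h : `|dot p x| <= enorm p * enorm x.
  rewrite ler_norml dot_le andbT lerNl -mulN1r -dotZl scaleN1r.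
  by rewrite -(enormN p); exact: dot_le.
rewrite ler_pdivrMr ?exprn_gt0//.
rewrite [leRHS](_ : _ = (delta * enorm p) * (enorm p * enorm x)); last by ring.
exact: ler_pM.
Qed.

(** A vector [y] near A u lies in the plane g A E, where [g] is the near-identity of [tilt] with g A
    u = y. This plane is close to A E, hence in [C]. *)
Lemma family_cone k (C : set (grass R d k)) delta0 : 0 < delta0 ->
  uniformly_invariant Sigma C delta0 ->
  exists delta, strict_cone Sigma [set u | u != 0 /\ exists2 E, C E & u \in plane E] delta.
Proof.
(* [delta <= 1/2] makes [g] invertible with |x| <= 2 |g x|, so both gaps between A E and g A E are
   at most 2 delta. [gap_ball] doubles this, and 4 delta < delta0. *)
move=> d0 hC; pose delta := Num.min 2^-1 (delta0 / 5).
have dl : 0 < delta by rewrite lt_min invr_gt0 ltr0n divr_gt0.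
have [dl2 dl5] : delta <= 2^-1 /\ delta <= delta0 / 5.
  have : delta <= delta by []. by rewrite {2}/delta le_min => /andP.
exists delta; split=> // [c u c0 [u0 [E CE uE]]|A u y SA [u0 [E CE uE]] hy].
  by split; [rewrite scaler_eq0 negb_or c0|exists E => //; exact: rpredZ].
have Au := hGL SA; have p0 : A *m u != 0.
  by apply: contra u0 => /eqP /(mulmx_inj Au) ->.
have [g gy hg] := tilt (ltW dl) p0 hy.
have g2 x : enorm x <= 2 * enorm (g *m x).
  have := enorm_dist x (g *m x); rewrite enorm_distC => h.
  have := le_trans h (hg x); have := enorm_ge0 x; nra.
have gu : g \in unitmx.
  apply: unitmx_inj => x gx0; apply/eqP; rewrite -enorm_eq0 eq_le enorm_ge0 andbT.
  by have := g2 x; rewrite gx0 enorm0 mulr0.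
split.
  rewrite -gy; apply: contra p0 => /eqP /(mulmx_inj gu) ->; exact: eqxx.
exists (act gu (act Au E)); last first.
  by rewrite /= -gy; do 2!apply: mem_mx_act.
apply: (hC A E (act Au E)) => //; apply: (@gap_ball _ _ _ _ _ (2 * delta)).
- by rewrite mulr_ge0// ltW.
- lra.
- apply: gapI => x xE; exists (g *m x); first exact: mem_mx_act.
  rewrite enorm_distC (le_trans (hg x))// ler_wpM2r//; lra.
- apply: gapI => _ /mx_actP[x xE ->]; exists x => //.
  apply: (le_trans (hg x)); rewrite -mulrA mulrCA ler_pM2l//.
Qed.

Lemma plane_family_has_cone i :
  (exists C : set (grass R d i),
    [/\ C !=set0, strictly_invariant Sigma C &
        exists F : grass R d (d - i), forall E, C E -> transverse E F]) ->
  has_cone i.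
Proof.
move=> [C [[E CE] /strictly_invariantP[e e0 hC] [F hF]]].
have [delta hcone] := family_cone e0 hC; eexists; exists delta; split; first exact: hcone.
  by exists E => u uE u0; split=> //; exists E.
exists F => v vF [v0 [E' CE' vE']].
by move/transverseP/(_ v vE' vF): (hF _ CE') => /eqP; apply/negP.
Qed.

Lemma vline_dim (u : 'cV[R]_d) : u != 0 -> \dim <[u]>%VS == 1.
Proof. by move=> u0; rewrite dim_vline u0. Qed.

Lemma line_family_has_cone i :
  (exists C : set (grass R d 1),
     [/\ strictly_invariant Sigma C,
         exists E : grass R d i, proj_set E `<=` C &
         exists F : grass R d (d - i), C `&` proj_set F = set0]) ->
  has_cone i.
Proof.
move=> [C [/strictly_invariantP[e e0 hC] [E hE] [F hF]]].
have [delta hcone] := family_cone e0 hC; eexists; exists delta; split; first exact: hcone.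
  exists E => u uE u0; split=> //; exists (Grass (vline_dim u0)); last exact: memv_line.
  by apply: hE; rewrite /proj_set /= -memvE.
exists F => v vF [v0 [L CL vL]].
suff : (C `&` proj_set F) L by rewrite hF.
split=> //; rewrite /proj_set /=; suff <- : <[v]>%VS = plane L by rewrite -memvE.
apply/eqP; rewrite eqEdim -memvE vL dim_vline v0.
by rewrite [X in (X <= _)%N]grass_dim.
Qed.

Lemma has_cone_line_family i : has_cone i ->
  exists C : set (grass R d 1),
     [/\ strictly_invariant Sigma C,
         exists E : grass R d i, proj_set E `<=` C &
         exists F : grass R d (d - i), C `&` proj_set F = set0].
Proof.
move=> [Cv [delta [hcone [E hE] [F hF]]]].
exists [set L | exists2 u, u \in plane L & Cv u]; split.
- apply/strictly_invariantP.
  (* A line at distance less than [e] from A L has gap at most [delta] from it; the projection of A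
     u to that line is the required vector of the cone. *)
  pose e := delta / ((d * d)%:R + 1).
  have e0 : 0 < e by rewrite divr_gt0 ?(cone_gt0 hcone)// ltr_wpDl.
  exists e => // A L L' L'' SA [u uL Cu] hL' /ball_gap[h _].
  exists (oproj L'' *m (A *m u)); first exact: oproj_mem.
  apply: (coneS hcone SA Cu); rewrite enorm_distC.
  have /h : A *m u \in plane L' by rewrite hL'; exact: mem_mx_act.
  move=> /le_trans -> //; rewrite ler_wpM2r// /e mulrA ler_pdivrMr ?ltr_wpDl//.
  by rewrite mulrC ler_pM2l ?(cone_gt0 hcone)// lerDl.
- exists E => L LE; have [|u u0 uL] := @nonzero_mem _ _ L; first by rewrite grass_dim.
  by exists u => //; apply: hE => //; exact: (subvP LE).
- exists F; rewrite -subset0 => L [[u uL Cu] LF].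
  by apply: (hF u) => //; exact: (subvP LF).
Qed.

End ConesAndPlanes.

(** * The real spectral theorem *)

Section Spectral.
Variable R : realType.

Lemma compact_sphere n : compact [set x : 'rV[R]_n | enorm x^T = 1].
Proof.
apply: (@subclosed_compact _ _ [set v : 'rV[R]_n | forall k, `[-1, 1]%classic (v ord0 k)]).
- have -> : [set x : 'rV[R]_n | enorm x^T = 1] =
      (fun x : 'rV[R]_n => dot x^T x^T) @^-1` [set 1].
    apply/seteqP; split=> x /=; first by rewrite -enorm_sqr => ->; rewrite expr1n.
    by rewrite -enorm_sqr => /eqP; rewrite sqrp_eq1 ?enorm_ge0// => /eqP.
  apply: preimage_closed; last exact: closed_eq.
  move=> x _; rewrite (_ : (fun x => _) = (fun x : 'rV[R]_n => \sum_k x 0 k * x 0 k)).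
    apply: continuous_sum => k y; apply: continuousM; exact: coord_continuous.
  by apply/funext => y; rewrite dotE; apply: eq_bigr => k _; rewrite !mxE.
- by apply: (@rV_compact R _ (fun=> `[-1, 1]%classic)) => _; exact: segment_compact.
move=> x /= hx k; rewrite in_itv/= -ler_norml -hx.
by have := entry_le_enorm x^T k; rewrite mxE.
Qed.

(* A maximizer v of the quadratic form on the unit sphere is an eigenvector:
   lambda - S is nonnegative and vanishes at v, so v lies in its kernel. *)
Lemma symmetric_eigenvector n (S : 'M[R]_n.+1) : S^T = S ->
  exists (v : 'cV[R]_n.+1) (lambda : R), enorm v = 1 /\ S *m v = lambda *: v.
Proof.
move=> sS; pose q (x : 'rV[R]_n.+1) := dot x^T (S *m x^T).
have [||v0 /[!inE]/= hv hmax] := compact_EVT_max _ (@compact_sphere n.+1) (f := q).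
- by exists (delta_mx 0 0); rewrite /= trmx_delta enorm_delta.
- apply: continuous_subspaceT => x.
  rewrite (_ : q = (fun x : 'rV[R]_n.+1 => \sum_k x 0 k * \sum_l S k l * x 0 l)).
    apply: continuous_sum => k y; apply: continuousM; first exact: coord_continuous.
    apply: continuous_sum => l z; apply: continuousM; first exact: cst_continuous.
    exact: coord_continuous.
  apply/funext => y; rewrite /q dotE; apply: eq_bigr => k _; rewrite !mxE; congr (_ * _).
  by apply: eq_bigr => l _; rewrite !mxE.
set v := v0^T in hv; exists v, (q v0); split=> //.
pose B (x : 'cV_n.+1) := q v0 *: x - S *m x.
have B0 x : 0 <= dot x (B x).
  have [->|x0] := eqVneq x 0; first by rewrite /dot trmx0 mul0mx mxE.
  have nx : 0 < enorm x by rewrite enorm_gt0.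
  have := hmax ((enorm x)^-1 *: x)^T; rewrite inE /= trmxK enormZ normfV ger0_norm//.
  rewrite mulVf ?gt_eqF// => /(_ erefl); rewrite {1}/q trmxK -scalemxAr dotZl dotZr mulrA.
  rewrite -invfM -expr2 ler_pdivrMl ?exprn_gt0// /B dotBr dotZr -enorm_sqr subr_ge0.
  by rewrite mulrC.
have Bv : dot v (B v) = 0.
  by rewrite /B dotBr dotZr -enorm_sqr hv expr1n mulr1 subrr.
have Bsym x y : dot x (B y) = dot y (B x).
  by rewrite /B !dotBr !dotZr (dotC x y) [dot x (S *m y)]dot_mulmx sS (dotC _ y).
have Blin a x y : B (x + a *: y) = B x + a *: B y.
  by rewrite /B mulmxDr -scalemxAr scalerDr scalerBr !scalerA (mulrC a) opprD addrACA.
have BE : B v = q v0 *: v - S *m v by [].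
clearbody B; have h w : dot w (B v) = 0.
  have key a : 0 <= 2 * a * dot w (B v) + a ^+ 2 * dot w (B w).
    have := B0 (v + a *: w); rewrite Blin dotDl !dotDr !dotZl !dotZr Bv add0r.
    by rewrite (Bsym v w); congr (_ <= _); ring.
  have c0 := B0 w; set b := dot w (B v) in key *; set c := dot w (B w) in c0 key *.
  suff : b = 0 by move=> ->.
  (* A near-minimizer of the quadratic 2 a b + a^2 c, with 1 + c in the denominator because c may
     vanish; its value is negative unless b = 0. *)
  have := key (- b / (1 + c)); have c1 : 0 < 1 + c by rewrite ltr_wpDr.
  have -> : 2 * (- b / (1 + c)) * b + (- b / (1 + c)) ^+ 2 * c =
     - (b ^+ 2 * (2 + c) / (1 + c) ^+ 2) by field; rewrite gt_eqF.
  rewrite oppr_ge0 pmulr_lle0 ?invr_gt0 ?exprn_gt0// pmulr_lle0 ?ltr_wpDr//.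
  by rewrite le_eqVlt ltNge sqr_ge0 orbF sqrf_eq0 => /eqP.
have /eqP : B v = 0 by apply: dot_eq => z; rewrite h /dot mulmx0 mxE.
by rewrite BE subr_eq0 => /eqP ->.
Qed.

(** The reflection along w = v - e_j exchanges v and e_j. As it is its own transpose and inverse,
    conjugation by it keeps symmetric matrices symmetric. *)
Lemma householder n (v : 'cV[R]_n) (j : 'I_n) : enorm v = 1 ->
  exists H : 'M[R]_n, [/\ H^T = H, H *m H = 1%:M & H *m delta_mx j 0 = v].
Proof.
move=> hv; pose w := v - delta_mx j 0.
have [w0|w0] := eqVneq w 0.
  exists 1%:M; rewrite trmx1 !mul1mx; split=> //; apply/eqP.
  by rewrite -subr_eq0 -oppr_eq0 opprB; apply/eqP.
have nw : 0 < enorm w ^+ 2 by rewrite exprn_gt0// enorm_gt0.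
pose c := 2 / enorm w ^+ 2; pose H := 1%:M - c *: (w *m w^T).
have Hx x : H *m x = x - (c * dot w x) *: w.
  rewrite mulmxBl mul1mx -scalemxAl -mulmxA (_ : w^T *m x = (dot w x)%:M).
    by rewrite mul_mx_scalar scalerA.
  by apply/matrixP => a b; rewrite !ord1 [RHS]mxE eqxx mulr1n.
exists H; split.
- by rewrite /H linearB linearZ /= trmx1 trmx_mul trmxK.
- apply: mulmx_ext => x; rewrite mul1mx -mulmxA !Hx dotBr dotZr -enorm_sqr.
  rewrite -[RHS]subr0 -addrA -opprD -scalerDl; congr (_ - _).
  have -> : c * dot w x + c * (dot w x - c * dot w x * enorm w ^+ 2) = 0.
    by rewrite /c; field; rewrite -sqrf_eq0 gt_eqF.
  by rewrite scale0r.
- rewrite Hx; have -> : c * dot w (delta_mx j 0) = -1.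
    set a := dot v (delta_mx j 0).
    have e1 : dot w (delta_mx j 0) = a - 1.
      by rewrite /w dotBl -enorm_sqr enorm_delta expr1n.
    have e2 : enorm w ^+ 2 = - (2 * (a - 1)).
      rewrite enorm_sqr {1}/w dotBl (dotC v) (dotC (delta_mx j 0)) e1.
      rewrite /w dotBl -(enorm_sqr v) hv -/a (dotC _ v) -/a; ring.
    rewrite /c e1 e2; field; apply: contraTneq nw => e3.
    by rewrite e2 e3 mulr0 oppr0 ltxx.
  by rewrite scaleN1r opprK /w addrC subrK.
Qed.

(** Conjugating by the reflection that sends e_0 to a unit eigenvector makes the first column a
    multiple of e_0, and by symmetry the first row as well; induction applies to the remaining
    block. *)
Theorem real_spectral n (S : 'M[R]_n) : S^T = S ->
  exists (P : 'M[R]_n) (t : 'rV[R]_n), P^T *m P = 1%:M /\ S = P *m diag_mx t *m P^T.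
Proof.
elim: n S => [|n IH] S sS.
  by exists 1%:M, 0; split; apply/matrixP => -[].
have [v [lambda [nv Sv]]] := symmetric_eigenvector sS.
have [H [sH HH Hv]] := householder 0 nv.
pose S1 : 'M[R]_(1 + n) := H *m S *m H.
have sS1 : S1^T = S1 by rewrite /S1 !trmx_mul sH sS mulmxA.
have col0 : S1 *m delta_mx 0 0 = lambda *: (delta_mx 0 0 : 'cV_(1 + n)).
  rewrite /S1 -!mulmxA Hv Sv -scalemxAr; congr (_ *: _).
  by rewrite -Hv mulmxA HH mul1mx.
have S1l k : S1 k 0 = lambda * (k == 0)%:R.
  have /matrixP/(_ k 0) := col0; rewrite -colE [LHS]mxE => ->.
  by rewrite [LHS]mxE mxE eqxx andbT.
have eS : S = H *m S1 *m H.
  by rewrite /S1 !mulmxA HH mul1mx -mulmxA HH mulmx1.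
clearbody S1; pose S2 := drsubmx S1.
have [|P [t [oP eS2]]] := IH S2; first by rewrite /S2 trmx_drsub sS1.
have eS1 : S1 = block_mx lambda%:M 0 0 S2.
  rewrite -[LHS]submxK; congr block_mx.
  - apply/matrixP => a b; rewrite !ord1 !mxE/= mulr1n.
    have e : lshift n 0 = 0 :> 'I_(1 + n) by apply: val_inj.
    by rewrite e S1l eqxx mulr1.
  - apply/matrixP => a b; rewrite !mxE -sS1 mxE.
    have -> : lshift n a = 0 :> 'I_(1 + n) by apply: val_inj; rewrite ord1.
    by rewrite S1l; case: eqP => [/(congr1 val)//|]; rewrite mulr0.
  - apply/matrixP => a b; rewrite !mxE.
    have -> : lshift n b = 0 :> 'I_(1 + n) by apply: val_inj; rewrite ord1.
    by rewrite S1l; case: eqP => [/(congr1 val)//|]; rewrite mulr0.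
pose Q : 'M[R]_(1 + n) := block_mx 1%:M 0 0 P.
have QT : Q^T = block_mx 1%:M 0 0 P^T by rewrite /Q tr_block_mx trmx1 !trmx0.
pose T : 'rV[R]_(1 + n) := row_mx lambda%:M t.
have QQ : Q^T *m Q = 1%:M.
  by rewrite QT /Q mulmx_block !mulmx0 !mul0mx !addr0 add0r mulmx1 oP -scalar_mx_block.
have QTQ : Q *m diag_mx T *m Q^T = S1.
  rewrite eS1 eS2 /T diag_mx_row QT /Q !mulmx_block !mulmx0 !mul0mx !addr0 !add0r.
  rewrite !mul1mx !mulmx1; congr block_mx.
    by apply/matrixP => a b; rewrite !ord1 !mxE.
  exact: mul0mx.
exists (H *m Q), T; split.
  by rewrite trmx_mul sH -mulmxA (mulmxA H) HH mul1mx.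
by rewrite eS -QTQ trmx_mul sH !mulmxA.
Qed.

End Spectral.

(** * Singular values *)

Section SingularValues.
Variable R : realType.

Lemma dot_diag n (t : 'rV[R]_n) (x : 'cV[R]_n) :
  dot x (diag_mx t *m x) = \sum_k t 0 k * x k 0 ^+ 2.
Proof.
rewrite dotE; apply: eq_bigr => k _; rewrite mul_diag_mx mxE; ring.
Qed.

Lemma orthogonal_trmx n (P : 'M[R]_n) : P^T *m P = 1%:M -> P *m P^T = 1%:M.
Proof. exact: mulmx1C. Qed.

Lemma char_poly_diag n (t : 'rV[R]_n) :
  char_poly (diag_mx t) = \prod_(k < n) ('X - (t 0 k)%:P).
Proof.
rewrite char_poly_trig ?diag_mx_is_trig//.
by apply: eq_bigr => k _; rewrite mxE eqxx mulr1n.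
Qed.

Lemma char_poly_conj n (P S : 'M[R]_n) : P^T *m P = 1%:M ->
  char_poly (P *m S *m P^T) = char_poly S.
Proof.
move=> oP; have oP' := orthogonal_trmx oP.
have [uP iP] : P \in unitmx /\ invmx P = P^T.
  have /mulmx1_unit[_ uP] := oP; split=> //.
  by rewrite -[LHS]mul1mx -oP mulmxK.
rewrite /char_poly /char_poly_mx.
have -> : 'X%:M - map_mx polyC (P *m S *m P^T) =
    map_mx polyC P *m ('X%:M - map_mx polyC S) *m map_mx polyC P^T.
  rewrite mulmxBr mulmxBl !map_mxM; congr (_ - _).
  by rewrite mul_mx_scalar -scalemxAl -map_mxM oP' map_mx1 scalemx1.
by rewrite !det_mulmx mulrAC -det_mulmx -map_mxM oP' map_mx1 det1 mul1r.
Qed.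

Lemma psd_spectrum_ge0 n (S P : 'M[R]_n) (t : 'rV[R]_n) : psd S ->
  P^T *m P = 1%:M -> S = P *m diag_mx t *m P^T -> forall k, 0 <= t 0 k.
Proof.
move=> [_ S0] oP eS k; have := S0 (P *m delta_mx k 0).
rewrite -mulmxA -[X in 0 <= X]/(dot _ _) eS -!mulmxA (mulmxA P^T) oP mul1mx.
rewrite dot_mulmx mulmxA oP mul1mx dot_diag (bigD1 k)//= big1 => [|j jk]; last first.
  by rewrite mxE (negPf jk) expr0n mulr0.
by rewrite mxE !eqxx expr1n mulr1 addr0.
Qed.

Lemma psd_gram m n (M : 'M[R]_(m, n)) : psd (M^T *m M).
Proof.
split; first by rewrite trmx_mul trmxK.
move=> v; rewrite -mulmxA -[X in 0 <= X]/(dot _ _) -mulmxA dot_mulmx trmxK -enorm_sqr.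
exact: sqr_ge0.
Qed.

Lemma psd_sqrtP n (M : 'M[R]_n) : psd M ->
  psd (psd_sqrt M) /\ psd_sqrt M *m psd_sqrt M = M.
Proof.
move=> pM; rewrite /psd_sqrt; case: xgetP => [S _ //|h]; exfalso.
have [P [t [oP eM]]] := real_spectral (proj1 pM).
have t0 := psd_spectrum_ge0 pM oP eM.
pose u : 'rV[R]_n := \row_k Num.sqrt (t 0 k).
apply: (h (P *m diag_mx u *m P^T)); split.
  split; first by rewrite !trmx_mul trmxK tr_diag_mx mulmxA.
  move=> v; rewrite -mulmxA -[X in 0 <= X]/(dot _ _) -!mulmxA dot_mulmx dot_diag.
  by apply: sumr_ge0 => k _; rewrite mulr_ge0 ?sqr_ge0// mxE sqrtr_ge0.
rewrite [RHS]eM -!mulmxA (mulmxA P^T P) oP mul1mx (mulmxA (diag_mx u)); congr (_ *m (_ *m _)).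
rewrite mulmx_diag; congr diag_mx; apply/rowP => k.
by rewrite !mxE -expr2 sqr_sqrtr.
Qed.

(** The spectral theorem rules out the default value of [eigenvalues]. Unique factorization of the
    characteristic polynomial makes the chosen sequence a permutation of the spectrum, and the
    columns of [P] are permuted accordingly. *)
Lemma sorted_spectral n (S : 'M[R]_n) : S^T = S -> exists P : 'M[R]_n,
  [/\ P^T *m P = 1%:M, size (eigenvalues S) = n, sorted >=%R (eigenvalues S) &
      S = P *m diag_mx (\row_k (eigenvalues S)`_k) *m P^T].
Proof.
move=> sS; have [P [t [oP eS]]] := real_spectral sS.
have cS : char_poly S = \prod_(a <- [seq t 0 k | k <- enum 'I_n]) ('X - a%:P).
  by rewrite eS char_poly_conj// char_poly_diag big_map big_enum.
rewrite /eigenvalues; case: xgetP => [s _ [sorts cs]|h]; last first.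
  exfalso; apply: (h (sort >=%R [seq t 0 k | k <- enum 'I_n])); split.
    by apply: sort_sorted => x y; exact: le_total.
  by rewrite cS; apply: perm_big; rewrite perm_sym perm_sort.
have pst : perm_eq s [seq t 0 k | k <- enum 'I_n].
  by apply: prod_XsubC_eq; rewrite -cs.
have ss : size s = n by rewrite (perm_size pst) size_map size_enum_ord.
have /tuple_permP[sg esg] : perm_eq s [tuple t 0 k | k < n] by exact: pst.
have es (k : 'I_n) : s`_k = t 0 (sg k).
  rewrite esg (nth_map k) ?size_enum_ord// nth_ord_enum tnth_mktuple.
  by [].
pose P' := \matrix_(a, b) P a (sg b).
have oP' : P'^T *m P' = 1%:M.
  apply/matrixP => a b; have /matrixP/(_ (sg a) (sg b)) := oP.
  rewrite !mxE (inj_eq perm_inj) => <-; apply: eq_bigr => k _; by rewrite !mxE.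
exists P'; split=> //.
have SP : S *m P = P *m diag_mx t by rewrite eS -mulmxA oP mulmx1.
have SP' : S *m P' = P' *m diag_mx (\row_k s`_k).
  apply/matrixP => a b; have /matrixP/(_ a (sg b)) := SP.
  rewrite !mul_mx_diag !mxE es => <-; apply: eq_bigr => k _; by rewrite !mxE.
by rewrite -SP' -mulmxA (orthogonal_trmx oP') mulmx1.
Qed.

(** The gateway to singular values: what follows uses only this form. The index is unrestricted
    because [nth] returns 0 beyond [n], which respects positivity and monotonicity. *)
Lemma singular_value_spectral n (M : 'M[R]_n) : exists P : 'M[R]_n,
  [/\ P^T *m P = 1%:M,
      M^T *m M = P *m diag_mx (\row_k singular_value k.+1 M ^+ 2) *m P^T,
      forall k, 0 <= singular_value k.+1 M &
      forall k l, (k <= l)%N -> singular_value l.+1 M <= singular_value k.+1 M].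
Proof.
have [pS eS] := psd_sqrtP (psd_gram M); set S := psd_sqrt _ in pS eS.
have [P [oP sz srt eP]] := sorted_spectral (proj1 pS).
have s0 := psd_spectrum_ge0 pS oP eP.
have s0' k : 0 <= (eigenvalues S)`_k.
  have [kn|kn] := ltnP k n; last by rewrite nth_default ?sz.
  by have := s0 (Ordinal kn); rewrite mxE.
exists P; split=> // [|k l kl]; last first.
  rewrite /singular_value -/S /=; have [ln|ln] := ltnP l n; last first.
    by rewrite [leLHS]nth_default ?sz.
  apply: (sorted_leq_nth _ _ 0 srt) => //; rewrite ?inE ?sz//.
  - by move=> x y z h1 h2; exact: le_trans h2 h1.
  - exact: lexx.
  - exact: leq_ltn_trans ln.
rewrite -eS {1 2}eP -!mulmxA (mulmxA P^T P) oP mul1mx (mulmxA (diag_mx _)).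
congr (_ *m (_ *m _)); rewrite mulmx_diag; congr diag_mx; apply/rowP => k.
by rewrite !mxE -expr2 /singular_value -/S.
Qed.

(** Extracts the coordinates off, ..., off + m - 1 of P^T x. The sum over at most one index [k]
    avoids casts between ordinals and gives 0 out of range. *)
Definition select n (P : 'M[R]_n) (off m : nat) : 'M[R]_(m, n) :=
  \matrix_(b < m, a < n) \sum_(k < n | (k : nat) == (off + b)%N) P a k.

Lemma select_mul n (P : 'M[R]_n) off m (x : 'cV[R]_n) : select P off m *m x = 0 ->
  forall k : 'I_n, (off <= k < off + m)%N -> (P^T *m x) k 0 = 0.
Proof.
move=> h k /andP[k1 k2]; have bm : (k - off < m)%N by rewrite ltn_subLR.
have /matrixP/(_ (Ordinal bm) 0) := h; rewrite !mxE => h0; rewrite -[RHS]h0; apply: eq_bigr => a _.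
by rewrite !mxE (big_pred1 k)// => j; rewrite /= subnKC.
Qed.

Definition kerspace m n (A : 'M[R]_(m, n)) : {vspace 'cV[R]_n} :=
  lker (linfun (mulmx A : 'cV[R]_n -> 'cV[R]_m)).

Lemma mem_kerspace m n (A : 'M[R]_(m, n)) x : (x \in kerspace A) = (A *m x == 0).
Proof. by rewrite memv_ker lfunE. Qed.

Lemma dim_kerspace m n (A : 'M[R]_(m, n)) : (n - m <= \dim (kerspace A))%N.
Proof.
have := limg_ker_dim (linfun (mulmx A : 'cV[R]_n -> 'cV[R]_m)) fullv.
rewrite capfv dim_cV => h; rewrite leq_subLR -[X in (X <= _)%N]h addnC leq_add2r.
by apply: leq_trans (dimvS (subvf _)) _; rewrite dim_cV.
Qed.

Lemma dot_gram_spectral n (M P : 'M[R]_n) (t : 'rV[R]_n) x :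
  M^T *m M = P *m diag_mx t *m P^T ->
  enorm (M *m x) ^+ 2 = \sum_k t 0 k * (P^T *m x) k 0 ^+ 2.
Proof.
move=> eM; rewrite enorm_sqr dot_mulmx mulmxA eM dotC -!mulmxA dot_mulmx.
by rewrite dot_diag.
Qed.

Lemma enorm_orthogonal n (P : 'M[R]_n) (x : 'cV[R]_n) : P^T *m P = 1%:M ->
  enorm x ^+ 2 = \sum_k (P^T *m x) k 0 ^+ 2.
Proof.
move=> /orthogonal_trmx oP; rewrite -(@enorm_iso _ _ _ P^T) ?trmxK//.
by rewrite enorm_sqr dotE; apply: eq_bigr => k _; rewrite expr2.
Qed.

Lemma meet_kerspace n m (E : {vspace 'cV[R]_n}) (A : 'M[R]_(m, n)) :
  (m < \dim E)%N -> exists x, [/\ x != 0, x \in E & A *m x = 0].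
Proof.
move=> h; have mn : (m < n)%N.
  by apply: leq_trans h _; apply: leq_trans (dimvS (subvf _)) _; rewrite dim_cV.
have [|x [x0 xE]] := @meet_nonzero _ _ E (kerspace A).
  rewrite -[ltnLHS](subnKC (ltnW mn)).
  by apply: leq_trans (leq_add h (dim_kerspace A)).
by rewrite mem_kerspace => /eqP; exists x.
Qed.

(** Courant-Fischer: the first i - 1 coordinates in the singular basis impose i - 1 conditions, so
    some nonzero vector of [E] satisfies them all. *)
Lemma sv_minmax_low n i (M : 'M[R]_n) (E : {vspace 'cV[R]_n}) :
  (0 < i)%N -> \dim E = i ->
  exists u, [/\ u != 0, u \in E & enorm (M *m u) <= singular_value i M * enorm u].
Proof.
case: i => // i _ dE; have [P [oP eM s0 smon]] := singular_value_spectral M.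
have [|u [u0 uE /select_mul hu]] := @meet_kerspace _ _ E (select P 0 i).
  by rewrite dE.
exists u; split=> //; rewrite -ler_sqr ?nnegrE ?mulr_ge0// exprMn.
rewrite (dot_gram_spectral _ eM) (enorm_orthogonal u oP) mulr_sumr.
apply: ler_sum => k _; rewrite [X in X * _]mxE; have [ki|ki] := ltnP k i.
  by rewrite hu// expr0n !mulr0.
by rewrite ler_wpM2r ?sqr_ge0// ler_sqr ?nnegrE// smon.
Qed.

(** Dually, killing the coordinates after the first i + 1 costs n - i - 1 conditions, one fewer than
    the dimension of [F]. *)
Lemma sv_minmax_high n i (M : 'M[R]_n) (F : {vspace 'cV[R]_n}) :
  (i < n)%N -> \dim F = (n - i)%N ->
  exists v, [/\ v != 0, v \in F & singular_value i.+1 M * enorm v <= enorm (M *m v)].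
Proof.
move=> ni dF; have [P [oP eM s0 smon]] := singular_value_spectral M.
have [|v [v0 vF /select_mul hv]] := @meet_kerspace _ _ F (select P i.+1 (n - i.+1)).
  by rewrite dF subnS ltn_predL subn_gt0.
exists v; split=> //; rewrite -ler_sqr ?nnegrE ?mulr_ge0// exprMn.
rewrite (dot_gram_spectral _ eM) (enorm_orthogonal v oP) mulr_sumr.
apply: ler_sum => k _; rewrite [X in _ <= X * _]mxE; have [ki|ki] := ltnP i k.
  by rewrite hv ?expr0n ?mulr0 // ki subnKC ?ltn_ord.
by rewrite ler_wpM2r ?sqr_ge0// ler_sqr ?nnegrE// smon.
Qed.

Lemma sv_ge0 n i (M : 'M[R]_n) : (0 < i)%N -> 0 <= singular_value i M.
Proof.
by case: i => // i _; have [P [_ _ ]] := singular_value_spectral M.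
Qed.

Lemma sv_ge n i (M : 'M[R]_n) (E : {vspace 'cV[R]_n}) a : (0 < i)%N -> \dim E = i ->
  (forall x, x \in E -> a * enorm x <= enorm (M *m x)) -> a <= singular_value i M.
Proof.
move=> i0 dE h; have [u [u0 uE hu]] := sv_minmax_low M i0 dE.
by rewrite -(ler_pM2r (_ : 0 < enorm u)) ?enorm_gt0//; apply: le_trans (h u uE) hu.
Qed.

(* A truncated singular value decomposition: the columns of W and U are the i
   leading right and left singular vectors of M, and D is diagonal. *)
Record top_data n i (M : 'M[R]_n) (W U : 'M[R]_(n, i)) (D : 'M[R]_i) : Prop := TopData {
  topW : W^T *m W = 1%:M;
  topU : U^T *m U = 1%:M;
  topMW : M *m W = U *m D;
  topUM : U^T *m M = D *m W^T;
  topDT : D^T = D;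
  top_low : forall z, singular_value i M * enorm z <= enorm (D *m z);
  top_high : forall x, W^T *m x = 0 -> enorm (M *m x) <= singular_value i.+1 M * enorm x }.

(** [W] takes the first i columns of an eigenbasis of M^T M, and U = M W D^-1, whence the positivity
    hypothesis. All identities follow from M^T M W = W D^2. *)
Lemma top_dataP n i (M : 'M[R]_n) : (0 < i <= n)%N -> 0 < singular_value i M ->
  exists W U D, @top_data n i M W U D.
Proof.
case: i => // i /= ni si; have [P [oP eM s0 smon]] := singular_value_spectral M.
have oP' := orthogonal_trmx oP.
pose w := widen_ord ni; pose W := \matrix_(a, b) P a (w b).
pose s : 'rV[R]_i.+1 := \row_k singular_value k.+1 M.
have sgt k : 0 < s 0 k by rewrite mxE (lt_le_trans si)// smon// -ltnS.
pose D := diag_mx s; pose D' := diag_mx (\row_k (s 0 k)^-1).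
have DD : D *m D' = 1%:M.
  rewrite /D /D' mulmx_diag -[RHS]diag_const_mx; congr diag_mx; apply/rowP => k.
  by rewrite [LHS]mxE [X in _ * X]mxE mulfV ?gt_eqF// mxE.
have D'D := mulmx1C DD.
have tD : D^T = D by exact: tr_diag_mx.
have tD' : D'^T = D' by exact: tr_diag_mx.
have oW : W^T *m W = 1%:M.
  apply/matrixP => a b; have /matrixP/(_ (w a) (w b)) := oP.
  rewrite !mxE => e; transitivity ((w a == w b)%:R : R); last by congr _%:R.
  by rewrite -e; apply: eq_bigr => k _; rewrite !mxE.
have gW : M^T *m M *m W = W *m (D *m D).
  have gP : M^T *m M *m P = P *m diag_mx (\row_k singular_value k.+1 M ^+ 2).
    by rewrite eM -mulmxA oP mulmx1.
  rewrite /D mulmx_diag; apply/matrixP => a b.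
  transitivity ((M^T *m M *m P) a (w b)).
    by rewrite [LHS]mxE [RHS]mxE; apply: eq_bigr => k _; congr (_ * _); rewrite mxE.
  rewrite gP !mul_mx_diag [LHS]mxE [RHS]mxE; congr (_ * _); first by rewrite mxE.
  by rewrite !mxE.
exists W, (M *m W *m D'), D; split=> //.
- rewrite !trmx_mul tD' -!mulmxA (mulmxA M^T) (mulmxA (M^T *m M)) gW.
  by rewrite !mulmxA -(mulmxA D') oW mulmx1 D'D mul1mx DD.
- by rewrite -mulmxA D'D mulmx1.
- rewrite !trmx_mul tD' -!mulmxA -[W^T *m _](_ : (M^T *m M *m W)^T = _).
    by rewrite gW !trmx_mul tD !mulmxA D'D mul1mx.
  by rewrite !trmx_mul trmxK.
- move=> z; rewrite -ler_sqr ?nnegrE ?mulr_ge0// exprMn !enorm_sqr !dotE mulr_sumr.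
  apply: ler_sum => k _; rewrite /D mul_diag_mx [X in _ <= X * _]mxE [X in _ <= _ * X]mxE.
  have sk : singular_value i.+1 M <= s 0 k by rewrite mxE smon// -ltnS.
  rewrite -!expr2 exprMn ler_wpM2r ?sqr_ge0//.
  by rewrite ler_sqr ?nnegrE//; exact: ltW.
- move=> x hx; rewrite -ler_sqr ?nnegrE ?mulr_ge0// exprMn.
  rewrite (dot_gram_spectral _ eM) (enorm_orthogonal x oP) mulr_sumr.
  apply: ler_sum => k _; rewrite [X in X * _]mxE; have [ki|ki] := ltnP k i.+1; last first.
    by rewrite ler_wpM2r ?sqr_ge0// ler_sqr ?nnegrE// smon.
  suff -> : (P^T *m x) k 0 = 0 by rewrite expr0n !mulr0.
  have /matrixP/(_ (Ordinal ki) 0) := hx; rewrite !mxE => h0; rewrite -[RHS]h0.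
  apply: eq_bigr => a _; rewrite !mxE; congr (P _ _ * _); exact: val_inj.
Qed.

(** * Determinant bounds from the spectrum of the Gram matrix *)

Section Determinant.
Variables (n : nat) (X : 'M[R]_n).

Lemma gram_spectrum : exists (P : 'M[R]_n) (t : 'rV[R]_n),
  [/\ P^T *m P = 1%:M, X^T *m X = P *m diag_mx t *m P^T,
      forall k, t 0 k = enorm (X *m (P *m delta_mx k 0)) ^+ 2,
      forall k, enorm (P *m delta_mx k 0) = 1 &
      \det X ^+ 2 = \prod_k t 0 k].
Proof.
have [P [t [oP eX]]] := real_spectral (proj1 (psd_gram X)).
exists P, t; split=> // [k|k|].
- rewrite (dot_gram_spectral _ eX) mulmxA oP mul1mx (bigD1 k)//= big1 => [|j jk].
    by rewrite mxE !eqxx expr1n mulr1 addr0.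
  by rewrite mxE (negPf jk) expr0n mulr0.
- by rewrite enorm_iso// enorm_delta.
- rewrite expr2 -{1}det_tr -det_mulmx eX !det_mulmx mulrAC -det_mulmx.
  by rewrite (orthogonal_trmx oP) det1 mul1r det_diag.
Qed.

Lemma det_ge a : 0 <= a -> (forall z, a * enorm z <= enorm (X *m z)) -> a ^+ n <= `|\det X|.
Proof.
move=> a0 h; have [P [t [oP eX et nP dX]]] := gram_spectrum.
rewrite -ler_sqr ?nnegrE ?exprn_ge0// real_normK ?num_real// dX exprAC.
rewrite -[X in _ ^+ X <= _]card_ord -prodr_const; apply: ler_prod => k _.
rewrite sqr_ge0 et ler_sqr ?nnegrE//=.
by have := h (P *m delta_mx k 0); rewrite nP mulr1.
Qed.

Lemma det_le a : 0 <= a -> (forall z, enorm (X *m z) <= a * enorm z) -> `|\det X| <= a ^+ n.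
Proof.
move=> a0 h; have [P [t [oP eX et nP dX]]] := gram_spectrum.
rewrite -ler_sqr ?nnegrE ?exprn_ge0// real_normK ?num_real// dX exprAC.
rewrite -[X in _ <= _ ^+ X]card_ord -prodr_const; apply: ler_prod => k _.
rewrite et sqr_ge0 ler_sqr ?nnegrE//=.
by have := h (P *m delta_mx k 0); rewrite nP mulr1.
Qed.

(** All eigenvalues of X^T X are at most 1, so their product is at most each of them. This turns a
    determinant bound back into a bound on angles. *)
Lemma det_contraction z : (forall z, enorm (X *m z) <= enorm z) ->
  `|\det X| * enorm z <= enorm (X *m z).
Proof.
move=> h; have [P [t [oP eX et nP dX]]] := gram_spectrum.
have t1 k : 0 <= t 0 k <= 1.
  rewrite et sqr_ge0/= -[leRHS](expr1n R 2) ler_sqr ?nnegrE//.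
  by rewrite (le_trans (h _))// nP.
rewrite -ler_sqr ?nnegrE ?mulr_ge0// exprMn real_normK ?num_real// dX.
rewrite (dot_gram_spectral _ eX) (enorm_orthogonal z oP) mulr_sumr.
apply: ler_sum => k _; rewrite ler_wpM2r ?sqr_ge0// (bigD1 k)//=.
have /andP[tk0 _] := t1 k; rewrite ler_piMr//.
by rewrite prodr_ile1// => j _; exact: t1.
Qed.

End Determinant.

End SingularValues.

(** * From cones to domination of singular values *)

Lemma index_lt i d : (1 <= i <= d - 1)%N -> (i < d)%N.
Proof. by case: d => [|d]; [case: i | rewrite subn1 => /andP[]]. Qed.

Section SvInvertible.
Variable R : realType.

Lemma sv_gt0 n i (M : 'M[R]_n) : (0 < i <= n)%N -> M \in unitmx -> 0 < singular_value i M.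
Proof.
case: i => // i /= ni Mu; have [P [oP eM s0 _]] := singular_value_spectral M.
rewrite lt_def s0 andbT; apply: contraTneq Mu => s_eq0.
have : \det (M^T *m M) = 0.
  rewrite eM !det_mulmx det_diag (bigD1 (Ordinal ni))//= mxE /= s_eq0 expr0n.
  by rewrite mul0r mulr0 mul0r.
by rewrite det_mulmx det_tr -expr2 => /eqP; rewrite sqrf_eq0 unitmxE => /eqP ->; rewrite unitr0.
Qed.

End SvInvertible.

Section ConeToDominated.
Variables (R : realType) (d i : nat) (Sigma : set 'M[R]_d).
Hypothesis hi : (1 <= i <= d - 1)%N.
Hypothesis hGL : Sigma `<=` GL R d.

Let i0 : (0 < i)%N. Proof. by case/andP: hi. Qed.
Let id : (i < d)%N := index_lt hi.

(** Min-max on [E] gives u with |w u| <= sigma_i |u|, and on w^-1 F gives v with |w v| >=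
    sigma_(i+1) |v|. As w v lies in [F], it is outside the cone and [cone_contract] compares the
    two. *)
Lemma has_cone_dominated K : 1 <= K -> bounded_by Sigma K ->
  has_cone Sigma i -> dominated i Sigma.
Proof.
move=> K1 HK [Cv [delta [hC [E hE] [F hF]]]].
have c1 := cone_const_ge1 hC K1.
(* The added 1 makes the inequality strict. *)
exists (cone_const delta K + 1), (cone_rate delta); split.
- by rewrite addr_gt0// (lt_le_trans ltr01).
- exact: cone_rate_itv hC.
move=> N A _ hA; have hw := word_prod hA; set w := \prod_(k < N) A k in hw *.
have wu := word_unit hGL hw.
have s_gt0 : 0 < singular_value i w by rewrite sv_gt0// i0 ltnW.
rewrite ltr_pdivrMr//.
have [u [u0 uE hu]] := sv_minmax_low w i0 (grass_dim E).
have dF : \dim (mx_act (invmx w) F) = (d - i)%N.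
  by rewrite dim_mx_act ?unitmx_inv// grass_dim.
have [v [v0 vF hv]] := sv_minmax_high w id dF.
rewrite mem_mx_act_inv// in vF.
have := cone_contract hC K1 HK hw (hE u uE u0) (hF _ vF).
set q := cone_rate delta ^+ N; set c := cone_const delta K in c1 *.
have q0 : 0 < q by rewrite exprn_gt0//; case/andP: (cone_rate_itv hC).
have nu : 0 < enorm u by rewrite enorm_gt0.
have nv : 0 < enorm v by rewrite enorm_gt0.
move=> h; apply: (@le_lt_trans _ _ (c * q * singular_value i w)); last first.
  by rewrite ltr_pM2r// ltr_pM2r// ltrDl.
rewrite -(ler_pM2r (mulr_gt0 nv nu)) mulrA.
apply: (@le_trans _ _ (enorm (w *m v) * enorm u)); first by rewrite ler_pM2r.
apply: (le_trans h); rewrite -(mulrA (c * q)) ler_wpM2l//.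
  by rewrite mulr_ge0 ?(ltW q0)// (le_trans ler01).
by rewrite (mulrC (enorm v)) mulrA ler_pM2r.
Qed.

End ConeToDominated.

(** * Norm and conorm of a matrix restricted to a subspace *)

Section RestrictedNorms.
Variables (R : realType) (d : nat) (M : 'M[R]_d) (E : {vspace 'cV[R]_d}).

Lemma has_inf_unit_image : (0 < \dim E)%N -> has_inf (unit_image_norms M E).
Proof.
move=> dE; split; last by exists 0 => _ [v _ <-].
have [x x0 xE] := nonzero_mem dE.
exists (enorm (M *m ((enorm x)^-1 *: x))), ((enorm x)^-1 *: x) => //; split.
  exact: rpredZ.
by rewrite enormZ normfV ger0_norm// mulVf// enorm_eq0.
Qed.

Lemma has_sup_unit_image : (0 < \dim E)%N -> has_sup (unit_image_norms M E).
Proof.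
move=> dE; split; first by case: (has_inf_unit_image dE).
have [c _ hc] := op_bound M; exists c => _ [v [_ nv] <-].
by apply: (le_trans (hc v)); rewrite nv mulr1.
Qed.

Lemma unit_image_scale x : x \in E -> x != 0 ->
  unit_image_norms M E (enorm (M *m x) / enorm x).
Proof.
move=> xE x0; exists ((enorm x)^-1 *: x).
  by split; [exact: rpredZ|rewrite enormZ normfV ger0_norm// mulVf// enorm_eq0].
by rewrite -scalemxAr enormZ normfV ger0_norm// mulrC.
Qed.

Lemma norm_on_ge x : x \in E -> enorm (M *m x) <= norm_on M E * enorm x.
Proof.
move=> xE; have [->|x0] := eqVneq x 0; first by rewrite mulmx0 !enorm0 mulr0.
rewrite -ler_pdivrMr ?enorm_gt0//; apply: ub_le_sup; last exact: unit_image_scale.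
apply: (proj2 (has_sup_unit_image _)); rewrite lt0n dimv_eq0.
by apply: contraNneq x0 => h; rewrite -memv0 -h.
Qed.

Lemma conorm_on_le x : x \in E -> conorm_on M E * enorm x <= enorm (M *m x).
Proof.
move=> xE; have [->|x0] := eqVneq x 0; first by rewrite mulmx0 !enorm0 mulr0.
rewrite -ler_pdivlMr ?enorm_gt0//; apply: ge_inf; last exact: unit_image_scale.
apply: (proj2 (has_inf_unit_image _)); rewrite lt0n dimv_eq0.
by apply: contraNneq x0 => h; rewrite -memv0 -h.
Qed.

Lemma norm_on_le a : (0 < \dim E)%N ->
  (forall x, x \in E -> enorm x = 1 -> enorm (M *m x) <= a) -> norm_on M E <= a.
Proof.
move=> dE h; apply: ge_sup; first by case: (has_sup_unit_image dE).
by move=> _ [x [xE nx] <-]; exact: h.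
Qed.

Lemma conorm_on_ge a : (0 < \dim E)%N ->
  (forall x, x \in E -> enorm x = 1 -> a <= enorm (M *m x)) -> a <= conorm_on M E.
Proof.
move=> dE h; apply: lb_le_inf; first by case: (has_inf_unit_image dE).
by move=> _ [x [xE nx] <-]; exact: h.
Qed.

End RestrictedNorms.

(** * Compactness and separation pass to subtypes *)

Section SubtypeTopology.
Variables (T : topologicalType) (A : set T).

Lemma nbhs_set_type (p : set_type A) (U : set (set_type A)) : nbhs p U ->
  exists2 W, nbhs (set_val p) W & set_val @^-1` W `<=` U.
Proof.
move=> [_ [/= [W oW <-] Wp] WU]; exists W => //.
exact: open_nbhs_nbhs.
Qed.

Lemma compact_set_type : compact A -> compact [set: set_type A].
Proof.
move=> cA F FF _.
have [|p [Ap clp]] := cA (set_val @ F) _.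
  by apply: (@filterS _ F _ setT) => [x _|]; [exact: set_valP|exact: filterT].
exists (exist _ p (mem_set Ap)); split=> // B U FB /nbhs_set_type[W pW WU].
have [|_ [[x Bx <-] Wx]] := clp (set_val @` B) W _ pW.
  by apply: (@filterS _ F _ B) => // x Bx; exists x.
by exists x; split=> //; exact: WU.
Qed.

Lemma hausdorff_set_type : hausdorff_space T -> hausdorff_space (set_type A).
Proof.
move=> hT p q clpq; apply: val_inj; apply: hT => U V pU qV.
have cv : continuous (set_val : set_type A -> T) by exact: initial_continuous.
have [x [Ux Vx]] := clpq _ _ (cv _ _ pU) (cv _ _ qV).
by exists (set_val x).
Qed.

End SubtypeTopology.

(** * The full shift *)

Section FullShift.
Import ArrowAsProduct.
Variables (R : realType) (d : nat) (Sigma : set 'M[R]_d).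

(** Indexed by all integers so that the shift is invertible. Letters in [set_type Sigma] make the
    space a product of compact spaces and keep the range of [letter0] in [Sigma]. *)
Definition shift_space : topologicalType := (int -> set_type Sigma : Type).

Definition shift_by (k : int) (x : shift_space) : shift_space := fun n => x (n + k).

Definition letter0 (x : shift_space) : 'M[R]_d := set_val (x 0).

Lemma continuous_coord (n : int) : continuous (fun x : shift_space => x n).
Proof. exact: (@proj_continuous int (fun=> set_type Sigma) n). Qed.

Lemma continuous_shift_by k : continuous (shift_by k).
Proof.
move=> x; have FF : Filter (shift_by k @ nbhs x) by exact: fmap_filter.
apply/cvg_sup => n U [_ [[W oW <-] /= Wx] WU].
have h := @continuous_coord (n + k) x W (open_nbhs_nbhs (conj oW Wx)).
by apply: (@filterS _ (nbhs x) _ _ _ _ h) => y Wy; exact: WU.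
Qed.

Lemma homeomorphism_shift : homeomorphism (shift_by 1).
Proof.
split; first exact: continuous_shift_by.
exists (shift_by (-1)); split; first exact: continuous_shift_by.
  by move=> x; apply/funext => n; rewrite /shift_by subrK.
by move=> x; apply/funext => n; rewrite /shift_by addrK.
Qed.

Lemma compact_shift_space : compact Sigma -> compact [set: shift_space].
Proof.
move=> /compact_set_type cS.
have := @tychonoff int (fun=> set_type Sigma) (fun=> setT) (fun=> cS).
by congr compact; apply/seteqP; split.
Qed.

Lemma hausdorff_shift_space : hausdorff_space shift_space.
Proof.
apply: (@hausdorff_product int (fun=> set_type Sigma)) => _.
apply: hausdorff_set_type; exact: norm_hausdorff.
Qed.

Lemma continuous_letter0 : continuous letter0.
Proof.
move=> x; apply: continuous_comp; first exact: continuous_coord.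
exact: initial_continuous.
Qed.

Lemma iter_shift k x n : iter k (shift_by 1) x n = x (n + k%:Z).
Proof.
elim: k x n => [|k IH] x n; first by rewrite addr0.
by rewrite iterSr IH /shift_by -addrA -PoszD addn1.
Qed.

(** The newest letter multiplies on the left while products run left to right, whence the reversed
    index. *)
Lemma cocycle_shift n (x : shift_space) :
  cocycle (shift_by 1) letter0 n x = \prod_(k < n) set_val (x (rev_ord k : nat)%:Z).
Proof.
elim: n => [|n IH]; first by rewrite big_ord0.
rewrite big_ord_recl /= IH /letter0 iter_shift add0r; congr (_ *m _).
  by rewrite subn1.
Qed.

(** Every finite word is a cocycle over some point of the shift. There min-max on E_x gives conorm
    <= sigma_i, and on F_x gives sigma_(i+1) <= norm. *)
Lemma dominated_splitting_dominated i : (1 <= i <= d - 1)%N -> Sigma `<=` GL R d ->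
  compact Sigma ->
  (forall (X : topologicalType) (T : X -> X) (A : X -> 'M[R]_d),
     compact [set: X] -> hausdorff_space X -> homeomorphism T ->
     continuous A -> range A `<=` Sigma -> has_dominated_splitting i T A) ->
  dominated i Sigma.
Proof.
move=> hi hGL cS hb; have id := index_lt hi; have /andP[i0 _] := hi.
have [|E [F [_ _ _ [C [tau [C0 tau01 h]]]]]] := hb shift_space (shift_by 1) letter0
  (compact_shift_space cS) hausdorff_shift_space homeomorphism_shift continuous_letter0.
  by move=> _ [x _ <-]; exact: set_valP.
exists C, tau; split=> // N A N0 hA; case: N N0 A hA => // N _ A hA.
pose a (k : 'I_N.+1) : set_type Sigma := exist _ (A k) (mem_set (hA k)).
(* Only coordinates 0 to N are read. [inord] fills in the others arbitrarily, and the reversal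
   undoes that of [cocycle_shift]. *)
pose x : shift_space := fun n => a (rev_ord (inord `|n|%N)).
have ex : cocycle (shift_by 1) letter0 N.+1 x = \prod_(k < N.+1) A k.
  rewrite cocycle_shift; apply: eq_bigr => k _.
  by rewrite /x absz_nat inord_val rev_ordK.
have := h x N.+1; rewrite ex; set w := \prod_(k < N.+1) A k.
have wu : w \in unitmx by exact: word_unit hGL (word_prod hA).
have s_gt0 : 0 < singular_value i w by rewrite sv_gt0// i0 ltnW.
have [K K1 HK] := compact_GL_bounded hGL cS.
have K0 : 0 < K by rewrite (lt_le_trans ltr01).
have cE : 0 < conorm_on w (E x).
  apply: (@lt_le_trans _ _ (K ^+ N.+1)^-1); first by rewrite invr_gt0 exprn_gt0.
  apply: conorm_on_ge => [|u _ nu]; first by rewrite grass_dim.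
  rewrite -[leLHS]mul1r ler_pdivrMr ?exprn_gt0// mulrC -nu.
  exact: (proj2 (word_bounded (ltW K0) HK (word_prod hA) u)).
have [u [u0 uE hu]] := sv_minmax_low w i0 (grass_dim (E x)).
have [v [v0 vF hv]] := sv_minmax_high w id (grass_dim (F x)).
have h1 : conorm_on w (E x) <= singular_value i w.
  by rewrite -(ler_pM2r (_ : 0 < enorm u)) ?enorm_gt0// (le_trans (conorm_on_le _ uE)).
have h2 : singular_value i.+1 w <= norm_on w (F x).
  by rewrite -(ler_pM2r (_ : 0 < enorm v)) ?enorm_gt0// (le_trans hv)// norm_on_ge.
apply: le_lt_trans; apply: ler_pM => //; first exact: sv_ge0.
  by rewrite invr_ge0 ltW.
by rewrite lef_pV2 ?posrE.
Qed.

End FullShift.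

(** * From cones to dominated splittings *)

Section Limits.
Variable R : realType.

Lemma exp_lt_eps (rho e : R) : 0 < rho < 1 -> 0 < e ->
  exists N, forall n, (N <= n)%N -> rho ^+ n < e.
Proof.
move=> /andP[r0 r1] e0.
have /cvgrPdist_lt/(_ e e0)[N _ hN] : (fun n => rho ^+ n) @ \oo --> (0 : R).
  by apply: cvg_expr; rewrite gtr0_norm.
exists N => n Nn; have := hN n Nn.
by rewrite sub0r normrN ger0_norm// exprn_ge0// ltW.
Qed.

Lemma geo_lt_eps (c rho e : R) : 0 <= c -> 0 < rho < 1 -> 0 < e ->
  exists N, forall n, (N <= n)%N -> c * rho ^+ n < e.
Proof.
move=> c0 hr e0; have c1 : 0 < c + 1 by rewrite ltr_wpDl.
have [|N hN] := exp_lt_eps hr (e := e / (c + 1)); first by rewrite divr_gt0.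
exists N => n /hN; rewrite ltr_pdivlMr// => h; apply: le_lt_trans h.
rewrite mulrC ler_wpM2l ?lerDl//.
by case/andP: hr => r0 _; rewrite exprn_ge0// ltW.
Qed.

Lemma ler_eps_mul (a b c : R) : 0 <= c -> (forall e, 0 < e -> a <= b + e * c) -> a <= b.
Proof.
move=> c0 h; apply/ler_addgt0Pr => e e0; have c1 : 0 < c + 1 by rewrite ltr_wpDl.
apply: (le_trans (h (e / (c + 1)) _)); first by rewrite divr_gt0.
by rewrite lerD2l mulrAC ler_pdivrMr// ler_pM2l// lerDl.
Qed.

Lemma gap_closed d a (E F : {vspace 'cV[R]_d}) :
  (forall e, 0 < e -> gap (a + e) E F) -> gap a E F.
Proof.
move=> h x xE; apply: (@ler_eps_mul _ _ (enorm x)) => // e e0.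
by rewrite -mulrDl; exact: h.
Qed.

Lemma gap_act d (M : 'M[R]_d) (K a : R) (E F : {vspace 'cV[R]_d}) : 0 <= K -> 0 <= a ->
  (forall x, enorm (M *m x) <= K * enorm x /\ enorm x <= K * enorm (M *m x)) ->
  gap a E F -> gap (K ^+ 2 * a) (mx_act M E) (mx_act M F).
Proof.
move=> K0 a0 hM h; apply: gapI => _ /mx_actP[x xE ->].
exists (M *m (oproj F *m x)); first by apply: mem_mx_act; exact: oproj_mem.
rewrite -mulmxBr; apply: (le_trans (proj1 (hM _))).
rewrite expr2 -!mulrA ler_wpM2l// (le_trans (h _ xE))// mulrCA.
by rewrite ler_wpM2l//; exact: (proj2 (hM _)).
Qed.

Section GrassLimits.
Variables d k : nat.

Definition gap2 (a : R) (E F : {vspace 'cV[R]_d}) := gap a E F /\ gap a F E.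

(** Compactness provides a cluster point; comparing [G n] with late terms near it shows that it
    inherits the same rate [r n]. *)
Lemma grass_limit (G : nat -> grass R d k) (r : nat -> R) :
  (forall n, 0 <= r n) -> (forall n m, (n <= m)%N -> gap2 (r n) (G n) (G m)) ->
  exists L : grass R d k, forall n, gap2 (r n) (G n) L.
Proof.
move=> r0 hG; have [|L [_ /clusterP clL]] := @compact_grass R d k (G @ \oo) _.
  exact: filterT.
exists L => n; suff h e : 0 < e -> gap2 (r n + e) (G n) L.
  by split; apply: gap_closed => e /h[].
move=> e0; pose D : R := (d * d)%:R; have D0 : 0 <= D by [].
have e1 : 0 < e / (D + 1) by rewrite divr_gt0// ltr_wpDl.
have [|_ [m nm <-] /ball_gap[h1 h2]] := clL (G @` [set m | (n <= m)%N]) _ _ e1.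
  by exists n => // m nm; exists m.
have De : D * (e / (D + 1)) <= e.
  by rewrite mulrCA ger_pMr// ler_pdivrMr ?mul1r ?lerDl// ltr_wpDl.
have De0 : 0 <= D * (e / (D + 1)) by rewrite mulr_ge0// ltW.
have [h3 h4] := hG n m nm; split.
  by apply: gap_le (gap_trans De0 h3 h2); rewrite lerD2l.
by apply: gap_le (gap_trans (r0 n) h1 h4); rewrite addrC lerD2l.
Qed.

Lemma gap2_le a b (E F : {vspace 'cV[R]_d}) : a <= b -> gap2 a E F -> gap2 b E F.
Proof. by move=> ab [h1 h2]; split; apply: gap_le ab _. Qed.

Lemma gap2_sym a (E F : {vspace 'cV[R]_d}) : gap2 a E F -> gap2 a F E.
Proof. by case. Qed.

Lemma gap2_trans a b (E F G : {vspace 'cV[R]_d}) : 0 <= a -> 0 <= b ->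
  gap2 a E F -> gap2 b F G -> gap2 (a + b) E G.
Proof.
move=> a0 b0 [h1 h2] [h3 h4]; split; first exact: gap_trans h1 h3.
by rewrite addrC; exact: gap_trans h4 h2.
Qed.

Lemma gap2_act (M : 'M[R]_d) (K a : R) (E F : {vspace 'cV[R]_d}) : 0 <= K -> 0 <= a ->
  (forall x, enorm (M *m x) <= K * enorm x /\ enorm x <= K * enorm (M *m x)) ->
  gap2 a E F -> gap2 (K ^+ 2 * a) (mx_act M E) (mx_act M F).
Proof. by move=> K0 a0 hM [h1 h2]; split; exact: gap_act. Qed.

Lemma continuous_gap (X : topologicalType) (G : X -> grass R d k) :
  (forall x e, 0 < e -> \forall y \near x, gap2 e (G x) (G y)) -> continuous G.
Proof.
move=> h x U /nearbyP[e e0 eU]; rewrite nbhs_simpl /=.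
have e4 : 0 < e / 4 by rewrite divr_gt0.
have := h x _ e4; apply: filterS => y [h1 h2]; apply: eU.
by apply: gap_ball h1 h2; [exact: ltW|lra].
Qed.

Lemma continuous_near_gap (X : topologicalType) (G : X -> grass R d k) (x : X) (e : R) :
  continuous G -> 0 < e -> \forall y \near x, gap2 e (G x) (G y).
Proof.
move=> cG e0; pose D : R := (d * d)%:R; have D0 : 0 <= D by [].
have e1 : 0 < e / (D + 1) by rewrite divr_gt0// ltr_wpDl.
have := cG x _ (nbhsx_ballx (G x) _ e1); rewrite nbhs_simpl /=.
apply: filterS => y /ball_gap; apply: gap2_le.
by rewrite mulrCA ger_pMr// ler_pdivrMr ?mul1r ?lerDl// ltr_wpDl.
Qed.

Lemma continuous_grass_limit (X : topologicalType) (G : nat -> X -> grass R d k)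
    (r : nat -> R) (L : X -> grass R d k) :
  (forall n, continuous (G n)) -> (forall n, 0 <= r n) ->
  (forall e, 0 < e -> exists n, r n < e) ->
  (forall x n, gap2 (r n) (G n x) (L x)) -> continuous L.
Proof.
move=> cG r0 hr hL; apply: continuous_gap => x e e0.
have e3 : 0 < e / 3 by rewrite divr_gt0.
have [n rn] := hr _ e3.
have := continuous_near_gap x (cG n) e3; apply: filterS => y h.
apply: gap2_le (gap2_trans _ _ (gap2_trans _ _ (gap2_sym (hL x n)) h) (hL y n)) => //.
- by lra.
- by rewrite addr_ge0// ltW.
- exact: ltW.
Qed.

Lemma near_mx_close (X : topologicalType) m n (M : X -> 'M[R]_(m, n)) x e :
  continuous M -> 0 < e ->
  \forall y \near x, forall z : 'cV_n, enorm ((M x - M y) *m z) <= e * enorm z.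
Proof.
move=> cM e0; pose D : R := (m * n)%:R; have D0 : 0 <= D by [].
have e1 : 0 < e / (D + 1) by rewrite divr_gt0// ltr_wpDl.
have := cM x _ (nbhsx_ballx (M x) _ e1); rewrite nbhs_simpl /=.
apply: filterS => y [_ hy] z.
apply: (le_trans (enorm_mulmx_le z (ltW e1) _)).
  by move=> a b; rewrite entryB ltW//; exact: hy.
by rewrite ler_wpM2r// mulrCA ger_pMr// ler_pdivrMr ?mul1r ?lerDl// ltr_wpDl.
Qed.

Lemma continuous_act (X : topologicalType) (M : X -> 'M[R]_d) (K : R)
    (E : grass R d k) (G : X -> grass R d k) :
  continuous M -> 0 < K -> (forall x v, enorm v <= K * enorm (M x *m v)) ->
  (forall x, plane (G x) = mx_act (M x) E) -> continuous G.
Proof.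
move=> cM K0 hK hG; apply: continuous_gap => x e e0.
have := near_mx_close x cM (divr_gt0 e0 K0); apply: filterS => y h.
rewrite !hG; split; apply: gapI => _ /mx_actP[v vE ->].
  exists (M y *m v); first exact: mem_mx_act.
  rewrite -mulmxBl; apply: (le_trans (h v)).
  by rewrite -mulrA ler_pM2l// ler_pdivrMl.
exists (M x *m v); first exact: mem_mx_act.
rewrite enorm_distC -mulmxBl; apply: (le_trans (h v)).
by rewrite -mulrA ler_pM2l// ler_pdivrMl.
Qed.

(** Continuity of matrix inversion is avoided: with z = M_a^-1 v, the matrix M_b sends z - M_b^-1 v
    to -(M_a - M_b) z, and M_b contracts by at most the factor K. *)
Lemma continuous_act_inv (X : topologicalType) (M : X -> 'M[R]_d) (K : R)
    (E : grass R d k) (G : X -> grass R d k) :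
  continuous M -> 0 < K -> (forall x v, enorm v <= K * enorm (M x *m v)) ->
  (forall x, M x \in unitmx) ->
  (forall x, plane (G x) = mx_act (invmx (M x)) E) -> continuous G.
Proof.
move=> cM K0 hK uM hG; apply: continuous_gap => x e e0.
have := near_mx_close x cM (divr_gt0 e0 K0); apply: filterS => y h.
have key a b v : (forall z : 'cV_d, enorm ((M a - M b) *m z) <= e / K * enorm z) ->
    enorm (invmx (M a) *m v - invmx (M b) *m v) <= e * enorm (invmx (M a) *m v).
  move=> hab; set z := invmx (M a) *m v; have ev : M a *m z = v by rewrite mulKVmx.
  apply: (le_trans (hK b _)).
  have -> : M b *m (z - invmx (M b) *m v) = - ((M a - M b) *m z).
    by rewrite mulmxBr mulKVmx// mulmxBl opprB ev.
  by rewrite enormN -ler_pdivlMl// mulrA (mulrC _ e).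
rewrite !hG; split; apply: gapI => _ /mx_actP[v vE ->].
  by exists (invmx (M y) *m v); [exact: mem_mx_act|exact: key].
exists (invmx (M x) *m v); first exact: mem_mx_act.
by apply: key => z; rewrite -enormN -mulNmx opprB.
Qed.

End GrassLimits.
End Limits.

Lemma invmx_mulmx (R : realType) d (M N : 'M[R]_d) : M \in unitmx -> N \in unitmx ->
  invmx (M *m N) = invmx N *m invmx M.
Proof.
move=> uM uN; have uMN : M *m N \in unitmx by rewrite unitmx_mul uM.
apply: (can_inj (mulKmx uMN)); rewrite mulmxV// mulmxA -(mulmxA M) mulmxV// mulmx1.
by rewrite mulmxV.
Qed.

Section Cocycles.
Variables (R : realType) (d : nat) (X : topologicalType) (T S : X -> X) (A : X -> 'M[R]_d).

Lemma iter_cancel n : cancel T S -> cancel (iter n T) (iter n S).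
Proof. by move=> h; elim: n => [//|n IH] x; rewrite iterSr iterS h IH. Qed.

Lemma cocycle_word (Sigma : set 'M[R]_d) n x : range A `<=` Sigma ->
  word Sigma n (cocycle T A n x).
Proof.
by move=> hA; elim: n => [|n IH] /=; [exact: word0|apply: wordS => //; apply: hA; exists (iter n T x)].
Qed.

Lemma cocycle_add m n x :
  cocycle T A (m + n) x = cocycle T A m (iter n T x) *m cocycle T A n x.
Proof.
elim: m => [|m IH]; first by rewrite mul1mx.
by rewrite addSn /= IH mulmxA iterD.
Qed.

Lemma continuous_iter n : continuous T -> continuous (iter n T).
Proof.
move=> cT; elim: n => [|n IH] x; first exact: cvg_id.
exact: (continuous_comp (IH x) (cT _)).
Qed.

Lemma continuous_cocycle n : continuous T -> continuous A -> continuous (cocycle T A n).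
Proof.
move=> cT cA; elim: n => [|n IH] /=.
  by move=> x; exact: cst_continuous.
apply: continuous_mulmx => // x.
by apply: continuous_comp; [exact: continuous_iter|exact: cA].
Qed.

End Cocycles.

(** * Contraction of gaps between planes inside and outside a cone *)

Section ConeGaps.
Variables (R : realType) (d i : nat) (Sigma : set 'M[R]_d).
Hypothesis hGL : Sigma `<=` GL R d.
Variables (Cv : set 'cV[R]_d) (delta K : R).
Hypothesis hC : strict_cone Sigma Cv delta.
Hypothesis K1 : 1 <= K.
Hypothesis HK : bounded_by Sigma K.
Hypothesis id : (i <= d)%N.

Let c := cone_const delta K.
Let rho := cone_rate delta.
Let d0 : 0 < delta := cone_gt0 hC.

Definition inner_plane (E : {vspace 'cV[R]_d}) :=
  forall u, u \in E -> u != 0 -> inner Sigma Cv u.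
Definition outer_plane (F : {vspace 'cV[R]_d}) := forall v, v \in F -> ~ Cv v.

Lemma inner_plane_act n w E : word Sigma n w -> inner_plane E -> inner_plane (mx_act w E).
Proof.
move=> + hE; elim=> [|A {}n {}w SA _ IH]; first by rewrite mx_act1.
rewrite mx_act_mul => _ /mx_actP[x xE ->] Ax0.
have x0 : x != 0 by apply: contraNneq Ax0 => ->; rewrite mulmx0.
by exists A, x; split=> //; exact: (innerW hC (IH x xE x0)).
Qed.

Lemma outer_plane_act n w F : word Sigma n w -> outer_plane F ->
  outer_plane (mx_act (invmx w) F).
Proof.
move=> hw hF v; rewrite mem_mx_act_inv ?(word_unit hGL hw)// => vF Cv_v.
exact: hF vF (cone_word hC hw Cv_v).
Qed.

(** Since - f is outside the cone, its distance |e + f| to the inner vector e is at least delta |e|.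
    This is a uniform lower bound on the angle between inner and outer planes. *)
Lemma inner_outer E F e f : inner_plane E -> outer_plane F -> e \in E -> f \in F ->
  delta * enorm e <= enorm (e + f).
Proof.
move=> hE hF eE fF; have [->|e0] := eqVneq e 0; first by rewrite enorm0 mulr0.
have N1 : -1 != 0 :> R by rewrite oppr_eq0 oner_eq0.
have := inner_far hC (hE e eE e0) (coneZ_iff hC N1 (hF f fF)).
by rewrite scaleN1r -opprD enormN addrC => /ltW.
Qed.

Lemma inner_outer_transverse E F : inner_plane E -> outer_plane F -> transverse E F.
Proof.
move=> hE hF; apply/transverseP => x xE xF; apply/eqP.
have NxF : - x \in F by rewrite rpredN.
have := inner_outer hE hF xE NxF; rewrite subrr enorm0 pmulr_rle0// => h.
by rewrite -enorm_eq0 eq_le h enorm_ge0.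
Qed.

(** 1 + delta^-1 bounds the oblique projection onto an outer plane along an inner one. *)
Definition gap_const := c * (1 + delta^-1).

Let c0 : 0 < c := lt_le_trans ltr01 (cone_const_ge1 hC K1).
Let rho0 : 0 < rho. Proof. by case/andP: (cone_rate_itv hC). Qed.

Lemma gap_const_ge0 : 0 <= gap_const.
Proof. by rewrite mulr_ge0 ?addr_ge0 ?invr_ge0// ltW. Qed.

(** Write e1 = e2 + f along E2 and w^-1 F. The error w e1 - w e2 = w f lies in [F], outside the
    cone, so [cone_contract] makes it small against w e1. *)
Lemma gap_inner n w (E1 E2 : {vspace 'cV[R]_d}) (F : {vspace 'cV[R]_d}) :
  word Sigma n w -> \dim E2 = i -> \dim F = (d - i)%N ->
  inner_plane E1 -> inner_plane E2 -> outer_plane F ->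
  gap (gap_const * rho ^+ n) (mx_act w E1) (mx_act w E2).
Proof.
move=> hw dE2 dF hE1 hE2 hF; have wu := word_unit hGL hw.
apply: gapI => _ /mx_actP[e1 e1E ->].
have hF' := outer_plane_act hw hF.
have dF' : (\dim E2 + \dim (mx_act (invmx w) F) = d)%N.
  by rewrite dE2 dim_mx_act ?unitmx_inv// dF subnKC.
have [e2 [f [e2E fF ee]]] :=
  transverse_decomp e1 (inner_outer_transverse hE2 hF') dF'.
exists (w *m e2); first exact: mem_mx_act.
have [e10|e10] := eqVneq e1 0.
  have e20 : e2 = 0.
    have := inner_outer hE2 hF' e2E fF; rewrite -ee e10 enorm0 pmulr_rle0// => h.
    by apply/eqP; rewrite -enorm_eq0 eq_le h enorm_ge0.
  by rewrite e10 e20 !mulmx0 subrr enorm0 mulr0.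
have -> : w *m e1 - w *m e2 = w *m f by rewrite -mulmxBr ee addrC addKr.
have n1 : 0 < enorm e1 by rewrite enorm_gt0.
rewrite mem_mx_act_inv// in fF.
have := cone_contract hC K1 HK hw (innerW hC (hE1 _ e1E e10)) (hF _ fF).
have hf : enorm f <= (1 + delta^-1) * enorm e1.
  have h1 : enorm e2 <= delta^-1 * enorm e1.
    rewrite ler_pdivlMl//; have := @inner_outer E2 (mx_act (invmx w) F) e2 f hE2 hF' e2E.
    by rewrite mem_mx_act_inv// -ee; exact.
  have : enorm f <= enorm e1 + enorm e2.
    by rewrite (_ : f = e1 - e2) ?enorm_triangleB// ee addrC addKr.
  lra.
move=> h; rewrite -(ler_pM2r n1); apply: (le_trans h).
rewrite [leRHS](_ : _ = c * rho ^+ n * (enorm (w *m e1) * ((1 + delta^-1) * enorm e1))).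
  by rewrite ler_wpM2l ?ler_wpM2l// mulr_ge0 ?exprn_ge0// ltW.
by rewrite /gap_const; ring.
Qed.

(** Write y = e + f along E and w^-1 F2. [cone_contract] for e and y, with |w e| <= delta^-1 |w y|
    from [inner_outer], makes the error e small against y. *)
Lemma gap_outer n w (E : {vspace 'cV[R]_d}) (F1 F2 : {vspace 'cV[R]_d}) :
  word Sigma n w -> \dim E = i -> \dim F2 = (d - i)%N ->
  inner_plane E -> outer_plane F1 -> outer_plane F2 ->
  gap (gap_const * rho ^+ n) (mx_act (invmx w) F1) (mx_act (invmx w) F2).
Proof.
move=> hw dE dF hE hF1 hF2; have wu := word_unit hGL hw.
apply: gapI => y yF; have hF' := outer_plane_act hw hF2.
have dF' : (\dim E + \dim (mx_act (invmx w) F2) = d)%N.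
  by rewrite dE dim_mx_act ?unitmx_inv// dF subnKC.
have [e [f [eE fF ee]]] := transverse_decomp y (inner_outer_transverse hE hF') dF'.
exists f => //; have -> : y - f = e by rewrite ee addrK.
have qn : 0 <= gap_const * rho ^+ n by rewrite mulr_ge0 ?gap_const_ge0// exprn_ge0// ltW.
have [->|e0] := eqVneq e 0; first by rewrite enorm0 mulr_ge0.
have hwE := inner_plane_act hw hE.
rewrite !mem_mx_act_inv// in yF fF.
have := cone_contract hC K1 HK hw (innerW hC (hE _ eE e0)) (hF1 _ yF).
have h1 : enorm (w *m e) <= delta^-1 * enorm (w *m y).
  rewrite ler_pdivlMl// ee mulmxDr.
  by apply: inner_outer hwE hF2 _ fF; exact: mem_mx_act.
have we : 0 < enorm (w *m e).
  by rewrite enorm_gt0; apply: contra e0 => /eqP /(mulmx_inj wu) ->.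
have wy : 0 < enorm (w *m y).
  by rewrite -(pmulr_rgt0 _ (_ : 0 < delta^-1)) ?invr_gt0// (lt_le_trans we).
move=> h; rewrite -(ler_pM2l wy); apply: (le_trans h).
apply: (@le_trans _ _ (c * rho ^+ n * (delta^-1 * enorm (w *m y) * enorm y))).
  by rewrite ler_wpM2l ?ler_wpM2r// mulr_ge0 ?exprn_ge0// ltW.
rewrite [leRHS](_ : _ = c * rho ^+ n * (delta^-1 * enorm (w *m y) * enorm y) +
   c * rho ^+ n * (enorm (w *m y) * enorm y)); last by rewrite /gap_const; ring.
have cr : 0 <= c * rho ^+ n := mulr_ge0 (ltW c0) (exprn_ge0 n (ltW rho0)).
by rewrite lerDl mulr_ge0// mulr_ge0.
Qed.

End ConeGaps.

Section ConeToSplitting.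
Variables (R : realType) (d i : nat) (Sigma : set 'M[R]_d).
Hypothesis hi : (1 <= i <= d - 1)%N.
Hypothesis hGL : Sigma `<=` GL R d.
Variables (K : R).
Hypothesis K1 : 1 <= K.
Hypothesis HK : bounded_by Sigma K.

Let id : (i < d)%N := index_lt hi.

Lemma has_cone_splitting (X : topologicalType) (T : X -> X) (A : X -> 'M[R]_d) :
  homeomorphism T -> continuous A -> range A `<=` Sigma ->
  has_cone Sigma i -> has_dominated_splitting i T A.
Proof.
move=> [cT [S [cS TS ST]]] cA rA [Cv [delta [hC [E0 hE0] [F0 hF0]]]].
have K0 : 0 < K by exact: lt_le_trans K1.
pose w n x := cocycle T A n x.
have hw n x : word Sigma n (w n x) by exact: cocycle_word.
have uw n x : w n x \in unitmx by exact: word_unit hGL (hw n x).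
have cw n : continuous (w n) by exact: continuous_cocycle.
have bw n x v : enorm v <= K ^+ n * enorm (w n x *m v).
  exact: (proj2 (word_bounded (ltW K0) HK (hw n x) v)).
have TSn n : cancel (iter n S) (iter n T) by exact: iter_cancel.
have outF0 : outer_plane Cv F0 by [].
(* At least one letter is applied, since [E0] lies in the cone but its image is inner. *)
pose E n x := act (uw n.+1 (iter n.+1 S x)) E0.
pose F' n x : grass R d (d - i) :=
  @act R d (d - i) (invmx (w n x)) (etrans (unitmx_inv (w n x)) (uw n x)) F0.
pose c := gap_const delta K; pose rho := cone_rate delta.
have c0 : 0 <= c := gap_const_ge0 hC K1.
have rho01 : 0 < rho < 1 := cone_rate_itv hC.
pose r n := c * rho ^+ n.
have r0 n : 0 <= r n by rewrite mulr_ge0// exprn_ge0//; case/andP: rho01 => /ltW.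
have rlim e : 0 < e -> exists n0, forall n, (n0 <= n)%N -> r n < e.
  exact: geo_lt_eps.
have in1 n x : inner_plane Sigma Cv (mx_act (w n.+1 x) E0).
  move=> _ /mx_actP[u uE ->] wu0.
  have u0 : u != 0 by apply: contraNneq wu0 => ->; rewrite mulmx0.
  exists (A (iter n T x)), (w n x *m u); split; last by rewrite mulmxA.
    by apply: rA; exists (iter n T x).
  exact: (cone_word hC (hw n x) (hE0 _ uE u0)).
(* Every later approximation is the image under the same word of length n of some inner plane, so
   [gap_inner] compares them all at rate rho^n. *)
have Esplit n m x : (n <= m)%N -> plane (E m x) =
    mx_act (w n (iter n S x)) (mx_act (w (m - n).+1 (iter m.+1 S x)) E0).
  move=> nm; rewrite -mx_act_mul /=; congr mx_act.
  have -> : iter n S x = iter (m - n).+1 T (iter m.+1 S x).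
    by rewrite -{2}(subnK nm) -addSn iterD TSn.
  by rewrite /w -cocycle_add addnS subnKC.
have Fsplit n m x : (n <= m)%N -> plane (F' m x) =
    mx_act (invmx (w n x)) (mx_act (invmx (w (m - n)%N (iter n T x))) F0).
  move=> nm; rewrite -mx_act_mul /=; congr mx_act.
  rewrite /w -{1}(subnK nm) cocycle_add.
  by rewrite invmx_mulmx//; exact: uw.
have gE x n m : (n <= m)%N -> gap2 (r n) (E n x) (E m x).
  move=> nm; rewrite (Esplit n n)// (Esplit n m)//.
  by split; apply: (gap_inner hGL hC K1 HK (ltnW id) (hw _ _) _ (grass_dim F0)) => //;
    rewrite dim_mx_act ?grass_dim.
have outF n x : outer_plane Cv (mx_act (invmx (w n x)) F0).
  exact: (outer_plane_act hGL hC (hw n x) outF0).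
have gF x n m : (n <= m)%N -> gap2 (r n) (F' n x) (F' m x).
  move=> nm; rewrite (Fsplit n n)// (Fsplit n m)//.
  split; apply: (gap_outer hGL hC K1 HK (ltnW id) (hw _ _) _ _ (in1 0%N x)) => //;
    by rewrite dim_mx_act ?unitmx_inv ?grass_dim.
have /choice[EE hEE] : forall x, exists L : grass R d i, forall n, gap2 (r n) (E n x) L.
  by move=> x; apply: grass_limit => // n m; exact: gE.
have /choice[FF hFF] : forall x, exists L : grass R d (d - i),
    forall n, gap2 (r n) (F' n x) L.
  by move=> x; apply: grass_limit => // n m; exact: gF.
have rlim' e : 0 < e -> exists n, r n < e.
  by move=> /rlim[n hn]; exists n; exact: hn.
have dd : (i + (d - i) = d)%N by rewrite subnKC// ltnW.
have d0 := cone_gt0 hC.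
have nearE x z n : z \in plane (EE x) ->
    exists z', [/\ z' \in plane (E n x), enorm (z - z') <= r n * enorm z &
      enorm z' <= enorm z].
  move=> zE; exists (oproj (E n x) *m z); split; [exact: oproj_mem| |exact: oproj_le].
  exact: (proj2 (hEE x n)).
have nearF x z n : z \in plane (FF x) ->
    exists z', [/\ z' \in plane (F' n x), enorm (z - z') <= r n * enorm z &
      enorm z' <= enorm z].
  move=> zF; exists (oproj (F' n x) *m z); split; [exact: oproj_mem| |exact: oproj_le].
  exact: (proj2 (hFF x n)).
exists EE, FF; split.
- split.
    apply: (continuous_grass_limit (G := E) (r := r)) => // n.
    apply: (continuous_act (M := fun x => w n.+1 (iter n.+1 S x)) (K := K ^+ n.+1)) => //.
    + by move=> x; apply: continuous_comp; [exact: continuous_iter|exact: cw].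
    + by rewrite exprn_gt0.
  apply: (continuous_grass_limit (G := F') (r := r)) => // n.
  apply: (continuous_act_inv (M := w n) (K := K ^+ n)) => //.
  by rewrite exprn_gt0.
(* A common vector would be within r n of both approximations, which [inner_outer] keeps apart; this
   is contradictory once r n (delta + 2) < delta. *)
- move=> x; have tr : transverse (EE x) (FF x).
    apply/transverseP => z zE zF; apply/eqP; apply/negP => /negP z0.
    have nz : 0 < enorm z by rewrite enorm_gt0.
    have d2 : 0 < delta + 2 by rewrite addr_gt0.
    have [n hn] := rlim' _ (divr_gt0 d0 d2).
    have [e [eE he _]] := nearE x z n zE; have [f [fF hf _]] := nearF x z n zF.
    have fF' : - f \in plane (F' n x) by rewrite rpredN.
    have := inner_outer hC (in1 n (iter n.+1 S x)) (outF n x) eE fF'.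
    have h1 : enorm (e - f) <= enorm (z - e) + enorm (z - f).
      rewrite (enorm_distC z e); apply: le_trans (enorm_triangle _ _).
      by rewrite addrA subrK.
    have h2 := enorm_dist z e.
    move: hn; rewrite ltr_pdivlMr// => hn h3.
    have : delta * (enorm z - enorm e) <= delta * (r n * enorm z).
      by rewrite ler_pM2l//; exact: le_trans he.
    have : (r n * (delta + 2)) * enorm z < delta * enorm z by rewrite ltr_pM2r.
    lra.
  split; last exact: tr.
  by apply: transverse_full; rewrite // !grass_dim.
- move=> x.
  have bA := HK (rA _ (ex_intro2 _ _ x Logic.I erefl)).
  have uA : A x \in unitmx by apply: hGL; apply: rA; exists x.
  have K2 : 0 < K ^+ 2 by rewrite exprn_gt0.
  have rK e : 0 < e -> exists n, K ^+ 2 * r n + r n.+1 <= e /\ r n + K ^+ 2 * r n.+1 <= e.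
    move=> e0; have K21 : 0 < K ^+ 2 + 1 by rewrite addr_gt0.
    have [n hn] := rlim _ (divr_gt0 e0 K21); exists n.
    have := hn n (leqnn _); have := hn n.+1 (leqnSn _).
    rewrite !ltr_pdivlMr//; have := r0 n; have := r0 n.+1; move: (r n) (r n.+1) => a b.
    set q := K ^+ 2 in K2 K21 * => h1 h2 h3 h4.
    have p1 : 0 <= q * a by rewrite mulr_ge0// ltW.
    have p2 : 0 <= q * b by rewrite mulr_ge0// ltW.
    have [ab|/ltW ab] := leP a b; have : q * a <= q * b \/ q * b <= q * a by apply/orP; exact: le_total.
      split; nra.
    split; nra.
  (* The approximations are equivariant up to a shift of the index, upwards for E and downwards for
     F'. The action being K^2-Lipschitz for gaps, the limits are invariant by [gap_eq]. *)
  have eE n : mx_act (A x) (E n x) = E n.+1 (T x).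
    have ex : iter n.+2 S (T x) = iter n.+1 S x by rewrite iterSr TS.
    have ew y : w n.+2 y = A (iter n.+1 T y) *m w n.+1 y by [].
    by rewrite -mx_act_mul [RHS]/(mx_act _ _) ex ew TSn.
  have eF n : mx_act (A x) (F' n.+1 x) = F' n (T x).
    have -> : plane (F' n.+1 x) = mx_act (invmx (A x)) (F' n (T x)).
      have ew : w n.+1 x = w n (T x) *m A x.
        by rewrite /w -addn1 cocycle_add; congr (_ *m _); rewrite /= mulmx1.
      rewrite [LHS]/(mx_act (invmx (w n.+1 x)) F0) ew invmx_mulmx//.
      exact: mx_act_mul.
    exact: mx_actKV.
  split; apply: gap_eq; rewrite ?dim_mx_act ?grass_dim// => e /rK[n [h1 h2]].
  + apply: (gap_le h1); apply: gap_trans (proj1 (hEE (T x) n.+1)) => //.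
    by rewrite -eE; apply: (gap_act (ltW K0) (r0 n) bA); exact: (proj2 (hEE x n)).
  + apply: (gap_le h2); rewrite addrC; apply: gap_trans (proj1 (hFF (T x) n)) => //.
    by rewrite -eF; apply: (gap_act (ltW K0) (r0 n.+1) bA); exact: (proj2 (hFF x n.+1)).
- have cc0 : 0 < cone_const delta K := lt_le_trans ltr01 (cone_const_ge1 hC K1).
  have rho0 : 0 < rho by case/andP: rho01.
  exists (cone_const delta K + 1), rho; split=> // [|x k]; first by rewrite addr_gt0.
  pose q := cone_const delta K * rho ^+ k.
  have q0 : 0 < q by rewrite mulr_gt0// exprn_gt0.
  have Bk : 0 <= K ^+ k by rewrite exprn_ge0// ltW.
  have key u v : u \in plane (EE x) -> v \in plane (FF x) ->
      enorm (w k x *m v) * enorm u <= q * (enorm (w k x *m u) * enorm v).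
    (* The limit planes only adhere to the cone and its complement, so [cone_contract] is applied to
       approximations u', v'. The three terms of [M] collect the errors made in w u', w v and u. *)
    move=> uE vF; pose M := (q * K ^+ k + K ^+ k + K ^+ k) * (enorm u * enorm v).
    have M0 : 0 <= M by rewrite !mulr_ge0// !addr_ge0// mulr_ge0// ltW.
    apply: (ler_eps_mul M0) => e e0; have [n0 hn0] := rlim e e0.
    pose n := maxn n0 k; have re := hn0 n (leq_maxl _ _).
    have kn : (k <= n)%N by exact: leq_maxr.
    have [u' [u'E hu _]] := nearE x u n uE; have [v' [v'F hv nv']] := nearF x v n vF.
    (* Here n >= k matters: the remaining n - k letters carry w_k v' into [F0], so it cannot be in
       the cone yet. *)
    have wv' : ~ Cv (w k x *m v').
      rewrite mem_mx_act_inv// in v'F => h; apply: (hF0 _ v'F).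
      by rewrite /w -(subnK kn) cocycle_add -mulmxA; exact: (cone_word hC (hw _ _) h).
    have h1 : enorm (w k x *m v') * enorm u' <= q * (enorm (w k x *m u') * enorm v').
      have [->|u'0] := eqVneq u' 0.
        by rewrite enorm0 mulr0; exact: mulr_ge0 (ltW q0) (mulr_ge0 (enorm_ge0 _) (enorm_ge0 _)).
      apply: (cone_contract hC K1 HK (hw k x) _ wv').
      exact: (innerW hC (in1 n (iter n.+1 S x) _ u'E u'0)).
    have hwB z : enorm (w k x *m z) <= K ^+ k * enorm z.
      exact: (proj1 (word_bounded (ltW K0) HK (hw k x) z)).
    have rn := r0 n.
    have hWv : enorm (w k x *m v) <= enorm (w k x *m v') + K ^+ k * (e * enorm v).
      have := hwB (v - v'); rewrite mulmxBr => h.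
      have := enorm_dist (w k x *m v) (w k x *m v').
      have : K ^+ k * enorm (v - v') <= K ^+ k * (e * enorm v).
        by rewrite ler_wpM2l// (le_trans hv)// ler_wpM2r// ltW.
      lra.
    have hWu : enorm (w k x *m u') <= enorm (w k x *m u) + K ^+ k * (e * enorm u).
      have := hwB (u' - u); rewrite mulmxBr => h.
      have := enorm_dist (w k x *m u') (w k x *m u).
      have : K ^+ k * enorm (u' - u) <= K ^+ k * (e * enorm u).
        by rewrite ler_wpM2l// enorm_distC (le_trans hu)// ler_wpM2r// ltW.
      lra.
    have hb : enorm u <= enorm u' + e * enorm u.
      have := enorm_dist u u'; have : r n * enorm u <= e * enorm u.
        exact: ler_wpM2r (enorm_ge0 u) _ _ (ltW re).
      lra.
    have hWv' := hwB v'.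
    rewrite /M; move: (enorm_ge0 u) (enorm_ge0 v) (enorm_ge0 u') (enorm_ge0 v').
    move: (enorm_ge0 (w k x *m u)) (enorm_ge0 (w k x *m v)) (enorm_ge0 (w k x *m u')).
    move: (enorm_ge0 (w k x *m v')) hWv hWu hb hWv' h1 nv' Bk q0 => {M M0}.
    move: (enorm (w k x *m u)) (enorm (w k x *m v)) (enorm (w k x *m u')).
    move: (enorm (w k x *m v')) (enorm u) (enorm v) (enorm u') (enorm v') (K ^+ k) q.
    move=> a' b s b' s' B Q p a p' a'0 ha hp hb ha' h1 hs B0 Q0 p0 A0 p'0 b0 s0 b'0 s'0.
    have i1 : a * b <= (a' + B * (e * s)) * b by rewrite ler_wpM2r.
    have i2 : a' * b <= a' * (b' + e * b) by rewrite ler_wpM2l.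
    have i3 : a' * (e * b) <= (B * s) * (e * b).
      by rewrite ler_wpM2r ?mulr_ge0 ?(ltW e0)// (le_trans ha')// ler_wpM2l.
    have i4 : Q * (p' * s') <= Q * ((p + B * (e * b)) * s).
      by rewrite ler_pM2l//; apply: ler_pM.
    nra.
  have dE : (0 < \dim (EE x))%N by rewrite grass_dim; case/andP: hi.
  have dF : (0 < \dim (FF x))%N by rewrite grass_dim subn_gt0.
  have cE : 0 < conorm_on (w k x) (EE x).
    apply: (@lt_le_trans _ _ (K ^+ k)^-1); first by rewrite invr_gt0 exprn_gt0.
    apply: conorm_on_ge => // u _ nu.
    by rewrite -[leLHS]mul1r ler_pdivrMr ?exprn_gt0// mulrC -nu.
  apply: (@le_lt_trans _ _ q); last by rewrite ltr_pM2r ?exprn_gt0// ltrDl.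
  rewrite ler_pdivrMr//; apply: norm_on_le => // v vF nv.
  rewrite mulrC -ler_pdivrMr//; apply: conorm_on_ge => // u uE nu.
  by rewrite ler_pdivrMr// mulrC; have := key u v uE vF; rewrite nu nv !mulr1.
Qed.

End ConeToSplitting.

(** * Uniform transversality *)

Section Frames.
Variable R : realType.

Lemma frame_proj_sym m n (V : 'M[R]_(m, n)) : (V *m V^T)^T = V *m V^T.
Proof. by rewrite trmx_mul trmxK. Qed.

Lemma frame_proj_idem m n (V : 'M[R]_(m, n)) : V^T *m V = 1%:M ->
  (V *m V^T) *m (V *m V^T) = V *m V^T.
Proof. by move=> h; rewrite -!mulmxA (mulmxA V^T) h mul1mx. Qed.

Section OneFrame.
Variables (m n : nat) (V : 'M[R]_(m, n)).
Hypothesis oV : V^T *m V = 1%:M.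

Lemma frame_projE (x : 'cV[R]_m) : enorm (V *m V^T *m x) = enorm (V^T *m x).
Proof. by rewrite -mulmxA enorm_iso. Qed.

Lemma frame_le (x : 'cV[R]_m) : enorm (V^T *m x) <= enorm x.
Proof.
by rewrite -frame_projE; apply: proj_le; [exact: frame_proj_sym|exact: frame_proj_idem].
Qed.

Lemma frame_coproj_le (x : 'cV[R]_m) : enorm (x - V *m V^T *m x) <= enorm x.
Proof. by apply: coproj_le; [exact: frame_proj_sym|exact: frame_proj_idem]. Qed.

Lemma frame_coproj_ker (x : 'cV[R]_m) : V^T *m (x - V *m V^T *m x) = 0.
Proof. by rewrite mulmxBr -!mulmxA (mulmxA V^T V) oV mul1mx subrr. Qed.

Lemma frame_ge (x : 'cV[R]_m) : enorm x - enorm (x - V *m V^T *m x) <= enorm (V^T *m x).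
Proof.
rewrite -frame_projE; have := enorm_dist x (x - V *m V^T *m x).
by rewrite opprB addrCA subrr addr0.
Qed.

Definition col_space : {vspace 'cV[R]_m} :=
  limg (linfun (mulmx V : 'cV[R]_n -> 'cV[R]_m)).

Lemma col_spaceP x : reflect (exists z, x = V *m z) (x \in col_space).
Proof.
apply: (iffP idP) => [/memv_imgP[z _ ->]|[z ->]]; first by exists z; rewrite lfunE.
by apply/memv_imgP; exists z; rewrite ?memvf// lfunE.
Qed.

Lemma dim_col_space : \dim col_space = n.
Proof.
rewrite /col_space limg_dim_eq ?dim_cV//; apply/eqP; rewrite -subv0; apply/subvP => x.
rewrite memv_cap memv_ker lfunE/= memv0 memvf/= => /eqP h.
by rewrite -[x]mul1mx -oV -mulmxA h mulmx0.
Qed.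

Lemma frame_transverse : transverse col_space (kerspace V^T).
Proof.
apply/transverseP => _ /col_spaceP[z ->]; rewrite mem_kerspace => /eqP.
by rewrite mulmxA oV mul1mx => ->; rewrite mulmx0.
Qed.

Lemma dim_frame_ker : (n <= m)%N -> \dim (kerspace V^T) = (m - n)%N.
Proof.
move=> nm; apply/eqP; rewrite eqn_leq dim_kerspace andbT leqNgt; apply/negP => h.
have [|x [x0 x1 x2]] := @meet_nonzero _ _ col_space (kerspace V^T).
  by rewrite dim_col_space -[ltnLHS](subnKC nm) ltn_add2l.
by have /transverseP/(_ x x1 x2)/eqP := frame_transverse; apply/negP.
Qed.

End OneFrame.

(** What a singular value decomposition says about the plane of [V] alone. When t is small against
    s, this nearly determines the plane. *)
Definition half_data m n p (M : 'M[R]_(p, m)) (V : 'M[R]_(m, n)) (s t : R) :=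
  (forall x : 'cV_m, s * enorm (V^T *m x) <= enorm (M *m x)) /\
  (forall x : 'cV_m, V^T *m x = 0 -> enorm (M *m x) <= t * enorm x).

(** If V^T z = 0, then s' |V'^T z| <= |M' z| <= K |M z| <= K t |z|, so each kernel is nearly
    contained in the other. A transposition turns this into closeness of the projectors. *)
Lemma half_data_close m n p p' (M : 'M[R]_(p, m)) (M' : 'M[R]_(p', m))
    (V V' : 'M[R]_(m, n)) s s' t t' K a :
  V^T *m V = 1%:M -> V'^T *m V' = 1%:M ->
  half_data M V s t -> half_data M' V' s' t' -> 0 < s -> 0 < s' -> 0 <= K -> 0 <= a ->
  (forall x : 'cV_m, enorm (M' *m x) <= K * enorm (M *m x)) ->
  (forall x : 'cV_m, enorm (M *m x) <= K * enorm (M' *m x)) ->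
  K * t <= a * s' -> K * t' <= a * s ->
  forall x, enorm ((V' *m V'^T - V *m V^T) *m x) <= (a + a) * enorm x.
Proof.
move=> oV oV' [h1 h2] [h1' h2'] s0 s0' K0 a0 hK1 hK2 ha hb x.
have ka z : V^T *m z = 0 -> enorm (V'^T *m z) <= a * enorm z.
  move=> hz; rewrite -(ler_pM2l s0'); apply: (le_trans (h1' z)).
  apply: (le_trans (hK1 z)); apply: (@le_trans _ _ (K * (t * enorm z))).
    by rewrite ler_wpM2l// h2.
  by rewrite mulrA [leRHS]mulrA (mulrC s') ler_wpM2r.
have kb z : V'^T *m z = 0 -> enorm (V^T *m z) <= a * enorm z.
  move=> hz; rewrite -(ler_pM2l s0); apply: (le_trans (h1 z)).
  apply: (le_trans (hK2 z)); apply: (@le_trans _ _ (K * (t' * enorm z))).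
    by rewrite ler_wpM2l// h2'.
  by rewrite mulrA [leRHS]mulrA (mulrC s) ler_wpM2r.
set P := V *m V^T; set P' := V' *m V'^T; pose z := P *m x - P' *m (P *m x).
have z0 : V'^T *m z = 0 by exact: frame_coproj_ker.
have -> : (P' - P) *m x = P' *m (x - P *m x) - z.
  by rewrite /z mulmxBl mulmxBr opprB addrA subrK.
rewrite mulrDl; apply: (le_trans (enorm_triangleB _ _)); apply: lerD.
  rewrite frame_projE//; apply: (le_trans (ka _ (frame_coproj_ker oV x))).
  by rewrite ler_wpM2l// frame_coproj_le.
have [->|nz0] := eqVneq z 0; first by rewrite enorm0 mulr_ge0.
rewrite -(ler_pM2r (_ : 0 < enorm z)) ?enorm_gt0// -expr2 enorm_sqr.
have -> : dot z z = dot (P *m z) x.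
  rewrite {2}/z dotBr (dot_mulmx P) frame_proj_sym (dot_mulmx P') frame_proj_sym.
  by rewrite /P' -(mulmxA V' V'^T z) z0 mulmx0 /dot trmx0 mul0mx [X in _ - X]mxE subr0.
apply: (le_trans (dot_le _ _)); rewrite frame_projE// mulrAC ler_wpM2r//.
exact: kb.
Qed.

(** Factor N + H = (1 + H N^-1) N, where H N^-1 has norm at most [eta]. *)
Lemma det_perturb n (N H : 'M[R]_n) eta : 0 <= eta <= 1 ->
  (forall z : 'cV_n, enorm (H *m z) <= eta * enorm (N *m z)) ->
  (1 - eta) ^+ n * `|\det N| <= `|\det (N + H)|.
Proof.
move=> /andP[e0 e1] h; have [N0|N0] := eqVneq (\det N) 0.
  by rewrite N0 normr0 mulr0.
have Nu : N \in unitmx by rewrite unitmxE unitfE.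
have -> : N + H = (1%:M + H *m invmx N) *m N.
  by rewrite mulmxDl mul1mx -mulmxA mulVmx// mulmx1.
rewrite det_mulmx normrM ler_wpM2r//; apply: det_ge => [|z]; first by rewrite subr_ge0.
have := h (invmx N *m z); rewrite mulKVmx// mulmxA => hz.
rewrite mulmxDl mul1mx; have := enorm_dist z (- (H *m invmx N *m z)).
rewrite opprK enormN; lra.
Qed.

End Frames.

Section TopData.
Variables (R : realType) (d i : nat).
Variables (M : 'M[R]_d) (W U : 'M[R]_(d, i)) (D : 'M[R]_i).
Hypothesis hT : top_data M W U D.

Lemma top_half : half_data M W (singular_value i M) (singular_value i.+1 M).
Proof.
split=> [x|x]; last exact: (top_high hT).
apply: (le_trans (top_low hT _)); rewrite mulmxA -(topUM hT) -mulmxA.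
exact: frame_le (topU hT) _.
Qed.

(** The projection onto the plane of U corresponds through M to that of W, so the part of M x off U
    is the image of the part of x off W. *)
Lemma top_outer x : 
  enorm (M *m x - U *m U^T *m (M *m x)) <= singular_value i.+1 M * enorm (x - W *m W^T *m x).
Proof.
have -> : U *m U^T *m (M *m x) = M *m (W *m W^T *m x).
  by rewrite mulmxA -(mulmxA U) (topUM hT) mulmxA -(topMW hT) -!mulmxA.
by rewrite -mulmxBr; apply: (top_high hT); exact: (frame_coproj_ker (topW hT)).
Qed.

Lemma top_D x : enorm (D *m x) = enorm (M *m (W *m x)).
Proof. by rewrite mulmxA (topMW hT) -mulmxA (enorm_iso _ (topU hT)). Qed.

(** Transposition exchanges W and U, so facts on input planes under left prolongation become facts
    on output planes under right prolongation. *)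
Lemma top_dual_half : half_data M^T U (singular_value i M) (singular_value i.+1 M).
Proof.
have e : W^T *m M^T = D *m U^T by rewrite -trmx_mul (topMW hT) trmx_mul (topDT hT).
split=> [y|y hy].
  apply: (le_trans (top_low hT _)); rewrite mulmxA -e -mulmxA.
  exact: frame_le (topW hT) _.
set z := M^T *m y; have hz : W^T *m z = 0 by rewrite mulmxA e -mulmxA hy mulmx0.
have [->|z0] := eqVneq z 0; first by rewrite enorm0 mulr_ge0// sv_ge0.
rewrite -(ler_pM2r (_ : 0 < enorm z)) ?enorm_gt0// -expr2 enorm_sqr {1}/z.
rewrite dotC dot_mulmx trmxK; apply: (le_trans (dot_le _ _)).
by rewrite mulrAC ler_wpM2r//; exact: (top_high hT).
Qed.

End TopData.

Section Transversality.
Variables (R : realType) (d i : nat) (Sigma : set 'M[R]_d).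
Hypothesis i0 : (0 < i)%N.
Hypothesis id : (i < d)%N.
Hypothesis hGL : Sigma `<=` GL R d.
Variable K : R.
Hypothesis K1 : 1 <= K.
Hypothesis HK : bounded_by Sigma K.
Variables C0 tau : R.
Hypothesis C0_gt0 : 0 < C0.
Hypothesis tau01 : 0 < tau < 1.
Hypothesis gapH : forall n M, (0 < n)%N -> word Sigma n M ->
  singular_value i.+1 M <= C0 * tau ^+ n * singular_value i M.
Variables (W U : 'M[R]_d -> 'M[R]_(d, i)) (D : 'M[R]_d -> 'M[R]_i).
Hypothesis topH : forall M, M \in unitmx -> top_data M (W M) (U M) (D M).

Let K0 : 0 < K := lt_le_trans ltr01 K1.
Let tau0 : 0 < tau. Proof. by case/andP: tau01. Qed.
Let tau1 : tau < 1. Proof. by case/andP: tau01. Qed.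
Let taun n : 0 < tau ^+ n := exprn_gt0 n tau0.

Local Notation s M := (singular_value i M).
Local Notation t M := (singular_value i.+1 M).
Local Notation P M := (W M *m (W M)^T).
Local Notation Q M := (U M *m (U M)^T).

Lemma word_top n M : word Sigma n M -> top_data M (W M) (U M) (D M).
Proof. by move=> hM; apply: topH; exact: word_unit hGL hM. Qed.

Lemma word_s_gt0 n M : word Sigma n M -> 0 < s M.
Proof. by move=> hM; apply: sv_gt0; [rewrite i0 ltnW|exact: word_unit hGL hM]. Qed.

Definition bibounded (B : 'M[R]_d) (b : R) := forall x : 'cV_d,
  enorm (B *m x) <= b * enorm x /\ enorm x <= b * enorm (B *m x).

Lemma bibounded_inv B b : B \in unitmx -> bibounded B b -> bibounded (invmx B) b.
Proof. by move=> Bu hB x; have [] := hB (invmx B *m x); rewrite mulKVmx. Qed.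

Lemma bibounded_tr B b : 0 <= b -> B \in unitmx -> bibounded B b -> bibounded B^T b.
Proof.
move=> b0 Bu hB x; split.
  set z := B^T *m x; have [->|z0] := eqVneq z 0; first by rewrite enorm0 mulr_ge0.
  rewrite -(ler_pM2r (_ : 0 < enorm z)) ?enorm_gt0// -expr2 enorm_sqr {1}/z.
  rewrite dotC dot_mulmx trmxK; apply: (le_trans (dot_le _ _)).
  by rewrite mulrAC ler_wpM2r//; exact: (proj1 (hB z)).
have [->|x0] := eqVneq x 0; first by rewrite enorm0 mulr_ge0.
rewrite -(ler_pM2r (_ : 0 < enorm x)) ?enorm_gt0// -expr2 enorm_sqr.
rewrite -{2}(mulKVmx Bu x) dot_mulmx; apply: (le_trans (dot_le _ _)).
rewrite mulrC mulrAC ler_wpM2r//.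
by have := proj2 (hB (invmx B *m x)); rewrite mulKVmx.
Qed.

(** Min-max with the plane of W M as test space; [s_mulr] tests on its preimage under [B]. *)
Lemma s_mull B b M : 0 < b -> M \in unitmx -> bibounded B b -> s M <= b * s (B *m M).
Proof.
move=> b0 Mu hB; have hT := topH Mu; rewrite -ler_pdivrMl//.
apply: (sv_ge i0 (dim_col_space (topW hT))) => _ /col_spaceP[z ->].
rewrite -mulrA ler_pdivrMl// -mulmxA; apply: le_trans (proj2 (hB _)).
by rewrite -(top_D hT) (enorm_iso _ (topW hT)); exact: (top_low hT).
Qed.

Lemma s_mulr B b M : 0 < b -> M \in unitmx -> B \in unitmx -> bibounded B b ->
  s M <= b * s (M *m B).
Proof.
move=> b0 Mu Bu hB; have hT := topH Mu; rewrite -ler_pdivrMl//.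
have dE : \dim (mx_act (invmx B) (col_space (W M))) = i.
  by rewrite dim_mx_act ?unitmx_inv// (dim_col_space (topW hT)).
apply: (sv_ge i0 dE) => y; rewrite mem_mx_act_inv// => /col_spaceP[z hz].
rewrite -mulrA ler_pdivrMl// -mulmxA hz -(top_D hT).
apply: le_trans (ler_wpM2l (ltW b0) (top_low hT z)).
rewrite mulrCA ler_wpM2l ?sv_ge0// -(enorm_iso z (topW hT)) -hz.
exact: (proj2 (hB y)).
Qed.

(** Twice the [a] of [half_data_close]: one K relates |A M x| to |M x|, the other relates their i-th
    singular values. [sum_const] sums the geometric series of steps. *)
Definition step_const := K ^+ 2 * C0 + K ^+ 2 * C0.
Definition sum_const := step_const / (1 - tau).

Let tau1' : 0 < 1 - tau. Proof. by rewrite subr_gt0. Qed.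

Lemma step_const_gt0 : 0 < step_const. Proof. by rewrite addr_gt0 ?mulr_gt0 ?exprn_gt0. Qed.
Lemma sum_const_gt0 : 0 < sum_const. Proof. by rewrite divr_gt0 ?step_const_gt0. Qed.

Lemma top_step n M A : (0 < n)%N -> word Sigma n M -> Sigma A ->
  forall x, enorm ((P (A *m M) - P M) *m x) <= step_const * tau ^+ n * enorm x.
Proof.
move=> n0 hM SA; have hM' := wordS SA hM; have Mu := word_unit hGL hM.
have Au := hGL SA; have bA : bibounded A K by exact: HK.
have -> : step_const * tau ^+ n = K ^+ 2 * C0 * tau ^+ n + K ^+ 2 * C0 * tau ^+ n by rewrite mulrDl.
have hT := word_top hM; have hT' := word_top hM'.
apply: (half_data_close (topW hT) (topW hT') (top_half hT) (top_half hT') (K := K)).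
- exact: word_s_gt0 hM.
- exact: word_s_gt0 hM'.
- exact: ltW.
- by rewrite ?mulr_ge0 ?exprn_ge0// ltW.
- by move=> x; rewrite -mulmxA; exact: (proj1 (bA _)).
- by move=> x; rewrite -mulmxA; exact: (proj2 (bA _)).
- rewrite expr2 -!mulrA ler_pM2l//; apply: (le_trans (gapH n0 hM)).
  rewrite -mulrA (mulrCA K) ler_pM2l// (mulrCA K) ler_pM2l//.
  exact: s_mull.
- rewrite expr2 -!mulrA ler_pM2l//; apply: (le_trans (gapH _ hM')) => //.
  rewrite -mulrA (mulrCA K) ler_pM2l// (mulrCA K).
  apply: (@le_trans _ _ (tau ^+ n * s (A *m M))).
    by rewrite ler_wpM2r ?sv_ge0// exprS ler_piMl// ltW.
  rewrite ler_pM2l//; have := s_mull K0 (word_unit hGL hM') (bibounded_inv Au bA).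
  by rewrite mulKmx.
Qed.

Lemma out_step n M A : (0 < n)%N -> word Sigma n M -> Sigma A ->
  forall x, enorm ((Q (M *m A) - Q M) *m x) <= step_const * tau ^+ n * enorm x.
Proof.
move=> n0 hM SA; have hM' : word Sigma n.+1 (M *m A).
  by rewrite -addn1; apply: word_cat hM (word1 SA).
have Mu := word_unit hGL hM.
have Au := hGL SA; have bA : bibounded A K by exact: HK.
have bAT := bibounded_tr (ltW K0) Au bA.
have -> : step_const * tau ^+ n = K ^+ 2 * C0 * tau ^+ n + K ^+ 2 * C0 * tau ^+ n by rewrite mulrDl.
have hT := word_top hM; have hT' := word_top hM'.
apply: (half_data_close (topU hT) (topU hT') (top_dual_half hT) (top_dual_half hT') (K := K)).
- exact: word_s_gt0 hM.
- exact: word_s_gt0 hM'.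
- exact: ltW.
- by rewrite ?mulr_ge0 ?exprn_ge0// ltW.
- by move=> x; rewrite trmx_mul -mulmxA; exact: (proj1 (bAT _)).
- by move=> x; rewrite trmx_mul -mulmxA; exact: (proj2 (bAT _)).
- rewrite expr2 -!mulrA ler_pM2l//; apply: (le_trans (gapH n0 hM)).
  rewrite -mulrA (mulrCA K) ler_pM2l// (mulrCA K) ler_pM2l//.
  exact: s_mulr.
- rewrite expr2 -!mulrA ler_pM2l//; apply: (le_trans (gapH _ hM')) => //.
  rewrite -mulrA (mulrCA K) ler_pM2l// (mulrCA K).
  apply: (@le_trans _ _ (tau ^+ n * s (M *m A))).
    by rewrite ler_wpM2r ?sv_ge0// exprS ler_piMl// ltW.
  rewrite ler_pM2l//.
  have Au' : invmx A \in unitmx by rewrite unitmx_inv.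
  have := s_mulr K0 (word_unit hGL hM') Au' (bibounded_inv Au bA).
  by rewrite mulmxK.
Qed.

Lemma step_constE : step_const = sum_const * (1 - tau).
Proof. by rewrite /sum_const divfK// gt_eqF. Qed.

(** 1 - tau^k is the normalized partial sum of the series, so the induction closes with equality. *)
Lemma geometric_step n k (a b e : R) : a <= step_const * tau ^+ (k + n) * e ->
  b <= sum_const * tau ^+ n * (1 - tau ^+ k) * e ->
  a + b <= sum_const * tau ^+ n * (1 - tau ^+ k.+1) * e.
Proof.
move=> ha hb; apply: (le_trans (lerD ha hb)).
by rewrite step_constE exprD exprS -subr_ge0 [X in 0 <= X](_ : _ = 0) ?lexx//; ring.
Qed.

Lemma top_sum_aux n k M w : (0 < n)%N -> word Sigma n M -> word Sigma k w ->
  forall x, enorm ((P (w *m M) - P M) *m x) <= sum_const * tau ^+ n * (1 - tau ^+ k) * enorm x.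
Proof.
move=> n0 hM; elim=> [|A {}k {}w SA hw IH] x.
  by rewrite mul1mx subrr mul0mx enorm0 subrr mulr0 mul0r.
have hwM := word_cat hw hM.
have -> : (P (A *m w *m M) - P M) *m x =
    (P (A *m (w *m M)) - P (w *m M)) *m x + (P (w *m M) - P M) *m x.
  by rewrite -mulmxDl mulmxA subrKA.
apply: (le_trans (enorm_triangle _ _)); apply: geometric_step => //.
by apply: top_step => //; rewrite addn_gt0 n0 orbT.
Qed.

Lemma out_sum_aux n k M w : (0 < n)%N -> word Sigma n M -> word Sigma k w ->
  forall x, enorm ((Q (M *m w) - Q M) *m x) <= sum_const * tau ^+ n * (1 - tau ^+ k) * enorm x.
Proof.
move=> n0 hM; elim: k w => [|k IH] w.
  by move=> hw x; inversion_clear hw; rewrite mulmx1 subrr mul0mx enorm0 subrr mulr0 mul0r.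
move=> /word_rcons[w' [A [hw' SA ->]]] x; have hwM := word_cat hM hw'.
have -> : (Q (M *m (w' *m A)) - Q M) *m x =
    (Q (M *m w' *m A) - Q (M *m w')) *m x + (Q (M *m w') - Q M) *m x.
  by rewrite -mulmxDl mulmxA subrKA.
apply: (le_trans (enorm_triangle _ _)); apply: geometric_step (IH _ hw' x).
by rewrite addnC; apply: out_step => //; rewrite addn_gt0 n0.
Qed.

Lemma one_sub_tau k : 0 <= 1 - tau ^+ k <= 1.
Proof.
apply/andP; split; last by rewrite gerBl ltW.
by rewrite subr_ge0 exprn_ile1// ltW.
Qed.

Lemma top_sum n k M w : (0 < n)%N -> word Sigma n M -> word Sigma k w ->
  forall x, enorm ((P (w *m M) - P M) *m x) <= sum_const * tau ^+ n * enorm x.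
Proof.
move=> n0 hM hw x; apply: (le_trans (top_sum_aux n0 hM hw x)); rewrite ler_wpM2r//.
have /andP[_ h] := one_sub_tau k; rewrite ler_piMr//.
by rewrite mulr_ge0 ?ltW// ?sum_const_gt0.
Qed.

Lemma out_sum n k M w : (0 < n)%N -> word Sigma n M -> word Sigma k w ->
  forall x, enorm ((Q (M *m w) - Q M) *m x) <= sum_const * tau ^+ n * enorm x.
Proof.
move=> n0 hM hw x; apply: (le_trans (out_sum_aux n0 hM hw x)); rewrite ler_wpM2r//.
have /andP[_ h] := one_sub_tau k; rewrite ler_piMr//.
by rewrite mulr_ge0 ?ltW// ?sum_const_gt0.
Qed.

(** When half of x lies along the leading input plane, |M x| >= sigma_i |x| / 2, whereas its part
    off the output plane is at most sigma_(i+1) |x|. *)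
Lemma slope n M x : (0 < n)%N -> word Sigma n M -> enorm x <= 2 * enorm ((W M)^T *m x) ->
  enorm (M *m x - Q M *m (M *m x)) <= 2 * C0 * tau ^+ n * enorm (M *m x).
Proof.
move=> n0 hM hx; have hT := word_top hM.
apply: (le_trans (top_outer hT x)).
apply: (@le_trans _ _ (t M * enorm x)).
  by rewrite ler_wpM2l ?sv_ge0//; exact: (frame_coproj_le (topW hT)).
apply: (@le_trans _ _ (C0 * tau ^+ n * (s M * enorm x))).
  by rewrite mulrA ler_wpM2r// gapH.
rewrite [leRHS](_ : _ = C0 * tau ^+ n * (2 * enorm (M *m x))); last by ring.
apply: ler_wpM2l; first exact: mulr_ge0 (ltW C0_gt0) (ltW (taun n)).
apply: (@le_trans _ _ (2 * (s M * enorm ((W M)^T *m x)))).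
  by rewrite mulrCA ler_wpM2l ?sv_ge0.
by rewrite ler_pM2l// (proj1 (top_half hT)).
Qed.

Definition align_const := 2 * C0 + sum_const.

Lemma align_const_gt0 : 0 < align_const. Proof. by rewrite addr_gt0 ?sum_const_gt0// mulr_gt0. Qed.

Lemma top_of_near n M w k x : (0 < n)%N -> word Sigma n M -> word Sigma k w ->
  sum_const * tau ^+ n <= 2^-1 -> enorm (W M *m x) <= 2 * enorm ((W (w *m M))^T *m (W M *m x)).
Proof.
move=> n0 hM hw h; have hT := word_top hM; have hT' := word_top (word_cat hw hM).
have e : P M *m (W M *m x) = W M *m x.
  by rewrite -mulmxA (mulmxA (W M)^T) (topW hT) mul1mx.
have := top_sum n0 hM hw (W M *m x); rewrite mulmxBl e enorm_distC => h1.
have := enorm_dist (W M *m x) (P (w *m M) *m (W M *m x)).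
rewrite (frame_projE (topW hT')) => h2.
have : sum_const * tau ^+ n * enorm (W M *m x) <= 2^-1 * enorm (W M *m x) by rewrite ler_wpM2r.
lra.
Qed.

(* The images of the output plane of B under longer and longer words A align
   with the output plane of A, at a rate that does not depend on B. *)
Lemma output_aligned n m A B z : (0 < n)%N -> (0 < m)%N -> word Sigma n A -> word Sigma m B ->
  sum_const * tau ^+ m <= 2^-1 ->
  enorm (A *m (U B *m z) - Q A *m (A *m (U B *m z))) <=
    align_const * tau ^+ n * enorm (A *m (U B *m z)).
Proof.
move=> n0 m0 hA hB hm; have hT := word_top hB; have hAB := word_cat hA hB.
have Du : D B \in unitmx.
  apply: unitmx_inj => x Dx0; have := top_low hT x; rewrite Dx0 enorm0.
  by rewrite pmulr_rle0 ?(word_s_gt0 hB)// => h; apply/eqP; rewrite -enorm_eq0 eq_le h enorm_ge0.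
(* The vector comes from the leading input plane of [B], which is close to that of A B. So [slope]
   puts its image near U (A B), and [out_sum] puts that near U A. *)
have ez : U B *m z = B *m (W B *m (invmx (D B) *m z)).
  by rewrite mulmxA (topMW hT) -mulmxA mulKVmx.
set y := A *m _; have ey : y = A *m B *m (W B *m (invmx (D B) *m z)) by rewrite /y ez mulmxA.
have nm0 : (0 < n + m)%N by rewrite addn_gt0 n0.
have := slope nm0 hAB (top_of_near (invmx (D B) *m z) m0 hB hA hm); rewrite -ey => h1.
have := out_sum n0 hA hB y; rewrite mulmxBl => h2.
have h3 : 2 * C0 * tau ^+ (n + m) * enorm y <= 2 * C0 * tau ^+ n * enorm y.
  rewrite exprD mulrA ler_wpM2r// ler_piMr ?exprn_ile1 ?ltW// ?mulr_gt0//.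
rewrite -[y - _](subrKA (Q (A *m B) *m y)); apply: (le_trans (enorm_triangle _ _)).
by rewrite /align_const mulrDl mulrDl; apply: lerD => //; exact: le_trans h3.
Qed.

(** [step_const] is the motion of the input plane. In the other term, 4 K^2 is the product of K for
    [A'], 2 for passing from A U B to [Z], and 2 K for inverting [G]. *)
Definition loss_const := step_const + 4 * K ^+ 2 * align_const.

Lemma loss_const_gt0 : 0 < loss_const.
Proof.
apply: addr_gt0 step_const_gt0 _; apply: mulr_gt0 _ align_const_gt0; apply: mulr_gt0 => //.
exact: exprn_gt0.
Qed.

Lemma loss_const_bounds n : loss_const * tau ^+ n <= 2^-1 ->
  [/\ step_const * tau ^+ n <= 2^-1, align_const * tau ^+ n <= 2^-1, step_const * tau ^+ n <= loss_const * tau ^+ n &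
      4 * K ^+ 2 * align_const * tau ^+ n <= loss_const * tau ^+ n].
Proof.
move=> h; have c1 := step_const_gt0; have c3 := align_const_gt0; have tn := taun n.
have K21 : 1 <= K ^+ 2 by rewrite exprn_ege1.
have p1 : 0 < step_const * tau ^+ n by rewrite mulr_gt0.
have p3 : 0 < align_const * tau ^+ n by rewrite mulr_gt0.
have : align_const * tau ^+ n <= K ^+ 2 * (align_const * tau ^+ n) by rewrite ler_peMl// ltW.
by move: h; rewrite /loss_const mulrDl -!mulrA => h h'; split; lra.
Qed.

(* |det (W A)^T (U B)| measures the transversality of the output plane of B and
   the contracted plane of A.  Prolonging A to A' A multiplies it by
   det ((W M)^T (W A)) det (1 + H (G Z)^-1), which is close to 1. *)
Lemma transversality_step n m A A' B : (0 < n)%N -> (0 < m)%N ->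
  word Sigma n A -> Sigma A' -> word Sigma m B ->
  loss_const * tau ^+ n <= 2^-1 -> sum_const * tau ^+ m <= 2^-1 ->
  (1 - loss_const * tau ^+ n) ^+ (i + i) * `|\det ((W A)^T *m U B)| <=
    `|\det ((W (A' *m A))^T *m U B)|.
Proof.
move=> n0 m0 hA SA' hB hn hm; have [hn1 hn3 h14 h34] := loss_const_bounds hn.
have hA' := wordS SA' hA; set M := A' *m A in hA' *.
have hT := word_top hA; have hT' := word_top hA'; have hTB := word_top hB.
(* [Z] is A U B read in the basis U A, and [Rm] what that reading forgets; [G] and [H] follow the
   two through [A'], read in the basis U M. In [e1] and [e2] the common left factor [D M] will
   cancel between determinants. *)
pose Z := D A *m ((W A)^T *m U B); pose G := (U M)^T *m A' *m U A.
pose Rm := A *m U B - Q A *m (A *m U B).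
pose H := (U M)^T *m A' *m Rm.
have eZ : Z = (U A)^T *m (A *m U B) by rewrite /Z mulmxA -(topUM hT) -mulmxA.
have eQ : Q A *m (A *m U B) = U A *m Z by rewrite eZ -!mulmxA.
have e1 : D M *m ((W M)^T *m U B) = G *m Z + H.
  rewrite mulmxA -(topUM hT') /H /G /Rm eQ mulmxBr (mulmxA _ (U A) Z) addrC subrK.
  by rewrite /M !mulmxA.
have e2 : D M *m ((W M)^T *m W A) = G *m D A.
  by rewrite mulmxA -(topUM hT') /G /M -!mulmxA (topMW hT).
have pn : 0 < loss_const * tau ^+ n by rewrite mulr_gt0 ?loss_const_gt0.
have tauS : tau ^+ n.+1 <= tau ^+ n by rewrite exprS ler_piMl// ltW.
(* A vector of the plane of U A is the image under A of an input vector that remains half aligned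
   for [M]. By [slope] its image under [A'] is then half visible in U M. *)
have hG z : enorm z <= 2 * K * enorm (G *m z).
  set x := W A *m (invmx (D A) *m z).
  have Du : D A \in unitmx.
    apply: unitmx_inj => x' Dx0; have := top_low hT x'; rewrite Dx0 enorm0.
    rewrite pmulr_rle0 ?(word_s_gt0 hA)// => h; apply/eqP.
    by rewrite -enorm_eq0 eq_le h enorm_ge0.
  have ez : A *m x = U A *m z by rewrite /x mulmxA (topMW hT) -mulmxA mulKVmx.
  have hx : enorm x <= 2 * enorm ((W M)^T *m x).
    have := top_step n0 hA SA' x; rewrite mulmxBl.
    have e : P A *m x = x by rewrite -mulmxA (mulmxA (W A)^T) (topW hT) mul1mx.
    rewrite e enorm_distC => h1.
    have := enorm_dist x (P M *m x); rewrite (frame_projE (topW hT')) => h2.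
    have : step_const * tau ^+ n * enorm x <= 2^-1 * enorm x by rewrite ler_wpM2r.
    lra.
  have := slope (ltn0Sn n) hA' hx; rewrite {1 2 4}/M -!mulmxA ez; set y := A' *m _ => h.
  have h5 : 2 * C0 * tau ^+ n.+1 <= 2^-1.
    apply: le_trans hn3; rewrite /align_const (mulrDl (2 * C0)); apply: ler_wpDr.
      exact: mulr_ge0 (ltW sum_const_gt0) (ltW (taun n)).
    by rewrite ler_wpM2l// mulr_ge0// ltW.
  have hy : enorm y - 2^-1 * enorm y <= enorm ((U M)^T *m y).
    have := frame_ge (topU hT') y.
    have : 2 * C0 * tau ^+ n.+1 * enorm y <= 2^-1 * enorm y by rewrite ler_wpM2r.
    by move: h; rewrite mulmxA; lra.
  have hz : enorm z <= K * enorm y.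
    by rewrite -(enorm_iso z (topU hT)); exact: (proj2 (HK SA' _)).
  have : K * (enorm y - 2^-1 * enorm y) <= K * enorm ((U M)^T *m y) by rewrite ler_pM2l.
  lra.
have hRm z : enorm (Rm *m z) <= align_const * tau ^+ n * enorm (A *m (U B *m z)).
  have := output_aligned z n0 m0 hA hB hm.
  by rewrite /Rm mulmxBl -!mulmxA.
have hZ z : enorm (A *m (U B *m z)) <= 2 * enorm (Z *m z).
  set y := A *m _; have := frame_ge (topU hT) y.
  have -> : (U A)^T *m y = Z *m z by rewrite eZ -!mulmxA.
  have := output_aligned z n0 m0 hA hB hm; rewrite -/y.
  have : align_const * tau ^+ n * enorm y <= 2^-1 * enorm y by rewrite ler_wpM2r.
  lra.
pose eta := loss_const * tau ^+ n.
have eta01 : 0 <= eta <= 1 by rewrite ltW//= (le_trans hn)// invf_le1 ?ler1n.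
have hH z : enorm (H *m z) <= eta * enorm (G *m Z *m z).
  have b1 : enorm (H *m z) <= K * enorm (Rm *m z).
    rewrite /H -!mulmxA; apply: (le_trans (frame_le (topU hT') _)).
    exact: (proj1 (HK SA' _)).
  have b2 := hG (Z *m z); rewrite mulmxA in b2.
  have c3 : 0 < align_const * tau ^+ n by rewrite mulr_gt0 ?align_const_gt0.
  apply: (@le_trans _ _ (4 * K ^+ 2 * align_const * tau ^+ n * enorm (G *m Z *m z))); last first.
    by rewrite ler_wpM2r.
  apply: (le_trans b1).
  rewrite [leRHS](_ : _ = K * (align_const * tau ^+ n * (2 * (2 * K * enorm (G *m Z *m z))))); last by ring.
  rewrite ler_pM2l//; apply: (le_trans (hRm z)); rewrite ler_pM2l//.
  by apply: (le_trans (hZ z)); rewrite ler_pM2l.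
have d1 := det_perturb eta01 hH.
have d2 : (1 - eta) ^+ i <= `|\det ((W M)^T *m W A)|.
  apply: det_ge => [|z]; first by rewrite subr_ge0; case/andP: eta01.
  rewrite -mulmxA; set x := W A *m z.
  have ex : enorm x = enorm z by rewrite enorm_iso// (topW hT).
  have := top_step n0 hA SA' x; rewrite mulmxBl.
  have e : P A *m x = x by rewrite -mulmxA (mulmxA (W A)^T) (topW hT) mul1mx.
  rewrite e enorm_distC => h1.
  have := enorm_dist x (P M *m x); rewrite (frame_projE (topW hT')) => h2.
  have : step_const * tau ^+ n * enorm x <= eta * enorm x by rewrite ler_wpM2r.
  rewrite -ex; lra.
have DMu : \det (D M) != 0.
  rewrite -unitfE -unitmxE; apply: unitmx_inj => x' Dx0; have := top_low hT' x'.
  rewrite Dx0 enorm0 pmulr_rle0 ?(word_s_gt0 hA')// => h; apply/eqP.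
  by rewrite -enorm_eq0 eq_le h enorm_ge0.
have pD : 0 < `|\det (D M)| by rewrite normr_gt0.
(* The determinants of [D M], [G] and [D A] are not controlled individually; these three identities
   eliminate them. The exponent i + i comes from [d1] and [d2]. *)
have f1 : `|\det (D M)| * `|\det ((W M)^T *m U B)| = `|\det (G *m Z + H)|.
  by rewrite -e1 det_mulmx normrM.
have f2 : `|\det (D M)| * `|\det ((W M)^T *m W A)| = `|\det G| * `|\det (D A)|.
  by rewrite -!normrM -!det_mulmx e2.
have f3 : `|\det (G *m Z)| = `|\det G| * `|\det (D A)| * `|\det ((W A)^T *m U B)|.
  by rewrite det_mulmx /Z det_mulmx !normrM mulrA.
rewrite -(ler_pM2l pD) f1; apply: le_trans d1.
rewrite f3 -f2 -/eta exprD.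
have e0 : 0 <= (1 - eta) ^+ i by rewrite exprn_ge0// subr_ge0; case/andP: eta01.
rewrite [leRHS](_ : _ = (1 - eta) ^+ i * (`|\det (D M)| * `|\det ((W A)^T *m U B)|) *
  `|\det ((W M)^T *m W A)|); last by ring.
rewrite [leLHS](_ : _ = (1 - eta) ^+ i * (`|\det (D M)| * `|\det ((W A)^T *m U B)|) *
  (1 - eta) ^+ i); last by ring.
by rewrite ler_wpM2l// !mulr_ge0.
Qed.

(** Alignment gives |D A (W A)^T U B z| >= |z| / (2 K^n) whatever the length of [B]; dividing by
    |det (D A)| <= (K^n)^i gives the constant. *)
Lemma transversality_base n m A B : (0 < n)%N -> (0 < m)%N ->
  word Sigma n A -> word Sigma m B ->
  loss_const * tau ^+ n <= 2^-1 -> sum_const * tau ^+ m <= 2^-1 ->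
  ((2 * K ^+ n * K ^+ n)^-1) ^+ i <= `|\det ((W A)^T *m U B)|.
Proof.
move=> n0 m0 hA hB hn hm; have [hn1 hn3 h14 h34] := loss_const_bounds hn.
have hT := word_top hA; have hTB := word_top hB.
have Kn : 0 < K ^+ n by rewrite exprn_gt0.
have eZ : D A *m ((W A)^T *m U B) = (U A)^T *m (A *m U B).
  by rewrite mulmxA -(topUM hT) -mulmxA.
have d1 : ((2 * K ^+ n)^-1) ^+ i <= `|\det (D A *m ((W A)^T *m U B))|.
  apply: det_ge => [|z]; first by rewrite invr_ge0 mulr_ge0// ltW.
  rewrite eZ -!mulmxA; set y := A *m _; have := frame_ge (topU hT) y.
  have := output_aligned z n0 m0 hA hB hm; rewrite -/y.
  have : align_const * tau ^+ n * enorm y <= 2^-1 * enorm y by rewrite ler_wpM2r.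
  have : enorm z <= K ^+ n * enorm y.
    rewrite -(enorm_iso z (topU hTB)); exact: (proj2 (word_bounded (ltW K0) HK hA _)).
  rewrite ler_pdivrMl ?mulr_gt0// => h1 h2 h3 h4.
  have : K ^+ n * (2^-1 * enorm y) <= K ^+ n * enorm ((U A)^T *m y).
    by rewrite ler_pM2l//; lra.
  lra.
have d2 : `|\det (D A)| <= (K ^+ n) ^+ i.
  apply: det_le => [|z]; first exact: ltW.
  rewrite (top_D hT); apply: (le_trans (proj1 (word_bounded (ltW K0) HK hA _))).
  by rewrite (enorm_iso z (topW hT)).
have Kni : 0 < (K ^+ n) ^+ i by rewrite exprn_gt0.
rewrite invfM exprMn [X in _ * X]exprVn ler_pdivrMr//; apply: (le_trans d1).
by rewrite det_mulmx normrM mulrC ler_wpM2l.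
Qed.

Definition total_loss_const := loss_const / (1 - tau).

Lemma transversality_uniform : exists (theta : R) (N : nat),
  [/\ 0 < theta, theta <= 1, (0 < N)%N &
   forall n m A B, (N <= n)%N -> (N <= m)%N -> word Sigma n A -> word Sigma m B ->
    forall z, theta * enorm z <= enorm ((W A)^T *m (U B *m z))].
Proof.
have c50 : 0 < total_loss_const by rewrite divr_gt0 ?loss_const_gt0.
have C4E : loss_const = total_loss_const * (1 - tau) by rewrite /total_loss_const divfK// gt_eqF.
have C45 : loss_const <= total_loss_const by rewrite C4E ler_piMr ?(ltW c50)// gerBl ltW.
have csum : 0 <= total_loss_const + sum_const by rewrite addr_ge0// ltW// sum_const_gt0.
have [|N0 hN0] := geo_lt_eps csum tau01 (e := 2^-1); first by rewrite invr_gt0.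
pose N := N0.+1; have N_gt0 : (0 < N)%N by [].
have hN n : (N <= n)%N -> [/\ total_loss_const * tau ^+ n <= 2^-1, loss_const * tau ^+ n <= 2^-1 & sum_const * tau ^+ n <= 2^-1].
  move=> Nn; have := hN0 n (ltnW Nn); rewrite mulrDl.
  have : loss_const * tau ^+ n <= total_loss_const * tau ^+ n by rewrite ler_pM2r.
  have : 0 < sum_const * tau ^+ n by rewrite mulr_gt0 ?sum_const_gt0.
  have : 0 < total_loss_const * tau ^+ n by rewrite mulr_gt0.
  by move=> ? ? ? ?; split; lra.
pose c0 := ((2 * K ^+ N * K ^+ N)^-1) ^+ i.
have KN : 1 <= K ^+ N by rewrite exprn_ege1.
have c0_gt0 : 0 < c0.
  by rewrite exprn_gt0// invr_gt0 !mulr_gt0// (lt_le_trans ltr01).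
(* The subtracted term is the sum of [loss_const * tau ^+ j] over N <= j < k + N, and a product of
   factors 1 - x_j is at least 1 minus the sum of the x_j. With a total loss below 1/2, [theta] is
   c0 / 2^(2 i). *)
have key k A m B : word Sigma (k + N) A -> (N <= m)%N -> word Sigma m B ->
    c0 * (1 - total_loss_const * (tau ^+ N - tau ^+ (k + N))) ^+ (i + i) <= `|\det ((W A)^T *m U B)|.
  move=> + Nm hB; have [_ _ hm] := hN m Nm; have m0 := leq_trans N_gt0 Nm.
  elim: k A => [|k IH] A hA.
    have [_ hn _] := hN N (leqnn _).
    rewrite add0n subrr mulr0 subr0 expr1n mulr1.
    exact: transversality_base hA hB hn hm.
  inversion hA as [|A' n' A1 SA' hA1 e1 e2].
  have Nn : (N <= k + N)%N by rewrite leq_addl.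
  have [h5 h4 _] := hN _ Nn; have [h5' _ _] := hN N (leqnn _).
  have n0 : (0 < k + N)%N by exact: leq_trans Nn.
  have := transversality_step n0 m0 hA1 SA' hB h4 hm.
  apply: le_trans; apply: le_trans (ler_wpM2l _ (IH _ hA1)); last first.
    by rewrite exprn_ge0// subr_ge0 (le_trans h4)// invf_le1 ?ler1n.
  rewrite mulrCA ler_pM2l// -exprMn.
  have t1 : 0 < total_loss_const * tau ^+ (k + N) by rewrite mulr_gt0.
  have t3 : 0 < total_loss_const * tau ^+ (k.+1 + N) by rewrite mulr_gt0.
  have t4 : 0 <= loss_const * tau ^+ (k + N) by rewrite ltW// mulr_gt0 ?loss_const_gt0.
  set b := 1 - total_loss_const * (tau ^+ N - tau ^+ (k + N)).
  have b1 : b <= 1.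
    rewrite /b gerBl; apply: mulr_ge0; first exact: ltW.
    rewrite subr_ge0 exprD; apply: ler_piMl; first exact: ltW.
    by rewrite exprn_ile1// ltW.
  have eb : 1 - total_loss_const * (tau ^+ N - tau ^+ (k.+1 + N)) = b - loss_const * tau ^+ (k + N).
    by rewrite C4E /b addSn exprS; ring.
  have b2 : 0 <= b - loss_const * tau ^+ (k + N) by rewrite -eb mulrBr; lra.
  rewrite eb lerXn2r ?nnegrE//; first by rewrite mulr_ge0//; lra.
  rewrite mulrBl mul1r lerD2l lerN2 ler_piMr//.
exists (c0 * 2^-1 ^+ (i + i)), N; split=> //.
- by rewrite mulr_gt0// exprn_gt0// invr_gt0.
- rewrite mulr_ile1 ?(ltW c0_gt0) ?exprn_ge0 ?invr_ge0//; last first.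
    by rewrite exprn_ile1 ?invr_ge0// invf_le1 ?ler1n.
  rewrite /c0 exprn_ile1// ?invr_ge0 ?mulr_ge0 ?(le_trans ler01 KN)// invf_le1.
    by nra.
  by rewrite !mulr_gt0// (lt_le_trans ltr01).
move=> n m A B Nn Nm hA hB z; rewrite mulmxA.
have contr x : enorm ((W A)^T *m U B *m x) <= enorm x.
  rewrite -mulmxA; apply: (le_trans (frame_le (topW (word_top hA)) _)).
  by rewrite (enorm_iso _ (topU (word_top hB))).
apply: le_trans (det_contraction z contr); rewrite ler_wpM2r//.
rewrite -(subnK Nn) in hA; apply: le_trans (key _ _ _ _ hA Nm hB).
rewrite ler_pM2l// lerXn2r ?nnegrE ?invr_ge0//.
  have [h5 _ _] := hN N (leqnn _); have := taun (n - N + N).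
  move=> h; have : 0 < total_loss_const * tau ^+ (n - N + N) by rewrite mulr_gt0.
  rewrite mulrBr; lra.
have [h5 _ _] := hN N (leqnn _); have := taun (n - N + N).
move=> h; have : 0 < total_loss_const * tau ^+ (n - N + N) by rewrite mulr_gt0.
rewrite mulrBr; lra.
Qed.

End Transversality.

(** * The attractor block *)

Section AttractorBlock.
Variables (R : realType) (d i : nat) (Sigma : set 'M[R]_d).
Hypothesis i0 : (0 < i)%N.
Hypothesis id : (i < d)%N.
Hypothesis hGL : Sigma `<=` GL R d.
Variable K : R.
Hypothesis K1 : 1 <= K.
Hypothesis HK : bounded_by Sigma K.
Variables C0 tau : R.
Hypothesis C0_gt0 : 0 < C0.
Hypothesis tau01 : 0 < tau < 1.
Hypothesis gapH : forall n M, (0 < n)%N -> word Sigma n M ->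
  singular_value i.+1 M <= C0 * tau ^+ n * singular_value i M.
Variables (W U : 'M[R]_d -> 'M[R]_(d, i)) (D : 'M[R]_d -> 'M[R]_i).
Hypothesis topH : forall M, M \in unitmx -> top_data M (W M) (U M) (D M).
Variables (theta : R) (N : nat).
Hypothesis theta_gt0 : 0 < theta.
Hypothesis theta_le1 : theta <= 1.
Hypothesis N0 : (0 < N)%N.
Hypothesis transv : forall n m A B, (N <= n)%N -> (N <= m)%N ->
  word Sigma n A -> word Sigma m B ->
  forall z, theta * enorm z <= enorm ((W A)^T *m (U B *m z)).

Let K0 : 0 < K := lt_le_trans ltr01 K1.
Let tau0 : 0 < tau. Proof. by case/andP: tau01. Qed.
Let taun n : 0 < tau ^+ n := exprn_gt0 n tau0.

Let word_top n M : word Sigma n M -> top_data M (W M) (U M) (D M).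
Proof. by move=> hM; apply: topH; exact: word_unit hGL hM. Qed.

Definition uniformly_transverse (a : R) (E : {vspace 'cV[R]_d}) := forall n M,
  (N <= n)%N -> word Sigma n M -> forall v, v \in E -> a * enorm v <= enorm ((W M)^T *m v).

(** The planes U B are [theta]-transverse; a third leaves room for errors both in [word_improves]
    and in the neighbourhoods of the block. *)
Definition margin := theta / 3.

Lemma margin_gt0 : 0 < margin. Proof. by rewrite divr_gt0. Qed.

Lemma near_transverse a eta M (E E' : {vspace 'cV[R]_d}) : M \in unitmx -> 0 <= a -> 
  (forall v, v \in E -> a * enorm v <= enorm ((W M)^T *m v)) -> gap eta E' E ->
  forall v, v \in E' -> (a - (a + 1) * eta) * enorm v <= enorm ((W M)^T *m v).
Proof.
move=> Mu a0 h hg v vE'; have := hg v vE'; set v' := oproj E *m v => hv.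
have := h v' (oproj_mem _ _); have := enorm_dist v v'.
have := frame_le (topW (topH Mu)) (v' - v); rewrite mulmxBr (enorm_distC v').
have := enorm_dist ((W M)^T *m v') ((W M)^T *m v).
have := enorm_ge0 v => v0 h1 h2 h3 h4.
have : a * (enorm v - enorm v') <= a * (eta * enorm v).
  by rewrite ler_wpM2l// (le_trans h3).
lra.
Qed.

(** The image of a transverse plane is within theta / 6 of the output plane of [w], which is
    [theta]-transverse. Two losses of theta / 6 leave 2 theta / 3. *)
Lemma word_improves m w (E : {vspace 'cV[R]_d}) : (N <= m)%N -> word Sigma m w ->
  C0 * tau ^+ m <= margin * (theta / 6) ->
  uniformly_transverse margin E -> uniformly_transverse (2 * margin) (mx_act w E).
Proof.
move=> Nm hw hm hE n M Nn hM _ /mx_actP[x xE ->]; have hT := word_top hw.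
have e0 := margin_gt0; set y := w *m x.
have h1 : enorm (y - U w *m (U w)^T *m y) <= theta / 6 * enorm y.
  apply: (le_trans (top_outer hT x)).
  have s0 := sv_ge0 w (ltn0Sn i).
  apply: (@le_trans _ _ (singular_value i.+1 w * enorm x)).
    by rewrite ler_wpM2l//; exact: (frame_coproj_le (topW hT)).
  have m0 : (0 < m)%N by exact: leq_trans Nm.
  apply: (@le_trans _ _ (C0 * tau ^+ m * singular_value i w * enorm x)).
    by rewrite ler_wpM2r// gapH.
  apply: (@le_trans _ _ (margin * (theta / 6) * singular_value i w * enorm x)).
    by rewrite !ler_wpM2r// sv_ge0.
  have h2 := hE _ _ Nm hw x xE; have h3 := proj1 (top_half hT) x.
  rewrite [leLHS](_ : _ = theta / 6 * (singular_value i w * (margin * enorm x))); last by ring.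
  rewrite ler_wpM2l ?divr_ge0 ?(ltW theta_gt0)//; apply: le_trans h3.
  by rewrite ler_wpM2l// sv_ge0.
have h4 := transv Nn Nm hM hw ((U w)^T *m y).
have h5 := frame_ge (topU hT) y.
have h6 := frame_le (topW (word_top hM)) (U w *m (U w)^T *m y - y).
rewrite mulmxBr enorm_distC in h6.
have h7 := enorm_dist ((W M)^T *m (U w *m (U w)^T *m y)) ((W M)^T *m y).
rewrite enorm_distC in h7; rewrite (enorm_distC _ y) in h6.
have y0 := enorm_ge0 y.
have h8 : theta * (enorm y - theta / 6 * enorm y) <= theta * enorm ((U w)^T *m y).
  by rewrite ler_wpM2l ?(ltW theta_gt0)//; lra.
have h9 : theta * (theta * enorm y) <= theta * enorm y.
  by rewrite ler_wpM2l ?(ltW theta_gt0)// ler_piMl.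
have eq := esym (mulmxA (U w) (U w)^T y); rewrite eq in h1 h5 h6 h7; rewrite /margin.
lra.
Qed.

(** Transversality of [E] to M w is pulled back by [w]. The part y2 of y in the kernel of (W M)^T
    contributes only O(tau^n), so for very long [M] the loss is bounded by powers of K. A single
    such [M] is all that the choice of F requires. *)
Lemma word_keeps m k w n M (E : {vspace 'cV[R]_d}) : (k <= m)%N -> word Sigma k w ->
  (N <= n)%N -> word Sigma n M -> C0 * K ^+ m ^+ 2 * tau ^+ n <= margin / 2 ->
  uniformly_transverse margin E -> forall y, y \in mx_act w E ->
  margin / (2 * K ^+ m ^+ 2) * enorm y <= enorm ((W M)^T *m y).
Proof.
move=> km hw Nn hM hn hE _ /mx_actP[x xE ->]; have hT := word_top hM.
have hMw := word_cat hM hw; have hT' := word_top hMw; have e0 := margin_gt0.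
have wu := word_unit hGL hw; have Mu := word_unit hGL hM.
have hb := word_bounded (ltW K0) HK hw.
have Kk : 0 < K ^+ k by rewrite exprn_gt0.
have Km : K ^+ k <= K ^+ m by rewrite ler_weXn2l.
have n0 : (0 < n)%N by exact: leq_trans Nn.
set y := w *m x; pose y1 := W M *m (W M)^T *m y; pose y2 := y - y1.
have ex : x = invmx w *m y1 + invmx w *m y2.
  by rewrite -mulmxDr /y2 addrC subrK mulKmx.
have nx : margin * enorm x <= enorm ((W (M *m w))^T *m x).
  by apply: hE hMw _ xE; exact: leq_trans (leq_addr _ _).
have b1 : enorm ((W (M *m w))^T *m (invmx w *m y1)) <= K ^+ k * enorm ((W M)^T *m y).
  apply: (le_trans (frame_le (topW hT') _)).
  by have := proj2 (hb (invmx w *m y1)); rewrite mulKVmx// {2}/y1 (frame_projE (topW hT)).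
have sM : 0 < singular_value i (M *m w).
  by apply: sv_gt0; [rewrite i0 ltnW|exact: word_unit hGL hMw].
have b2 : enorm ((W (M *m w))^T *m (invmx w *m y2)) <= C0 * tau ^+ n * K ^+ k * enorm y.
  rewrite -(ler_pM2l sM); apply: (le_trans (proj1 (top_half hT') _)).
  rewrite -mulmxA mulKVmx//.
  apply: (le_trans (top_high hT (frame_coproj_ker (topW hT) y))).
  have s1 := s_mulr i0 topH Kk Mu wu hb.
  apply: (@le_trans _ _ (C0 * tau ^+ n * singular_value i M * enorm y)).
    apply: ler_pM => //; [exact: sv_ge0|exact: gapH|exact: (frame_coproj_le (topW hT))].
  rewrite [leRHS](_ : _ = C0 * tau ^+ n * (K ^+ k * singular_value i (M *m w)) * enorm y);
    last by ring.
  by rewrite ler_wpM2r// ler_wpM2l// mulr_ge0 ?ltW.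
have hy := proj1 (hb x); rewrite -/y in hy.
have b3 : C0 * tau ^+ n * K ^+ k * enorm y <= margin / 2 * enorm x.
  apply: (@le_trans _ _ (C0 * K ^+ m ^+ 2 * tau ^+ n * enorm x)); last by rewrite ler_wpM2r.
  rewrite [leRHS](_ : _ = C0 * tau ^+ n * (K ^+ m ^+ 2 * enorm x)); last by ring.
  rewrite -mulrA ler_wpM2l//; first by rewrite mulr_ge0 ?ltW.
  rewrite expr2 -mulrA; apply: ler_pM => //; first exact: ltW.
  by apply: (le_trans hy); rewrite ler_wpM2r.
have b4 := enorm_triangle ((W (M *m w))^T *m (invmx w *m y1)) ((W (M *m w))^T *m (invmx w *m y2)).
rewrite -mulmxDr -ex in b4.
have b5 : margin / 2 * enorm x <= K ^+ m * enorm ((W M)^T *m y).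
  have : K ^+ k * enorm ((W M)^T *m y) <= K ^+ m * enorm ((W M)^T *m y) by rewrite ler_wpM2r.
  lra.
have Kmp : 0 < K ^+ m by exact: lt_le_trans Km.
rewrite mulrAC ler_pdivrMr ?mulr_gt0 ?exprn_gt0//.
have : margin * enorm y <= margin * (K ^+ m * enorm x).
  by rewrite ler_pM2l// (le_trans hy)// ler_wpM2r.
have : K ^+ m * (margin / 2 * enorm x) <= K ^+ m * (K ^+ m * enorm ((W M)^T *m y)).
  by rewrite ler_pM2l.
rewrite expr2; nra.
Qed.

Lemma exists_word A0 n : Sigma A0 -> exists M, word Sigma n M.
Proof.
move=> SA; elim: n => [|n [M hM]]; first by exists 1%:M; exact: word0.
by exists (A0 *m M); exact: wordS.
Qed.

Lemma gap2_refl a (E : {vspace 'cV[R]_d}) : 0 <= a -> gap2 a E E.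
Proof.
by move=> a0; split=> x xE; rewrite oproj_id// subrr enorm0 mulr_ge0.
Qed.

(* Words of length m improve the transversality of the uniformly transverse
   planes, but shorter words may not.  So C is made of neighbourhoods of the
   images of these planes under all words of length k < m, with radii that grow
   with k faster than the Lipschitz constant of the action. *)
Lemma attractor_block A0 : Sigma A0 -> exists (C : set (grass R d i)) (delta : R),
  [/\ C !=set0, 0 < delta, uniformly_invariant Sigma C delta &
      exists F : grass R d (d - i), forall E, C E -> transverse E F].
Proof.
move=> SA0; have e0 := margin_gt0.
have e13 : margin <= 3^-1 by rewrite /margin -[leRHS]mul1r ler_wpM2r// invr_ge0.
have [m [Nm hm]] : exists m, (N <= m)%N /\ C0 * tau ^+ m <= margin * (theta / 6).
  have [|m0 hm0] := geo_lt_eps (ltW C0_gt0) tau01 (e := margin * (theta / 6)).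
    by rewrite mulr_gt0// divr_gt0.
  by exists (maxn m0 N); rewrite leq_maxr; split=> //; rewrite ltW// hm0// leq_maxl.
have m_gt0 : (0 < m)%N by exact: leq_trans Nm.
have Km : 1 <= K ^+ m by rewrite exprn_ege1.
have K2m : 1 <= K ^+ m ^+ 2 by rewrite exprn_ege1.
(* The transversality left by [word_keeps] after fewer than m letters; all radii below are at most
   eps2 / 6, so the neighbourhoods do not destroy it. *)
pose eps2 := margin / (2 * K ^+ m ^+ 2).
have K2m0 : 0 < 2 * K ^+ m ^+ 2 by rewrite mulr_gt0// (lt_le_trans ltr01).
have e2_gt0 : 0 < eps2 by rewrite divr_gt0.
have e2_le : eps2 <= margin by rewrite ler_pdivrMr//; apply: ler_peMr; [exact: ltW|lra].
(* A letter multiplies gaps by at most K^2. The extra 1 makes the next radius exceed the image of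
   the previous one by at least [eps1], which is the margin of strict invariance. *)
pose L := K ^+ 2 + 1; have L1 : 1 <= L by rewrite lerDr exprn_ge0// ltW.
have L0 : 0 < L by exact: lt_le_trans L1.
pose eps1 := eps2 / 6 / L ^+ m.
have e1_gt0 : 0 < eps1 by rewrite !divr_gt0// exprn_gt0.
have e1L k : (k <= m)%N -> eps1 * L ^+ k <= eps2 / 6.
  move=> km; rewrite /eps1 mulrAC ler_pdivrMr ?exprn_gt0// ler_pM2l ?divr_gt0//.
  exact: ler_weXn2l.
have eta0 k : 0 <= eps1 * L ^+ k by rewrite mulr_ge0 ?exprn_ge0// ltW.
pose C : set (grass R d i) := [set E | exists k w (E0 : grass R d i),
  [/\ (k < m)%N, word Sigma k w, uniformly_transverse margin E0 &
      gap2 (eps1 * L ^+ k) E (mx_act w E0)]].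
have inC E : uniformly_transverse margin (plane E) -> C E.
  move=> hE; exists 0%N, 1%:M, E; split=> //; first exact: word0.
  by rewrite mx_act1; exact: gap2_refl.
have [B hB] := exists_word N SA0.
exists C, (eps1 / ((d * d)%:R + 1)); split.
- have dU : \dim (col_space (U B)) == i by rewrite (dim_col_space (topU (word_top hB))).
  exists (Grass dU); apply: inC => n M Nn hM _ /col_spaceP[z ->].
  rewrite (enorm_iso _ (topU (word_top hB))).
  apply: le_trans (transv Nn (leqnn _) hM hB z); rewrite ler_wpM2r//.
  by rewrite /margin ler_pdivrMr//; apply: ler_peMr; [exact: ltW theta_gt0|rewrite ler1n].
- by rewrite divr_gt0// ltr_wpDl.
- move=> A E E' E'' SA [k [w [E0 [km hw hE0 hE]]]] hE' /ball_gap hball.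
  have De : (d * d)%:R * (eps1 / ((d * d)%:R + 1)) <= eps1.
    by rewrite mulrCA ger_pMr// ler_pdivrMr ?mul1r ?lerDl// ltr_wpDl.
  have g1 := gap2_sym (gap2_le De hball).
  have g2 : gap2 (K ^+ 2 * (eps1 * L ^+ k)) E' (mx_act (A *m w) E0).
    rewrite hE' mx_act_mul; apply: gap2_act => //; first exact: ltW.
    by move=> x; exact: HK.
  have K20 : 0 <= K ^+ 2 * (eps1 * L ^+ k) by rewrite mulr_ge0// exprn_ge0// ltW.
  have g3 := gap2_trans (ltW e1_gt0) K20 g1 g2.
  have g4 : gap2 (eps1 * L ^+ k.+1) E'' (mx_act (A *m w) E0).
    apply: gap2_le g3.
    rewrite [leRHS](_ : _ = eps1 * L ^+ k + K ^+ 2 * (eps1 * L ^+ k)); last first.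
      by rewrite exprS {1}/L; move: (L ^+ k) => q; ring.
    by rewrite lerD2r; apply: ler_peMr; [exact: ltW|rewrite exprn_ege1].
  have hAw := wordS SA hw.
  move: km; rewrite leq_eqVlt => /orP[/eqP km|km]; last first.
    by exists k.+1, (A *m w), E0; split.
  (* After m letters [word_improves] yields 2 [margin]; the neighbourhood costs at most one
     [margin], so E'' itself restarts at k = 0. *)
  apply: inC => n M Nn hM v vE.
  rewrite km in hAw g4; have hE2 := word_improves Nm hAw hm hE0.
  have e22 : 0 <= 2 * margin by rewrite mulr_ge0// ltW.
  have := near_transverse (word_unit hGL hM) e22 (hE2 n M Nn hM) (proj1 g4) vE.
  apply: le_trans; rewrite ler_wpM2r//.
  have := e1L m (leqnn _); have := eta0 m; move: (eps1 * L ^+ m) => eta h1 h2.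
  have : 2 * margin * eta <= eta by rewrite ler_piMl//; lra.
  lra.
- have cK0 : 0 <= C0 * K ^+ m ^+ 2.
    by apply: mulr_ge0; [exact: ltW|exact: le_trans ler01 K2m].
  have [|n0 hn0] := geo_lt_eps cK0 tau01 (e := margin / 2); first by rewrite divr_gt0.
  pose n := maxn n0 N; have [M hM] := exists_word n SA0.
  have hn : C0 * K ^+ m ^+ 2 * tau ^+ n <= margin / 2 by rewrite ltW// hn0// leq_maxl.
  have dF : \dim (kerspace (W M)^T) == (d - i)%N.
    by rewrite (dim_frame_ker (topW (word_top hM)) (ltnW id)).
  exists (Grass dF) => E [k [w [E0 [km hw hE0 hE]]]].
  apply/transverseP => x xE; rewrite mem_kerspace => /eqP hx.
  have h := word_keeps (ltnW km) hw (leq_maxr n0 N) hM hn hE0.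
  have := near_transverse (word_unit hGL hM) (ltW e2_gt0) h (proj1 hE) xE.
  rewrite hx enorm0 pmulr_rle0 => [h1|].
    by apply/eqP; rewrite -enorm_eq0 eq_le h1 enorm_ge0.
  have := e1L k (ltnW km); have := eta0 k; move: (eps1 * L ^+ k) => eta h1 h2.
  have : eps2 * eta <= eta by rewrite ler_piMl//; lra.
  rewrite /eps2 -/eps2; lra.
Qed.

End AttractorBlock.

(** * From domination to an invariant family of planes *)

Section DominatedToFamily.
Variables (R : realType) (d i : nat) (Sigma : set 'M[R]_d).
Hypothesis hi : (1 <= i <= d - 1)%N.
Hypothesis hGL : Sigma `<=` GL R d.

Lemma dominated_plane_family K : 1 <= K -> bounded_by Sigma K -> dominated i Sigma ->
  exists C : set (grass R d i),
    [/\ C !=set0, strictly_invariant Sigma C &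
        exists F : grass R d (d - i), forall E, C E -> transverse E F].
Proof.
move=> K1 HK [C0 [tau [C0_gt0 tau01 hdom]]].
have i0 : (0 < i)%N by case/andP: hi.
have id := index_lt hi.
have gapH n M : (0 < n)%N -> word Sigma n M ->
    singular_value i.+1 M <= C0 * tau ^+ n * singular_value i M.
  move=> n0 hM; have [A SA eM] := prod_word hM.
  have := hdom n A n0 SA; rewrite -eM => /ltW.
  by rewrite ler_pdivrMr// sv_gt0 ?i0 ?(ltnW id)// (word_unit hGL hM).
have /choice[T hT] : forall M : 'M[R]_d,
    exists T : 'M[R]_(d, i) * 'M[R]_(d, i) * 'M[R]_i,
      M \in unitmx -> top_data M T.1.1 T.1.2 T.2.
  move=> M; have [Mu|Mu] := boolP (M \in unitmx); last by exists (0, 0, 0).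
  have i0d : (0 < i <= d)%N by rewrite i0 ltnW.
  have [W [U [D hD]]] := top_dataP i0d (sv_gt0 i0d Mu).
  by exists (W, U, D).
pose W M := (T M).1.1; pose U M := (T M).1.2; pose D M := (T M).2.
have topH M : M \in unitmx -> top_data M (W M) (U M) (D M) by exact: hT.
(* Without letters there are no long words, but strict invariance is vacuous; any plane with a
   transverse complement will do, here those of the identity. *)
have [[A0 SA0]|nS] := pselect (exists A0, Sigma A0); last first.
  have h1 := topH _ (unitmx1 _ _).
  have dE : \dim (col_space (W 1%:M)) == i by rewrite (dim_col_space (topW h1)).
  have dF : \dim (kerspace (W 1%:M)^T) == (d - i)%N.
    by rewrite (dim_frame_ker (topW h1) (ltnW id)).
  exists [set Grass dE]; split; first by exists (Grass dE).
    apply/strictly_invariantP; exists 1 => // A E E' E'' SA.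
    by case: nS; exists A.
  by exists (Grass dF) => _ ->; exact: (frame_transverse (topW h1)).
have [theta [N [th0 th1 N0 htr]]] := transversality_uniform i0 id hGL K1 HK C0_gt0 tau01 gapH topH.
have [C [delta [C1 dl hC hF]]] := attractor_block i0 id hGL K1 HK C0_gt0 tau01 gapH topH th0 th1 N0 htr SA0.
by exists C; split=> //; apply/strictly_invariantP; exists delta.
Qed.

End DominatedToFamily.

Theorem theorem2 (R : realType) (d i : nat) (hi : (1 <= i <= d - 1)%N)
    (Sigma : set 'M[R]_d) (hGL : Sigma `<=` GL R d) (hK : compact Sigma) :
  [<-> dominated i Sigma;
       forall (X : topologicalType) (T : X -> X) (A : X -> 'M[R]_d),
         compact [set: X] -> hausdorff_space X -> homeomorphism T ->
         continuous A -> range A `<=` Sigma ->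
         has_dominated_splitting i T A;
       exists C : set (grass R d i),
         [/\ C !=set0, strictly_invariant Sigma C &
             exists F : grass R d (d - i), forall E, C E -> transverse E F];
       exists C : set (grass R d 1),
         [/\ strictly_invariant Sigma C,
             exists E : grass R d i, proj_set E `<=` C &
             exists F : grass R d (d - i), C `&` proj_set F = set0]].
Proof.
have [K K1 HK] := compact_GL_bounded hGL hK.
(* The hard step is used twice: (a) gives (b) through the cone of its planes, and (b) gives (c) by
   first returning to (a) with the full shift. *)
have cone_of_dominated : dominated i Sigma -> has_cone Sigma i.
  by move=> /(dominated_plane_family hi hGL K1 HK) /(plane_family_has_cone hGL).
split.
  by move=> /cone_of_dominated hc X T A _ _ hT cA rA; exact: (has_cone_splitting hi hGL K1 HK hT cA rA hc).
split.
  move=> /(dominated_splitting_dominated hi hGL hK).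
  exact: (dominated_plane_family hi hGL K1 HK).
split.
  by move=> /(plane_family_has_cone hGL); exact: has_cone_line_family.
by move=> /(line_family_has_cone hGL); exact: (has_cone_dominated hi hGL K1 HK).
Qed.
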